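(* Let $\delta\in\mathbb{Z}$ and $\lambda\in\mathbb{C}$, and let $A(w_0,\delta,\lambda)$ be the long intertwining operator of the minimal principal series $I(\chi_{\delta,\lambda})$ of $SU(2,1)$ (given by the convergent integral in the context for $\mathrm{Re}\,\lambda$ large, and by meromorphic continuation in $\lambda$ otherwise). Then $A(w_0,\delta,\lambda)$ acts on each basis vector $W^{(j,n)}_{m_1,m_2}$ of $I(\chi_{\delta,\lambda})$ (so $m_2=\frac{n+\delta}{3}$) as multiplication by a scalar: as meromorphic functions of $\lambda$, $$A(w_0,\delta,\lambda)\,W^{(j,n)}_{m_1,m_2}=[A(w_0,\delta,\lambda)]_{m_2}\,W^{(j,n)}_{m_1,m_2},$$ where $$[A(w_0,\delta,\lambda)]_{m_2}=\frac{\pi^2\,2^{-\lambda-1}\,\Gamma(\lambda)}{\Gamma\left(1-\frac{\lambda-\delta}{2}\right)\Gamma\left(1-\frac{\lambda+\delta}{2}\right)}\cdot\frac{\Gamma\left(j+m_2-\frac{\lambda+\delta}{2}+1\right)\Gamma\left(j-m_2-\frac{\lambda-\delta}{2}+1\right)}{\Gamma\left(j+m_2+\frac{\lambda-\delta}{2}+1\right)\Gamma\left(j-m_2+\frac{\lambda+\delta}{2}+1\right)}.$$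
   Context: **Group.** $G=SU(2,1)=\{g\in SL(3,\mathbb{C}) : \bar g^{t}Jg=J\}$ with $J=\mathrm{diag}(1,1,-1)$. The maximal compact subgroup is $K=\{\mathrm{diag}(A,\det(A)^{-1}) : A\in U(2)\}$, identified with $U(2)$. Let $E_{ab}$ be the matrix units, $U_0=\frac12\mathrm{diag}(i,i,-2i)$, $U_3=\frac12\mathrm{diag}(i,-i,0)$. Let $M=\{e^{-t(U_0-3U_3)}=\mathrm{diag}(e^{it},e^{-2it},e^{it}) : t\in\mathbb{R}\}$, $A_0=\{e^{s(E_{13}+E_{31})} : s\in\mathbb{R}\}$, and let $N$ be the analytic subgroup with Lie algebra $$\left\{\begin{pmatrix} iw&z&-iw\\-\bar z&0&\bar z\\ iw&z&-iw\end{pmatrix} : z\in\mathbb{C},\,w\in\mathbb{R}\right\}.$$ **Principal series.** For $\delta\in\mathbb{Z}$, $\lambda\in\mathbb{C}$, $I(\chi_{\delta,\lambda})$ is the space of smooth $K$-finite functions $f:G\to\mathbb{C}$ with $$f\left(g\,e^{-t(U_0-3U_3)}e^{s(E_{13}+E_{31})}n\right)=e^{-i\delta t-(\lambda+2)s}f(g)\qquad(t,s\in\mathbb{R},\ n\in N),$$ with $G$ acting by left translation. By $G=KA_0N$, such $f$ is determined by its restriction to $K$. **Wigner functions.** For $j\in\frac12\mathbb{Z}_{\ge0}$, $n\in\frac12\mathbb{Z}$ with $j+n\in\mathbb{Z}$, let $\pi_{j,n}$ be the irreducible representation of $U(2)$ on homogeneous polynomials of degree $2j$ in $z=(z_1,z_2)^t$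 given by $\pi_{j,n}(g)f(z)=(\det g)^{j+n}f(g^{-1}z)$. It has basis $v^j_m=\frac{z_1^{j-m}z_2^{j+m}}{\sqrt{(j-m)!(j+m)!}}$, $m\in\{-j,-j+1,\dots,j\}$, which is declared orthonormal for a Hermitian inner product $\langle\cdot,\cdot\rangle$, linear in the first and conjugate linear in the second argument. Put $W^{(j,n)}_{m_1,m_2}(k)=\langle v^j_{m_1},\pi_{j,n}(k)v^j_{m_2}\rangle$ for $k\in K\cong U(2)$, $m_1,m_2\in\{-j,\dots,j\}$. Restriction to $K$ identifies $I(\chi_{\delta,\lambda})$ with the algebraic span of the $W^{(j,n)}_{m_1,m_2}$ satisfying $-n+3m_2=\delta$; each such $W^{(j,n)}_{m_1,m_2}$ is regarded as an element of $I(\chi_{\delta,\lambda})$ for every $\lambda$ through this identification. **Intertwining operator.** Let $w_0=\mathrm{diag}(-1,-1,1)\in K$ represent the nontrivial element of the restricted Weyl group; $w_0\chi_{\delta,\lambda}=\chi_{\delta,-\lambda}$. Let $c=\exp\left(\frac{\pi}{4}(E_{31}-E_{13})\right)$ and $$\overline N=\left\{\bar n(z,w)=c\begin{pmatrix}1&0&0\\ \sqrt2\,z&1&0\\ |z|^2-2iw&\sqrt2\,\bar z&1\end{pmatrix}c^{-1} : z\in\mathbb{C},\,w\in\mathbb{R}\right\},$$ with Haar measure $d\bar n=dx\,dy\,dw$, $z=x+iy$; here $\overline N\cap w_0^{-1}Nw_0=\overline N$. The long intertwining operator $A(w_0,\delta,\lambda):I(\chi_{\delta,\lambda})\to I(w_0\chi_{\delta,\lambda})$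 is $$(A(w_0,\delta,\lambda)f)(g)=\int_{\overline N}f(g\,w_0\,\bar n)\,d\bar n,$$ which converges for $\mathrm{Re}\,\lambda$ sufficiently large and is extended meromorphically in $\lambda$ (acting on the fixed space of $K$-finite functions spanned by the $W^{(j,n)}_{m_1,m_2}$ with $-n+3m_2=\delta$). In the equation for $A(w_0,\delta,\lambda)W^{(j,n)}_{m_1,m_2}$, source and target vectors are identified with functions on $K$ in this way. *)

(* Defs.v *)
From HB Require Import structures.
From mathcomp Require Import all_boot all_order all_algebra.
From mathcomp Require Import all_classical all_reals all_analysis.
From mathcomp Require Import complex.
(* The notations of mpoly.v clash with those of mathcomp-analysis. *)
From mathcomp Require Import -(notations) mpoly.

Set Implicit Arguments.
Unset Strict Implicit.
Unset Printing Implicit Defensive.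

Import Order.TTheory GRing.Theory Num.Theory.
Import numFieldNormedType.Exports.

Local Open Scope classical_set_scope.
Local Open Scope complex_scope.
Local Open Scope ring_scope.

(* The topology of the complex numbers R[i] is carried by its alias (R[i])^o,
   hence the casts to (R[i])^o wherever limits or derivatives are taken. *)

Section ComplexFunctions.
Context {R : realType}.
Local Notation C := R[i].

Definition cexp (z : C) : C :=
  (expR (complex.Re z))%:C * (cos (complex.Im z) +i* sin (complex.Im z)).

(* x ^ z for a real base x > 0 *)
Definition cpow (x : R) (z : C) : C := cexp (z * (ln x)%:C).

Definition cintegrable d (T : measurableType d)
    (mu : {measure set T -> \bar R}) (D : set T) (h : T -> C) : Prop :=
  mu.-integrable D (fun x => (complex.Re (h x))%:E) /\
  mu.-integrable D (fun x => (complex.Im (h x))%:E).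

Definition cintegral d (T : measurableType d)
    (mu : {measure set T -> \bar R}) (D : set T) (h : T -> C) : C :=
  (\int[mu]_(x in D) complex.Re (h x)) +i* (\int[mu]_(x in D) complex.Im (h x)).

Definition euler_integral (z : C) : C :=
  cintegral lebesgue_measure `]0, +oo[ (fun t : R =>
    cpow t (z - 1) * (expR (- t))%:C).

(* Gamma z = Gamma (z + p) / (z (z + 1) ... (z + p - 1)), where p is the least
   natural number such that Re (z + p) > 0.  At the poles z = 0, -1, -2, ... one
   factor of the product vanishes, so that both Gamma z and (Gamma z)^-1 are 0;
   the latter is the value at z of the entire function 1 / Gamma. *)
Definition Gamma (z : C) : C :=
  let p := Num.truncn (1 - complex.Re z) in
  euler_integral (z + p%:R) / \prod_(i < p) (z + i%:R).

Definition holomorphic_near (z0 : C) (h : C -> C) : Prop :=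
  \forall z \near (z0 : C^o), derivable (h : C^o -> C^o) z 1.

(* Meromorphic functions on the whole plane are represented by total functions
   whose values on a discrete closed set are irrelevant. *)
Definition meromorphic (f : C -> C) : Prop :=
  forall z0 : C, exists (p : nat) (h : C -> C), holomorphic_near z0 h /\
    \forall z \near (z0 : C^o)^', f z = h z / (z - z0) ^+ p.

(* Equality, as meromorphic functions of z, of two families of functions on D *)
Definition mero_eq T (D : set T) (F1 F2 : C -> T -> C) : Prop :=
  forall z0 : C, \forall z \near (z0 : C^o)^', forall x, D x -> F1 z x = F2 z x.

End ComplexFunctions.

Section SU21.
Context {R : realType}.
Local Notation C := R[i].
Local Notation M3 := 'M[C]_3.

Definition expmx (X : M3) : M3 :=
  limn (fun n => \sum_(0 <= k < n) (k`!%:R^-1 *: X ^+ k) : 'M[C^o]_3).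

Definition adjmx n (A : 'M[C]_n) : 'M[C]_n := map_mx Num.conj A^T.

Definition diag3 (a b c : C) : M3 := diag_mx (\row_(i < 3) [:: a; b; c]`_i).

Definition mx3 (rows : seq (seq C)) : M3 :=
  \matrix_(i < 3, j < 3) (nth [::] rows i)`_j.

(* The matrix units, with indices starting from 1 *)
Definition Emx (a b : nat) : M3 := delta_mx (inord a.-1) (inord b.-1).

Definition Jmx : M3 := diag3 1 1 (- 1).

Definition SU21 : set M3 :=
  [set g | \det g = 1 /\ adjmx g *m Jmx *m g = Jmx].

Definition su21 : set M3 :=
  [set X | \tr X = 0 /\ adjmx X *m Jmx + Jmx *m X = 0].

Definition U2 : set 'M[C]_2 := [set A | adjmx A *m A = 1%:M].

Definition Kgrp : set M3 :=
  [set k | exists2 A : 'M[C]_2, U2 A &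
             k = block_mx A 0 0 ((\det A)^-1)%:M :> 'M[C]_(2 + 1)].

Definition toU2 (k : M3) : 'M[C]_2 := ulsubmx (k : 'M[C]_(2 + 1)).

Definition U0 : M3 := 2^-1 *: diag3 'i 'i (- (2 * 'i)).
Definition U3 : M3 := 2^-1 *: diag3 'i (- 'i) 0.

Definition m_ (t : R) : M3 := expmx (- t%:C *: (U0 - 3 *: U3)).
Definition a_ (s : R) : M3 := expmx (s%:C *: (Emx 1 3 + Emx 3 1)).

Definition lie_n : set M3 :=
  [set X | exists (z : C) (w : R), let iw := 'i * w%:C in
     X = mx3 [:: [::     iw; z;     - iw];
                 [:: - z^*; 0;       z^*];
                 [::     iw; z;     - iw]] ].

Definition matrix_subgroup (H : set M3) : Prop :=
  [/\ H 1%:M,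
      forall g h, H g -> H h -> H (g *m h)
    & forall g, H g -> H (invmx g)].

(* The analytic subgroup with Lie algebra lie_n is the subgroup generated by
   the exponentials of the elements of lie_n. *)
Definition Ngrp : set M3 := smallest matrix_subgroup (expmx @` lie_n).

(* Functions on the group are represented by functions on all matrices, of
   which only the values on SU21 matter.  Such a function is C^k when its
   iterated derivatives of order <= k along left invariant vector fields,
     (X f)(g) = d/dt f(g exp(tX)) at t = 0   (X in su21),
   exist and are continuous on SU21 (these fields span all tangent spaces). *)
Definition left_invariant_derivative (X : M3) (f h : M3 -> C) : Prop :=
  forall g, SU21 g ->
    let phi (t : R) := f (g *m expmx (t%:C *: X)) in
    is_derive (0 : R) (1 : R) (fun t => complex.Re (phi t))
      (complex.Re (h g)) /\
    is_derive (0 : R) (1 : R) (fun t => complex.Im (phi t))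
      (complex.Im (h g)).

Fixpoint class_C (k : nat) (f : M3 -> C) : Prop :=
  {within SU21 : set 'M[C^o]_3, continuous (f : 'M[C^o]_3 -> C^o)} /\
  if k is k'.+1 then
    forall X, su21 X -> exists2 h, left_invariant_derivative X f h & class_C k' h
  else True.

Definition smooth (f : M3 -> C) : Prop := forall k, class_C k f.

(* The left translates of f by K span a finite dimensional space. *)
Definition K_finite (f : M3 -> C) : Prop :=
  exists (d : nat) (e : 'I_d -> M3 -> C), forall k, Kgrp k ->
    exists c : 'I_d -> C, forall g, SU21 g ->
      f (invmx k *m g) = \sum_(i < d) c i * e i g.

(* I(chi_{delta, lambda}) *)
Definition principal_series (delta : int) (lambda : C) : set (M3 -> C) :=
  [set f | [/\ smooth f, K_finite f &
    forall g (t s : R) n, SU21 g -> Ngrp n ->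
      f (g *m m_ t *m a_ s *m n) =
      cexp (- ('i * delta%:~R * t%:C) - (lambda + 2) * s%:C) * f g]].

Definition w0 : M3 := diag3 (- 1) (- 1) 1.

Definition c_ : M3 := expmx ((pi / 4)%:C *: (Emx 3 1 - Emx 1 3)).

Definition nbar (z : C) (w : R) : M3 :=
  let sqrt2 := (Num.sqrt 2)%:C in
  c_ *m mx3 [:: [:: 1;                         0;                   0];
                [:: sqrt2 * z;                 1;                   0];
                [:: `|z| ^+ 2 - 2 * 'i * w%:C; sqrt2 * z^*;         1]]
     *m invmx c_.

(* dx dy dw *)
Local Notation dnbar :=
  ((@lebesgue_measure R \x @lebesgue_measure R) \x @lebesgue_measure R)%E.

Definition intertwining_integrand (f : M3 -> C) (g : M3) (p : R * R * R) : C :=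
  f (g *m w0 *m nbar (p.1.1 +i* p.1.2) p.2).

Definition intertwining_converges (f : M3 -> C) (g : M3) : Prop :=
  cintegrable dnbar setT (intertwining_integrand f g).

Definition intertwining_integral (f : M3 -> C) (g : M3) : C :=
  cintegral dnbar setT (intertwining_integrand f g).

End SU21.

Section Wigner.
Context {R : realType}.
Local Notation C := R[i].
Local Notation polyz := (mpoly 2 C).

Definition z1 : polyz := mpolyX C (mnm1 (0 : 'I_2)).
Definition z2 : polyz := mpolyX C (mnm1 (1 : 'I_2)).

(* j in (1/2) Z_{>= 0} *)
Definition is_spin (j : rat) : bool := (0 <= j) && (2 * j \is a Num.int).

(* m in {-j, -j + 1, ..., j} *)
Definition is_weight (j m : rat) : bool :=
  [&& - j <= m, m <= j & m + j \is a Num.int].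

Definition vbasis_ (j m : rat) : polyz :=
  let a := Num.truncn (j - m) in let b := Num.truncn (j + m) in
  (Num.sqrt (a`! * b`!)%:R : R)%:C^-1 *: (z1 ^+ a * z2 ^+ b).

(* The monomials z1 ^ a z2 ^ b are orthogonal, of squared norm a! b!; that is,
   the vectors vbasis_ j m are orthonormal. *)
Definition inner (p q : polyz) : C :=
  \sum_(u <- msupp p)
    ((u (0 : 'I_2))`! * (u (1 : 'I_2))`!)%:R * mcoeff u p * (mcoeff u q)^*.

Definition subst_lin (A : 'M[C]_2) (p : polyz) : polyz :=
  comp_mpoly [tuple A i 0 *: z1 + A i 1 *: z2 | i < 2] p.

(* (det A) ^ (j + n) p (A^-1 z) *)
Definition pi_ (j n : rat) (A : 'M[C]_2) (p : polyz) : polyz :=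
  (\det A ^ Num.floor (j + n)) *: subst_lin (invmx A) p.

Definition wigner (j n m1 m2 : rat) (k : 'M[C]_3) : C :=
  inner (vbasis_ j m1) (pi_ j n (toU2 k) (vbasis_ j m2)).

(* The indices of the functions wigner j n m1 m2 in I(chi_{delta, lambda}) *)
Definition wigner_index (delta : int) (j n m1 m2 : rat) : Prop :=
  [/\ is_spin j, 2 * n \is a Num.int, j + n \is a Num.int,
      is_weight j m1 /\ is_weight j m2 & - n + 3 * m2 = delta%:~R].

(* Restrictions to K of the elements of I(chi_{delta, lambda}), for any lambda *)
Definition wigner_span (delta : int) : set ('M[C]_3 -> C) :=
  [set phi | exists (r : nat) (c : 'I_r -> C) (j n m1 m2 : 'I_r -> rat),
     (forall i, wigner_index delta (j i) (n i) (m1 i) (m2 i)) /\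
     forall k, Kgrp k ->
       phi k = \sum_(i < r) c i * wigner (j i) (n i) (m1 i) (m2 i) k].

(* A lambda is the operator A(w_0, delta, lambda), in terms of the restrictions
   to K of elements of I(chi_{delta, lambda}) and I(chi_{delta, - lambda}): it
   is given by the convergent integral for Re lambda large, and depends
   meromorphically on lambda.  By uniqueness of meromorphic continuation, this
   determines the meromorphic functions A ^~ phi k of lambda. *)
Definition long_intertwining_operator (delta : int)
    (A : C -> ('M[C]_3 -> C) -> ('M[C]_3 -> C)) : Prop :=
  [/\ forall lambda phi,
        wigner_span delta phi -> wigner_span delta (A lambda phi),
      exists sigma : R, forall lambda, sigma < complex.Re lambda ->
        forall f phi, principal_series delta lambda f ->
        wigner_span delta phi -> (forall k, Kgrp k -> f k = phi k) ->
        forall k, Kgrp k -> intertwining_converges f k /\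
          A lambda phi k = intertwining_integral f k
    & forall phi k, wigner_span delta phi -> Kgrp k ->
        meromorphic (fun lambda => A lambda phi k)].

(* [A(w_0, delta, lambda)]_{m2} on the K-types with highest weight j *)
Definition intertwining_scalar (delta : int) (j m2 : rat) (lambda : C) : C :=
  let d : C := delta%:~R in
  let j' : C := ratr j in
  let m : C := ratr m2 in
  (pi ^+ 2)%:C * cpow 2 (- lambda - 1) * Gamma lambda
    / (Gamma (1 - (lambda - d) / 2) * Gamma (1 - (lambda + d) / 2))
  * (Gamma (j' + m - (lambda + d) / 2 + 1) * Gamma (j' - m - (lambda - d) / 2 + 1)
    / (Gamma (j' + m + (lambda - d) / 2 + 1) * Gamma (j' - m + (lambda + d) / 2 + 1))).

End Wigner.

(* Main.v *)
(* Write nbar(z, w) = kappa a_s n with kappa in K and n in N, and put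
   u = |z|^2 - 2 i w, zeta = (1 - u) / (1 + u), e^(i theta) = conj(1 + u) / |1 + u|.
   Then s = log |1 + u|, and kappa is the element of U(2) with first column
   (zeta e^(-i theta), 2 z / |1 + u|) and determinant e^(i theta).  Expanding
   W(k w_0 kappa) binomially gives a combination of Wigner functions at k whose
   coefficients are monomials in the entries of kappa.  Since the measure is
   invariant under z -> e^(i t) z, only the multiples of W(k) survive
   integration; hence A(w_0) acts by a scalar, namely the integral of
   e^(- (lambda + 2) s + i delta theta) P(zeta), where P is a Zernike
   polynomial.

   The three-term recurrence of the Zernike polynomials reduces this integral to
   the case P = 1, because multiplication by e^(-s + i theta) = (1 + zeta) / 2
   shifts (lambda, delta) to (lambda + 1, delta + 1).  The case P = 1 is Cauchy's
   integral of (1 + i t)^(-p) (1 - i t)^(-q), which is evaluated by the Gaussian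
   integral for delta = 0, and for other delta by the same shifts.

   The scalar is a rational function of lambda times the value for P = 1, which
   is holomorphic in a half plane and satisfies a functional equation under
   lambda -> lambda + 2; this gives the meromorphic continuation. *)

Require Import Defs.
From HB Require Import structures.
From mathcomp Require Import all_boot all_order all_algebra.
From mathcomp Require Import all_classical all_reals all_analysis.
From mathcomp Require Import measurable_realfun ring lra zify.
From mathcomp Require Import complex.
From mathcomp Require Import -(notations) mpoly.

Local Open Scope classical_set_scope.
Local Open Scope ring_scope.

(** The Gaussian integral gives Cauchy's integral for [delta = 0] as sqrt(pi) Gamma(kappa - 1/2) /
    Gamma(kappa) with kappa = lambda/2 + 1, whereas the formula contains Gamma(lambda) over a
    product of two values near lambda/2. The gap is the duplication formula. It comes from the fact
    that Gamma(x)^2 / Gamma(2x) is, up to a power of 2, again Cauchy's integral; the same relation,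
    read as a halving of the argument, excludes zeros of Gamma, which makes division by its values
    legitimate.

    The parameter delta reaches the integral through the index relation - n + 3 m2 = delta: this
    number is the exponent of e^(i theta) in exactly those terms of the binomial expansion that
    survive the rotation.

    The operator has to be a function of phi, although its formula refers to an expansion of phi in
    Wigner functions. An expansion is therefore chosen once for each phi, and the result must be
    shown not to depend on it.

    Every exchange of integrals rests on a majorant that is a product of factors 1/(1 + t^2), which
    explains the generous lower bounds on Re lambda. *)

Module Proofs.
Set Implicit Arguments.
Unset Strict Implicit.
Unset Printing Implicit Defensive.
Import Order.TTheory GRing.Theory Num.Theory.
Import numFieldNormedType.Exports.
Local Open Scope complex_scope.
Local Open Scope ring_scope.
Import Normc.
Local Notation Re := complex.Re.
Local Notation Im := complex.Im.

(** * Complex-valued integrals *)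

Section ComplexNumbers.
Context {R : realType}.
Local Notation C := R[i].
Implicit Types (z w : C) (x y : R).

Lemma complex_eqP z w : Re z = Re w -> Im z = Im w -> z = w.
Proof. by case: z w => [a b] [c d] /= -> ->. Qed.

Lemma cReD z w : Re (z + w) = Re z + Re w. Proof. by case: z w => ? ? []. Qed.
Lemma cImD z w : Im (z + w) = Im z + Im w. Proof. by case: z w => ? ? []. Qed.
Lemma cReN z : Re (- z) = - Re z. Proof. by case: z. Qed.
Lemma cImN z : Im (- z) = - Im z. Proof. by case: z. Qed.
Lemma cReM z w : Re (z * w) = Re z * Re w - Im z * Im w.
Proof. by case: z w => ? ? []. Qed.
Lemma cImM z w : Im (z * w) = Re z * Im w + Im z * Re w.
Proof. by case: z w => ? ? []. Qed.
Lemma Re_realc x : Re x%:C = x. Proof. by []. Qed.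
Lemma Im_realc x : Im x%:C = 0. Proof. by []. Qed.

Lemma realcD x y : (x + y)%:C = x%:C + y%:C. Proof. exact: rmorphD. Qed.
Lemma realcN x : (- x)%:C = - x%:C. Proof. exact: rmorphN. Qed.
Lemma realcM x y : (x * y)%:C = x%:C * y%:C. Proof. exact: rmorphM. Qed.
Lemma realcV x : (x^-1)%:C = x%:C^-1. Proof. exact: fmorphV. Qed.
Lemma realcX x n : (x ^+ n)%:C = x%:C ^+ n. Proof. exact: rmorphXn. Qed.
Lemma realc_nat n : (n%:R : R)%:C = n%:R. Proof. exact: rmorph_nat. Qed.

Definition realcE := (realcD, realcN, realcM, realcV, realc_nat).

Lemma Re_mk x y : Re (x +i* y) = x. Proof. by []. Qed.
Lemma Im_mk x y : Im (x +i* y) = y. Proof. by []. Qed.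

Definition ReImE :=
  (cReD, cImD, cReN, cImN, cReM, cImM, Re_realc, Im_realc, Re_mk, Im_mk).

Lemma normr_Re_le z : `|Re z| <= normc z.
Proof.
case: z => a b /=; rewrite -sqrtr_sqr ler_sqrt ?addr_ge0 ?sqr_ge0//.
by rewrite lerDl sqr_ge0.
Qed.

Lemma normr_Im_le z : `|Im z| <= normc z.
Proof.
case: z => a b /=; rewrite -sqrtr_sqr ler_sqrt ?addr_ge0 ?sqr_ge0//.
by rewrite lerDr sqr_ge0.
Qed.

Lemma normc_le z : normc z <= `|Re z| + `|Im z|.
Proof.
case: z => a b /=; rewrite -[leRHS]ger0_norm ?addr_ge0// -sqrtr_sqr.
rewrite ler_sqrt ?sqr_ge0// sqrrD !real_normK ?num_real//.
by rewrite addrAC lerDl mulrn_wge0// mulr_ge0.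
Qed.

Lemma normcR x : normc x%:C = `|x|.
Proof. by rewrite /= expr0n addr0 sqrtr_sqr. Qed.

Lemma normc_ge0 z : 0 <= normc z. Proof. by case: z => a b; rewrite sqrtr_ge0. Qed.

Lemma normcX z n : normc (z ^+ n) = normc z ^+ n.
Proof. by elim: n => [|n IH]; rewrite ?normc1// !exprS normcM IH. Qed.

Lemma normC_normc z : `|z| = (normc z)%:C. Proof. by []. Qed.

Lemma normc_conj z : normc z^* = normc z.
Proof. by case: z => a b /=; rewrite sqrrN. Qed.

Lemma cexpD z w : cexp (z + w) = cexp z * cexp w.
Proof.
case: z w => [a b] [c d]; apply: complex_eqP; rewrite /cexp !ReImE /=;
by rewrite expRD ?sinD ?cosD; ring.
Qed.

Lemma cexp0 : cexp (0 : C) = 1.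
Proof. by apply: complex_eqP; rewrite /cexp /= expR0 cos0 sin0; ring. Qed.

Lemma cexpN z : cexp (- z) = (cexp z)^-1.
Proof.
have h : cexp z * cexp (- z) = 1 by rewrite -cexpD subrr cexp0.
have nz : cexp z != 0.
  by apply/eqP => e; move: h; rewrite e mul0r => /eqP; rewrite eq_sym oner_eq0.
by apply: (mulfI nz); rewrite h divff.
Qed.

Lemma cexp_neq0 z : cexp z != 0.
Proof.
apply/eqP => e; have : cexp z * cexp (- z) = 1 by rewrite -cexpD subrr cexp0.
by rewrite e mul0r => /eqP; rewrite eq_sym oner_eq0.
Qed.

Lemma cexpR x : cexp x%:C = (expR x)%:C.
Proof. by apply: complex_eqP; rewrite /cexp /= cos0 sin0; ring. Qed.

Lemma normc_cexp z : normc (cexp z) = expR (Re z).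
Proof.
rewrite /cexp normcM normcR ger0_norm ?expR_ge0//=.
by rewrite cos2Dsin2 sqrtr1 mulr1.
Qed.

Lemma conj_cexp z : (cexp z)^* = cexp z^*.
Proof.
by case: z => a b; apply: complex_eqP; rewrite /cexp /= ?cosN ?sinN; ring.
Qed.

Lemma cexp_natr z n : cexp (n%:R * z) = cexp z ^+ n.
Proof.
elim: n => [|n IH]; first by rewrite mul0r cexp0 expr0.
by rewrite -[in LHS]addn1 natrD mulrDl cexpD mul1r IH exprSr.
Qed.

End ComplexNumbers.

Section ComplexMeasurable.
Context {R : realType} d (T : measurableType d).
Local Notation C := R[i].
Implicit Types h : T -> C.

Definition cmeasurable h : Prop :=
  measurable_fun setT (fun x => Re (h x)) /\ measurable_fun setT (fun x => Im (h x)).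

Lemma cmeasurable_cst (c : C) : cmeasurable (fun=> c).
Proof. by split; exact: measurable_cst. Qed.

Lemma cmeasurableR (f : T -> R) : measurable_fun setT f -> cmeasurable (fun x => (f x)%:C).
Proof. by move=> mf; split => //=; exact: measurable_cst. Qed.

Lemma cmeasurableD h1 h2 : cmeasurable h1 -> cmeasurable h2 ->
  cmeasurable (fun x => h1 x + h2 x).
Proof.
move=> [a1 b1] [a2 b2]; split.
  by under eq_fun do rewrite cReD; exact: measurable_funD.
by under eq_fun do rewrite cImD; exact: measurable_funD.
Qed.

Lemma cmeasurableN h : cmeasurable h -> cmeasurable (fun x => - h x).
Proof.
move=> [a b]; split.
  by under eq_fun do rewrite cReN; exact: measurableT_comp.
by under eq_fun do rewrite cImN; exact: measurableT_comp.
Qed.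

Lemma cmeasurableB h1 h2 : cmeasurable h1 -> cmeasurable h2 ->
  cmeasurable (fun x => h1 x - h2 x).
Proof. by move=> m1 m2; apply: cmeasurableD => //; exact: cmeasurableN. Qed.

Lemma cmeasurableM h1 h2 : cmeasurable h1 -> cmeasurable h2 ->
  cmeasurable (fun x => h1 x * h2 x).
Proof.
move=> [a1 b1] [a2 b2]; split.
  under eq_fun do rewrite cReM.
  by apply: measurable_funB; exact: measurable_funM.
under eq_fun do rewrite cImM.
by apply: measurable_funD; exact: measurable_funM.
Qed.

Lemma cmeasurableX h n : cmeasurable h -> cmeasurable (fun x => h x ^+ n).
Proof.
move=> mh; elim: n => [|n IH].
  by under eq_fun do rewrite expr0; exact: cmeasurable_cst.
by under eq_fun do rewrite exprS; exact: cmeasurableM.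
Qed.

Lemma cmeasurable_conj h : cmeasurable h -> cmeasurable (fun x => (h x)^*).
Proof.
move=> [a b]; split.
  by rewrite (_ : (fun x => _) = (fun x => Re (h x)))//; apply/funext => x; case: (h x).
rewrite (_ : (fun x => _) = (fun x => - Im (h x))); first exact: measurableT_comp.
by apply/funext => x; case: (h x).
Qed.

Lemma cmeasurable_sum (I : Type) (s : seq I) (P : pred I) (F : I -> T -> C) :
  (forall i, cmeasurable (F i)) -> cmeasurable (fun x => \sum_(i <- s | P i) F i x).
Proof.
move=> mF; elim: s => [|i s IH].
  by under eq_fun do rewrite big_nil; exact: cmeasurable_cst.
under eq_fun do rewrite big_cons; case: (P i) => //.
exact: cmeasurableD.
Qed.

Lemma cmeasurable_cexp h : cmeasurable h -> cmeasurable (fun x => cexp (h x)).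
Proof.
move=> [a b]; rewrite /cexp; apply: cmeasurableM.
  by apply: cmeasurableR; exact: measurableT_comp.
split => /=.
  apply: (measurableT_comp _ b); apply: continuous_measurable_fun; exact: continuous_cos.
apply: (measurableT_comp _ b); apply: continuous_measurable_fun; exact: continuous_sin.
Qed.

End ComplexMeasurable.

Section ComplexIntegral.
Context {R : realType} d (T : measurableType d) (mu : {measure set T -> \bar R}).
Local Notation C := R[i].
Implicit Types h : T -> C.

Lemma integrable_dominated (f g : T -> R) : measurable_fun setT f ->
  (forall x, `|f x| <= g x) -> mu.-integrable setT (EFin \o g) ->
  mu.-integrable setT (EFin \o f).
Proof.
move=> mf fg; apply: le_integrable => //; first exact/measurable_EFinP.
by move=> x _ /=; rewrite lee_fin (le_trans (fg x))// ler_norm.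
Qed.

Lemma cintegrable_dominated h (g : T -> R) : cmeasurable h ->
  (forall x, normc (h x) <= g x) -> mu.-integrable setT (EFin \o g) ->
  cintegrable mu setT h.
Proof.
move=> [mr mi] hg ig; split.
  apply: integrable_dominated mr _ ig => x; exact: le_trans (normr_Re_le _) (hg x).
apply: integrable_dominated mi _ ig => x; exact: le_trans (normr_Im_le _) (hg x).
Qed.

Lemma cintegrableD h1 h2 : cintegrable mu setT h1 -> cintegrable mu setT h2 ->
  cintegrable mu setT (fun x => h1 x + h2 x).
Proof.
move=> [a1 b1] [a2 b2]; split.
  under eq_fun do rewrite cReD EFinD; exact: integrableD.
under eq_fun do rewrite cImD EFinD; exact: integrableD.
Qed.

Lemma cintegrableZ (c : C) h : cintegrable mu setT h ->
  cintegrable mu setT (fun x => c * h x).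
Proof.
move=> [a b]; split.
  under eq_fun do rewrite cReM EFinB !EFinM.
  by apply: integrableB => //; exact: integrableZl.
under eq_fun do rewrite cImM EFinD !EFinM.
by apply: integrableD => //; exact: integrableZl.
Qed.

Lemma cintegrable0 : cintegrable mu setT (fun=> 0 : C).
Proof. by split; exact: integrable0. Qed.

Lemma cintegrable_sum (I : Type) (s : seq I) (P : pred I) (F : I -> T -> C) :
  (forall i, cintegrable mu setT (F i)) ->
  cintegrable mu setT (fun x => \sum_(i <- s | P i) F i x).
Proof.
move=> mF; elim: s => [|i s IH].
  by under eq_fun do rewrite big_nil; exact: cintegrable0.
under eq_fun do rewrite big_cons; case: (P i) => //.
exact: cintegrableD.
Qed.

Lemma cintegralD h1 h2 : cintegrable mu setT h1 -> cintegrable mu setT h2 ->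
  cintegral mu setT (fun x => h1 x + h2 x) =
  cintegral mu setT h1 + cintegral mu setT h2.
Proof.
move=> [a1 b1] [a2 b2]; apply: complex_eqP; rewrite /cintegral !(cReD, cImD, cReM, cImM) /=.
  by under eq_Rintegral do rewrite cReD; rewrite RintegralD.
by under eq_Rintegral do rewrite cImD; rewrite RintegralD.
Qed.

Lemma cintegralZ (c : C) h : cintegrable mu setT h ->
  cintegral mu setT (fun x => c * h x) = c * cintegral mu setT h.
Proof.
move=> [a b].
have i1 (r : R) : mu.-integrable setT (EFin \o (fun x => r * Re (h x))).
  by apply: (eq_integrable measurableT _ _ _ (integrableZl measurableT r a)) => // x _; rewrite /= EFinM.
have i2 (r : R) : mu.-integrable setT (EFin \o (fun x => r * Im (h x))).
  by apply: (eq_integrable measurableT _ _ _ (integrableZl measurableT r b)) => // x _; rewrite /= EFinM.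
apply: complex_eqP; rewrite /cintegral !(cReD, cImD, cReM, cImM) /=.
  under eq_Rintegral do rewrite cReM.
  by rewrite RintegralB// !RintegralZl.
under eq_Rintegral do rewrite cImM.
by rewrite RintegralD// !RintegralZl.
Qed.

Lemma cintegralZr (c : C) h : cintegrable mu setT h ->
  cintegral mu setT (fun x => h x * c) = cintegral mu setT h * c.
Proof. by move=> ih; under eq_fun do rewrite mulrC; rewrite cintegralZ// mulrC. Qed.

Lemma cintegralB h1 h2 : cintegrable mu setT h1 -> cintegrable mu setT h2 ->
  cintegral mu setT (fun x => h1 x - h2 x) =
  cintegral mu setT h1 - cintegral mu setT h2.
Proof.
move=> i1 i2; under eq_fun do rewrite -mulN1r.
by rewrite cintegralD ?cintegralZ ?mulN1r//; exact: cintegrableZ.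
Qed.

Lemma cintegrableB h1 h2 : cintegrable mu setT h1 -> cintegrable mu setT h2 ->
  cintegrable mu setT (fun x => h1 x - h2 x).
Proof.
move=> i1 i2; under eq_fun do rewrite -mulN1r.
by apply: cintegrableD => //; exact: cintegrableZ.
Qed.

Lemma cintegral_sum (I : Type) (s : seq I) (P : pred I) (F : I -> T -> C) :
  (forall i, cintegrable mu setT (F i)) ->
  cintegral mu setT (fun x => \sum_(i <- s | P i) F i x) =
  \sum_(i <- s | P i) cintegral mu setT (F i).
Proof.
move=> mF; elim: s => [|i s IH].
  under eq_fun do rewrite big_nil; rewrite big_nil.
  by apply: complex_eqP; rewrite /= /Rintegral integral0.
under eq_fun do rewrite big_cons; rewrite big_cons; case: (P i) => //.
by rewrite cintegralD ?IH//; exact: cintegrable_sum.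
Qed.

(** Real and imaginary parts are estimated separately, whence the factor 2. *)
Lemma cintegral_bound h (g : T -> R) : cmeasurable h ->
  (forall x, normc (h x) <= g x) -> mu.-integrable setT (EFin \o g) ->
  normc (cintegral mu setT h) <= 2 * \int[mu]_x g x.
Proof.
move=> mh hg ig; have [ir ii] := cintegrable_dominated mh hg ig.
have bnd f : mu.-integrable setT (EFin \o f) -> (forall x, `|f x| <= g x) ->
    `|\int[mu]_x f x| <= \int[mu]_x g x.
  move=> fi fg; apply: le_trans (le_normr_Rintegral _ fi) _ => //.
  by apply: le_Rintegral => //; exact: integrable_norm.
apply: (le_trans (normc_le _)); rewrite mulrDl !mul1r lerD//; apply: bnd => // x.
  exact: le_trans (normr_Re_le _) (hg x).
exact: le_trans (normr_Im_le _) (hg x).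
Qed.

Lemma cintegral_real (f : T -> R) :
  cintegral mu setT (fun x => (f x)%:C) = (\int[mu]_x f x)%:C.
Proof. by apply: complex_eqP => //=; rewrite /Rintegral integral0. Qed.

End ComplexIntegral.

Section ComplexFubini.
Context {R : realType} d1 d2 (T1 : measurableType d1) (T2 : measurableType d2).
Variables (m1 : {sigma_finite_measure set T1 -> \bar R}).
Variables (m2 : {sigma_finite_measure set T2 -> \bar R}).
Local Notation C := R[i].
Variables (g1 : T1 -> R) (g2 : T2 -> R).
Hypotheses (i1 : m1.-integrable setT (EFin \o g1)) (i2 : m2.-integrable setT (EFin \o g2)).
Hypotheses (p1 : forall x, 0 <= g1 x) (p2 : forall y, 0 <= g2 y).

Lemma integrable_prodM :
  (m1 \x m2)%E.-integrable setT (EFin \o (fun p => g1 p.1 * g2 p.2)).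
Proof.
have mg1 : measurable_fun setT g1 by apply/measurable_EFinP; case/integrableP : i1.
have mg2 : measurable_fun setT g2 by apply/measurable_EFinP; case/integrableP : i2.
apply/integrable12ltyP.
  apply/measurable_EFinP; apply: measurable_funM; exact: measurableT_comp.
have j1 := integrableZl measurableT (\int[m2]_y g2 y) i1.
rewrite (eq_integral (fun x => (\int[m2]_y g2 y)%:E * (g1 x)%:E)%E); last first.
  move=> x _ /=; rewrite -EFinM -RintegralZr// /Rintegral fineK; last first.
    apply: integrable_fin_num => //.
    by have := integrableZl measurableT (g1 x) i2; apply: eq_integrable => // y _ /=; rewrite EFinM muleC.
  by apply: eq_integral => y _; rewrite /= ger0_norm ?mulr_ge0// mulrC.
have /integrableP[_] := j1; apply: le_lt_trans; apply: ge0_le_integral => //.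
- by move=> x _; rewrite -EFinM lee_fin mulr_ge0// Rintegral_ge0.
- apply/measurable_EFinP; apply: measurable_funM => //.
- by apply: measurableT_comp => //; apply/measurable_EFinP; apply: measurable_funM.
- by move=> x _; rewrite lee_abs.
Qed.

(** A majorant that splits as a product makes every section integrable, not just almost every one.
    The inner integrals are then finite at each point, and real-valued iterated integrals make sense
    throughout. *)
Lemma RFubini (f : T1 * T2 -> R) : measurable_fun setT f ->
  (forall x y, `|f (x, y)| <= g1 x * g2 y) ->
  [/\ (m1 \x m2)%E.-integrable setT (EFin \o f),
      \int[(m1 \x m2)%E]_p f p = \int[m1]_x \int[m2]_y f (x, y) &
      \int[(m1 \x m2)%E]_p f p = \int[m2]_y \int[m1]_x f (x, y)].
Proof.
move=> mf fg.
have fi : (m1 \x m2)%E.-integrable setT (EFin \o f).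
  by apply: integrable_dominated mf _ integrable_prodM => -[x y] /=.
have mf1 x : measurable_fun setT (fun y => f (x, y)) by exact: measurable_fun_pair2.
have mf2 y : measurable_fun setT (fun x => f (x, y)) by exact: measurable_fun_pair1.
split => //; rewrite /Rintegral.
- rewrite -(integral12_prod_meas1 fi); congr fine; apply: eq_integral => x _ /=.
  rewrite fineK//; apply: integrable_fin_num => //.
  apply: (integrable_dominated (g := fun y => g1 x * g2 y)) => //.
  by apply: (eq_integrable measurableT _ _ _ (integrableZl measurableT (g1 x) i2)) => // z _; rewrite /= EFinM.
- rewrite -(integral21_prod_meas1 fi); congr fine; apply: eq_integral => y _ /=.
  rewrite fineK//; apply: integrable_fin_num => //.
  apply: (integrable_dominated (g := fun x => g1 x * g2 y)) => //.
  by apply: (eq_integrable measurableT _ _ _ (integrableZr measurableT (g2 y) i1)) => // z _; rewrite /= EFinM.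
Qed.

Lemma cFubini (h : T1 * T2 -> C) : cmeasurable h ->
  (forall x y, normc (h (x, y)) <= g1 x * g2 y) ->
  [/\ cintegrable (m1 \x m2)%E setT h,
      cintegral (m1 \x m2)%E setT h =
        cintegral m1 setT (fun x => cintegral m2 setT (fun y => h (x, y))) &
      cintegral (m1 \x m2)%E setT h =
        cintegral m2 setT (fun y => cintegral m1 setT (fun x => h (x, y)))].
Proof.
move=> [mr mi] hg.
have [] := RFubini mr (fun x y => le_trans (normr_Re_le _) (hg x y)).
have [] := RFubini mi (fun x y => le_trans (normr_Im_le _) (hg x y)).
move=> ii e1 e2 ir e3 e4; split; first by split.
  by apply: complex_eqP.
by apply: complex_eqP.
Qed.

End ComplexFubini.

(** * Calculus on the real line *)

Section Exhaustion.
Context {R : realType} d (T : measurableType d) (mu : {measure set T -> \bar R}).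
Variables (A : (set T)^nat).
Hypotheses (ndA : nondecreasing_seq A) (mA : forall i, measurable (A i)).

Let mU : measurable (\bigcup_i A i). Proof. exact: bigcup_measurable. Qed.

Lemma ge0_cvg_Rintegral_bigcup (f : T -> R) : (forall x, 0 <= f x) ->
  mu.-integrable (\bigcup_i A i) (EFin \o f) ->
  \int[mu]_(x in A n) f x @[n --> \oo] --> \int[mu]_(x in \bigcup_i A i) f x.
Proof.
move=> f0 fi; rewrite /Rintegral; apply: fine_cvg; rewrite fineK; last first.
  by apply: integrable_fin_num.
apply: ge0_nondecreasing_set_cvg_integral => //.
- move=> i; apply: (measurable_funS mU); first exact: bigcup_sup.
  exact: measurable_int fi.
- by move=> i x _ /=; rewrite lee_fin.
Qed.

(** Monotone convergence applies to nonnegative functions, so f is written as |f| - (|f| - f). *)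
Lemma cvg_Rintegral_bigcup (f : T -> R) :
  mu.-integrable (\bigcup_i A i) (EFin \o f) ->
  \int[mu]_(x in A n) f x @[n --> \oo] --> \int[mu]_(x in \bigcup_i A i) f x.
Proof.
move=> fi.
have fai : mu.-integrable (\bigcup_i A i) (EFin \o (fun x => `|f x|)).
  exact: integrable_norm.
have fbi : mu.-integrable (\bigcup_i A i) (EFin \o (fun x => `|f x| - f x)).
  apply: (eq_integrable mU _ _ _ (integrableB mU fai fi)) => x _ /=.
  by rewrite EFinB.
have h D : measurable D -> D `<=` \bigcup_i A i ->
    \int[mu]_(x in D) f x =
    \int[mu]_(x in D) `|f x| - \int[mu]_(x in D) (`|f x| - f x).
  move=> mD sD; rewrite -RintegralB//; try exact: integrableS _ _ sD _.
  by apply: eq_Rintegral => x _; rewrite opprB addrC subrK.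
rewrite h// (_ : (fun n => _) = (fun n => \int[mu]_(x in A n) `|f x| - \int[mu]_(x in A n) (`|f x| - f x))); last first.
  by apply/funext => n; rewrite h//; exact: bigcup_sup.
apply: cvgB; apply: ge0_cvg_Rintegral_bigcup => // x.
by rewrite subr_ge0 ler_norm.
Qed.

Lemma integrable_bigcup_ge0 (f : T -> R) (l : \bar R) : (l < +oo)%E ->
  (forall x, 0 <= f x) ->
  measurable_fun (\bigcup_i A i) f ->
  (forall n, (\int[mu]_(x in A n) (f x)%:E <= l)%E) ->
  mu.-integrable (\bigcup_i A i) (EFin \o f).
Proof.
move=> ly f0 mf fl; apply/integrableP; split; first exact/measurable_EFinP.
rewrite (eq_integral (EFin \o f)); last first.
  by move=> x _ /=; rewrite ger0_norm.
apply: (@le_lt_trans _ _ l) => //.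
have h := @ge0_nondecreasing_set_cvg_integral _ _ _ A (EFin \o f) mu ndA mA _ _.
apply: (cvge_le _ (h _ _)).
- by apply: nearW => n; exact: fl.
- move=> i; apply/measurable_EFinP; apply: (measurable_funS mU _ mf).
  exact: bigcup_sup.
- by move=> i x _ /=; rewrite lee_fin.
Qed.

End Exhaustion.

Section LineCalculus.
Context {R : realType}.
Local Notation mu := (@lebesgue_measure R).

(** The shift to [n.+1] gives each interval positive length, as the fundamental theorem of calculus
    demands. *)
Definition sym_itv (n : nat) : set R := `[- n.+1%:R, n.+1%:R]%classic.

Lemma sym_itv_nd : nondecreasing_seq sym_itv.
Proof.
move=> m n mn; rewrite subsetEset; apply: subset_itv; rewrite bnd_simp.
  by rewrite lerN2 ler_nat.
by rewrite ler_nat.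
Qed.

Lemma bigcup_sym_itv : \bigcup_i sym_itv i = setT.
Proof.
apply/seteqP; split => // x _; exists (Num.truncn `|x|) => //.
rewrite /sym_itv /= in_itv /= -ler_norml ltW//.
exact: truncnS_gt.
Qed.

Lemma measurable_sym_itv n : measurable (sym_itv n).
Proof. exact: measurable_itv. Qed.

Lemma FTC2_sym (f F : R -> R) : continuous f ->
  (forall x : R, is_derive x (1 : R) F (f x)) -> forall n,
  (\int[mu]_(x in sym_itv n) (f x)%:E = (F n.+1%:R - F (- n.+1%:R))%:E)%E.
Proof.
move=> cf dF n; rewrite EFinB.
have cF : continuous F.
  move=> x; apply/differentiable_continuous/derivable1_diffP.
  by have [] := dF x.
apply: continuous_FTC2.
- by apply: (@lt_trans _ _ 0); rewrite ?oppr_lt0 ltr0n.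
- exact: continuous_subspaceT.
- split; first by move=> x _; have [] := dF x.
    exact/cvg_at_right_filter/cF.
  exact/cvg_at_left_filter/cF.
- by move=> x _; rewrite derive1E; have [] := dF x.
Qed.

Lemma Rintegral_derivative (f F : R -> R) (l1 l2 : R) : continuous f ->
  (forall x : R, is_derive x (1 : R) F (f x)) ->
  F n.+1%:R @[n --> \oo] --> l2 -> F (- n.+1%:R) @[n --> \oo] --> l1 ->
  mu.-integrable setT (EFin \o f) -> \int[mu]_x f x = l2 - l1.
Proof.
move=> cf dF F2 F1 fi.
have := cvg_Rintegral_bigcup sym_itv_nd measurable_sym_itv (f := f) (mu := mu).
rewrite bigcup_sym_itv => /(_ fi) h.
have h' : (\int[mu]_(x in sym_itv n) f x) @[n --> \oo] --> l2 - l1.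
  rewrite (_ : (fun n => _) = (fun n => F n.+1%:R - F (- n.+1%:R))); first exact: cvgB.
  by apply/funext => n; rewrite /Rintegral (FTC2_sym cf dF).
by apply: (cvg_unique _ h h').
Qed.

(** The integrals over the exhausting intervals are increments of a bounded primitive, hence at most
    [M + M]. *)
Lemma integrable_derivative_ge0 (f F : R -> R) (M : R) : continuous f ->
  (forall x, 0 <= f x) -> (forall x : R, is_derive x (1 : R) F (f x)) ->
  (forall x, `|F x| <= M) ->
  mu.-integrable setT (EFin \o f).
Proof.
move=> cf f0 dF FM; rewrite -bigcup_sym_itv.
apply: (integrable_bigcup_ge0 (mu := mu) sym_itv_nd measurable_sym_itv (ltry (M + M))) => //.
- by apply: measurable_funTS; exact: continuous_measurable_fun.
- move=> n; rewrite (FTC2_sym cf dF) lee_fin lerD//.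
    exact: le_trans (ler_norm _) (FM _).
  by have := FM (- n.+1%:R); rewrite ler_norml lerNl => /andP[].
Qed.

End LineCalculus.

Section Substitution.
Context {R : realType}.
Local Notation mu := (@lebesgue_measure R).
Variables (F F' : R -> R) (D : set R).
Hypothesis dF : forall x : R, is_derive x (1 : R) F (F' x).
Hypothesis cF' : continuous F'.
Hypothesis F'0 : forall x, 0 < F' x.
Hypothesis DE : \bigcup_n `[F (- n.+1%:R), F n.+1%:R]%classic = D.

Let B n : set R := `[F (- n.+1%:R), F n.+1%:R]%classic.

Let cF : continuous F.
Proof.
move=> x; apply/differentiable_continuous/derivable1_diffP.
by have [] := dF x.
Qed.

Let F_homo : {homo F : x y / x < y}.
Proof.
move=> x y xy.
have [c _] := MVT xy (fun z _ => dF z) (continuous_subspaceT cF).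
by move/eqP; rewrite subr_eq => /eqP ->; rewrite ltrDr mulr_gt0// subr_gt0.
Qed.

Let F_homo_le : {homo F : x y / x <= y}.
Proof. by move=> x y; rewrite le_eqVlt => /orP[/eqP->//|/F_homo/ltW]. Qed.

Let F_in_D x : D (F x).
Proof.
rewrite -DE; have : (\bigcup_i sym_itv i : set R) x by rewrite bigcup_sym_itv.
case=> n _; rewrite /sym_itv /= in_itv /= => /andP[a b].
by exists n => //=; rewrite in_itv /= !F_homo_le.
Qed.

Let ndB : nondecreasing_seq B.
Proof.
move=> m n mn; rewrite subsetEset; apply: subset_itv; rewrite bnd_simp;
by apply: F_homo_le; rewrite ?lerN2 ler_nat.
Qed.

Let mB n : measurable (B n). Proof. exact: measurable_itv. Qed.

Let integral_B (f : R -> R) n : (forall y, D y -> {for y, continuous f}) ->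
  (\int[mu]_(y in B n) (f y)%:E = \int[mu]_(x in sym_itv n) (f (F x) * F' x)%:E)%E.
Proof.
move=> cf; have eF' : derive1 F = F'.
  by apply/funext => x; rewrite derive1E; have [] := dF x.
rewrite /B (@integration_by_substitution_increasing _ F f (- n.+1%:R) n.+1%:R).
- by apply: eq_integral => x _ /=; rewrite eF'.
- by apply: (@le_trans _ _ 0); rewrite ?oppr_le0.
- by move=> x y _ _; exact: F_homo.
- by rewrite eF' => x _; exact: cF'.
- by rewrite eF'; apply/cvg_ex; exists (F' (- n.+1%:R)); apply/cvg_at_right_filter/cF'.
- by rewrite eF'; apply/cvg_ex; exists (F' n.+1%:R); apply/cvg_at_left_filter/cF'.
- split; first by move=> x _; have [] := dF x.
    exact/cvg_at_right_filter/cF.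
  exact/cvg_at_left_filter/cF.
- apply: continuous_in_subspaceT => y; rewrite inE => yB; apply: cf.
  by rewrite -DE; exists n.
Qed.

Variable f : R -> R.
Hypothesis cf : forall y, D y -> {for y, continuous f}.

Let cnf y : D y -> {for y, continuous (fun y => `|f y|)}.
Proof. by move=> Dy; apply: cvg_norm; exact: cf. Qed.

Let continuous_fF : continuous (fun x => f (F x) * F' x).
Proof.
move=> x; apply: cvgM; last exact: cF'.
by apply: (@continuous_comp _ _ _ F f); [exact: cF|exact: cf].
Qed.

Let mD : measurable D. Proof. by rewrite -DE; exact: bigcup_measurable. Qed.

Let mfD : measurable_fun D f.
Proof.
rewrite -DE; apply/measurable_fun_bigcup => // n.
apply: subspace_continuous_measurable_fun => //.
apply: continuous_in_subspaceT => y; rewrite inE => yB; apply: cf.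
by rewrite -DE; exists n.
Qed.

(** In both directions the integrals of |f| over an exhausting sequence are bounded by the total
    integral on the other side, because the finite substitution matches [B n] with [sym_itv n].
    Describing [D] as the union of the images covers the whole line (affine maps, sinh) and the half
    line (exp) alike. *)
Lemma integrable_substitution : mu.-integrable D (EFin \o f) <->
  mu.-integrable setT (EFin \o (fun x => f (F x) * F' x)).
Proof using dF cF' F'0 DE cf.
have nE x : `|f (F x) * F' x| = `|f (F x)| * F' x.
  by rewrite normrM (gtr0_norm (F'0 x)).
split => fi.
  apply: (integrable_dominated (mu := mu) (g := fun x => `|f (F x) * F' x|)) => //.
    exact: continuous_measurable_fun.
  rewrite -bigcup_sym_itv.
  have /integrableP[_ ly] := fi.
  apply: (integrable_bigcup_ge0 (mu := mu) sym_itv_nd measurable_sym_itv ly) => //.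
    apply: measurable_funTS; apply: continuous_measurable_fun => x.
    by apply: cvg_norm; exact: continuous_fF.
  move=> n; have -> : (\int[mu]_(x in sym_itv n) `|f (F x) * F' x|%:E =
      \int[mu]_(x in sym_itv n) (`|f (F x)| * F' x)%:E)%E.
    by apply: eq_integral => x _; rewrite nE.
  rewrite -(integral_B _ cnf); apply: ge0_subset_integral => //.
  - exact: mB.
  - by apply/measurable_EFinP; exact: measurableT_comp.
  - by rewrite -DE; exact: bigcup_sup.
have mn : measurable_fun D (fun y => `|f y|) by exact: measurableT_comp.
have ii : mu.-integrable D (EFin \o (fun y => `|f y|)).
  rewrite -DE.
  have /integrableP[_ ly] := fi.
  apply: (integrable_bigcup_ge0 (mu := mu) ndB mB ly) => //; first by rewrite /B DE.
  move=> n; rewrite (integral_B _ cnf).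
  have -> : (\int[mu]_(x in sym_itv n) (`|f (F x)| * F' x)%:E =
      \int[mu]_(x in sym_itv n) `|f (F x) * F' x|%:E)%E.
    by apply: eq_integral => x _; rewrite nE.
  apply: ge0_subset_integral => //.
    exact: measurable_sym_itv.
  apply/measurable_EFinP; apply: continuous_measurable_fun => x.
  by apply: cvg_norm; exact: continuous_fF.
apply: (@le_integrable _ _ _ mu D mD _ (EFin \o (fun y => `|f y|)) _ _ ii); first exact/measurable_EFinP.
by move=> x _ /=; rewrite normr_id.
Qed.

Lemma Rintegral_substitution : mu.-integrable D (EFin \o f) ->
  \int[mu]_(y in D) f y = \int[mu]_x (f (F x) * F' x).
Proof using dF cF' F'0 DE cf.
move=> fi; have /integrable_substitution fFi := fi.
have := cvg_Rintegral_bigcup ndB mB (f := f) (mu := mu).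
rewrite -/B DE => /(_ fi) h1.
have := cvg_Rintegral_bigcup sym_itv_nd measurable_sym_itv (f := fun x => f (F x) * F' x) (mu := mu).
rewrite bigcup_sym_itv => /(_ fFi) h2.
have e : (fun n => \int[mu]_(x in B n) f x) =
         (fun n => \int[mu]_(x in sym_itv n) (f (F x) * F' x)).
  by apply/funext => n; rewrite /Rintegral integral_B.
by rewrite e in h1; apply: (cvg_unique _ h1 h2).
Qed.

End Substitution.

Section ComplexCalculus.
Context {R : realType}.
Local Notation C := R[i].
Local Notation mu := (@lebesgue_measure R).
Implicit Types (h H phi : R -> C) (t : R).

Definition ccontinuous_at t h : Prop :=
  continuous_at t (fun x => Re (h x)) /\ continuous_at t (fun x => Im (h x)).

Definition ccontinuous h : Prop := forall t, ccontinuous_at t h.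

Lemma ccontinuous_atR t (f : R -> R) : continuous_at t f ->
  ccontinuous_at t (fun x => (f x)%:C).
Proof. by move=> cf; split => //=; exact: cst_continuous. Qed.

Lemma ccontinuous_at_cst t (c : C) : ccontinuous_at t (fun=> c).
Proof. by split; exact: cst_continuous. Qed.

Lemma ccontinuous_atD t h1 h2 : ccontinuous_at t h1 -> ccontinuous_at t h2 ->
  ccontinuous_at t (fun x => h1 x + h2 x).
Proof.
move=> [a1 b1] [a2 b2]; split.
  by under eq_fun do rewrite cReD; exact: continuousD.
by under eq_fun do rewrite cImD; exact: continuousD.
Qed.

Lemma ccontinuous_atM t h1 h2 : ccontinuous_at t h1 -> ccontinuous_at t h2 ->
  ccontinuous_at t (fun x => h1 x * h2 x).
Proof.
move=> [a1 b1] [a2 b2]; split.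
  by under eq_fun do rewrite cReM; apply: cvgB; exact: cvgM.
by under eq_fun do rewrite cImM; apply: cvgD; exact: cvgM.
Qed.

Lemma ccontinuous_atB t h1 h2 : ccontinuous_at t h1 -> ccontinuous_at t h2 ->
  ccontinuous_at t (fun x => h1 x - h2 x).
Proof.
move=> c1 c2; under eq_fun do rewrite -mulN1r.
by apply: ccontinuous_atD => //; apply: ccontinuous_atM => //; exact: ccontinuous_at_cst.
Qed.

Lemma ccontinuous_at_cexp t h : ccontinuous_at t h ->
  ccontinuous_at t (fun x => cexp (h x)).
Proof.
move=> [a b]; apply: ccontinuous_atM.
  apply: ccontinuous_atR; apply: (continuous_comp a); exact: continuous_expR.
split => /=; apply: (continuous_comp b); [exact: continuous_cos|exact: continuous_sin].
Qed.

Lemma ccontinuous_measurable h : ccontinuous h -> cmeasurable h.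
Proof. by move=> ch; split; apply: continuous_measurable_fun => t; have [] := ch t. Qed.

Definition cderive_at t H (v : C) : Prop :=
  is_derive t (1 : R) (fun x => Re (H x)) (Re v) /\
  is_derive t (1 : R) (fun x => Im (H x)) (Im v).

Lemma cderive_eq t H v w : cderive_at t H v -> v = w -> cderive_at t H w.
Proof. by move=> ? <-. Qed.

Lemma cderive_atR t (f : R -> R) v : is_derive t (1 : R) f v ->
  cderive_at t (fun x => (f x)%:C) v%:C.
Proof. by move=> df; split => //=; exact: is_derive_cst. Qed.

Lemma cderive_at_cst t (c : C) : cderive_at t (fun=> c) 0.
Proof. by split => /=; exact: is_derive_cst. Qed.

Lemma cderive_atD t H1 H2 v1 v2 : cderive_at t H1 v1 -> cderive_at t H2 v2 ->
  cderive_at t (fun x => H1 x + H2 x) (v1 + v2).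
Proof.
move=> [a1 b1] [a2 b2]; split.
  by under eq_fun do rewrite cReD; rewrite cReD; exact: is_deriveD.
by under eq_fun do rewrite cImD; rewrite cImD; exact: is_deriveD.
Qed.

Lemma cderive_atM t H1 H2 v1 v2 : cderive_at t H1 v1 -> cderive_at t H2 v2 ->
  cderive_at t (fun x => H1 x * H2 x) (v1 * H2 t + H1 t * v2).
Proof.
move=> [a1 b1] [a2 b2]; split.
  under eq_fun do rewrite cReM.
  apply: (is_derive_eq (is_deriveB (is_deriveM a1 a2) (is_deriveM b1 b2))).
  by rewrite !(cReD, cReM) /GRing.scale /=; ring.
under eq_fun do rewrite cImM.
apply: (is_derive_eq (is_deriveD (is_deriveM a1 b2) (is_deriveM b1 a2))).
by rewrite !(cImD, cImM) /GRing.scale /=; ring.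
Qed.

Lemma cderive_at_cexp t H v : cderive_at t H v ->
  cderive_at t (fun x => cexp (H x)) (v * cexp (H t)).
Proof.
move=> [a b].
have e := is_derive1_comp (is_derive_expR (Re (H t))) a.
have c := is_derive1_comp (is_derive_cos (Im (H t))) b.
have s := is_derive1_comp (is_derive_sin (Im (H t))) b.
apply: (@cderive_eq _ _ ((expR (Re (H t)) * Re v)%:C * (cos (Im (H t)) +i* sin (Im (H t)))
   + (expR (Re (H t)))%:C * ((- sin (Im (H t)) * Im v) +i* (cos (Im (H t)) * Im v)))).
  by apply: cderive_atM; [exact: cderive_atR|split].
by apply: complex_eqP; rewrite /cexp !(cReD, cImD, cReM, cImM) /=; ring.
Qed.

(* The decay condition makes the boundary terms at infinity vanish. *)
Lemma cintegral_derivative0 h H (M : R) : ccontinuous h ->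
  (forall t, cderive_at t H (h t)) -> (forall t, normc (H t) * (1 + `|t|) <= M) ->
  cintegrable mu setT h -> cintegral mu setT h = 0.
Proof.
move=> ch dH HM [ir ii].
have M0 : 0 <= M by apply: le_trans (HM 0); rewrite mulr_ge0 ?normc_ge0// addr_ge0.
have lim (F : R -> R) (s : nat -> R) : (forall t, `|F t| <= normc (H t)) ->
    (forall n, `|s n| = n.+1%:R) -> F (s n) @[n --> \oo] --> (0 : R).
  move=> FH sE.
  apply: (@squeeze_cvgr _ _ _ _ (fun n => - (M * harmonic n)) (fun n => M * harmonic n)).
  - apply: nearW => n; rewrite -ler_norml.
    apply: (le_trans (FH _)); rewrite /harmonic /= ler_pdivlMr ?ltr0n//.
    apply: le_trans (HM (s n)); rewrite ler_wpM2l ?normc_ge0// sE.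
    by rewrite lerDr.
  - by rewrite -oppr0 -(mulr0 M); apply: cvgN; apply: cvgM; [exact: cvg_cst|exact: cvg_harmonic].
  - by rewrite -(mulr0 M); apply: cvgM; [exact: cvg_cst|exact: cvg_harmonic].
apply: complex_eqP; rewrite /cintegral /=.
  rewrite (Rintegral_derivative (l1 := 0) (l2 := 0) _ (fun t => (dH t).1))//; last 3 first.
  - by move=> t; have [] := ch t.
  - by apply: (lim (fun t => Re (H t)) (fun n => n.+1%:R)) => [t|n]; [exact: normr_Re_le|rewrite ger0_norm].
  - by apply: (lim (fun t => Re (H t)) (fun n => - n.+1%:R)) => [t|n]; [exact: normr_Re_le|rewrite normrN ger0_norm].
  by rewrite subrr.
rewrite (Rintegral_derivative (l1 := 0) (l2 := 0) _ (fun t => (dH t).2))//; last 3 first.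
- by move=> t; have [] := ch t.
- by apply: (lim (fun t => Im (H t)) (fun n => n.+1%:R)) => [t|n]; [exact: normr_Im_le|rewrite ger0_norm].
- by apply: (lim (fun t => Im (H t)) (fun n => - n.+1%:R)) => [t|n]; [exact: normr_Im_le|rewrite normrN ger0_norm].
by rewrite subrr.
Qed.

Lemma cintegral_substitution (F F' : R -> R) (D : set R) h :
  (forall x : R, is_derive x (1 : R) F (F' x)) -> continuous F' ->
  (forall x, 0 < F' x) ->
  \bigcup_n `[F (- n.+1%:R), F n.+1%:R]%classic = D ->
  (forall y, D y -> ccontinuous_at y h) ->
  (cintegrable mu D h <-> cintegrable mu setT (fun x => (F' x)%:C * h (F x))) /\
  (cintegrable mu D h ->
    cintegral mu D h = cintegral mu setT (fun x => (F' x)%:C * h (F x))).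
Proof.
move=> dF cF' F0 DE ch.
have eRe : (fun x => Re ((F' x)%:C * h (F x))) = (fun x => Re (h (F x)) * F' x).
  by apply/funext => x; rewrite cReM /= mul0r subr0 mulrC.
have eIm : (fun x => Im ((F' x)%:C * h (F x))) = (fun x => Im (h (F x)) * F' x).
  by apply/funext => x; rewrite cImM /= mul0r addr0 mulrC.
have cr y : D y -> {for y, continuous (fun x => Re (h x))} by move=> /ch[].
have ci y : D y -> {for y, continuous (fun x => Im (h x))} by move=> /ch[].
have h1 := integrable_substitution dF cF' F0 DE cr.
have h2 := integrable_substitution dF cF' F0 DE ci.
split.
  have -> : cintegrable mu setT (fun x => (F' x)%:C * h (F x)) <->
    mu.-integrable setT (EFin \o (fun x => Re (h (F x)) * F' x)) /\
    mu.-integrable setT (EFin \o (fun x => Im (h (F x)) * F' x)).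
    by rewrite /cintegrable -eRe -eIm.
  by rewrite -h1 -h2.
move=> [ir ii]; apply: complex_eqP; rewrite /cintegral /=.
  rewrite (Rintegral_substitution dF cF' F0 DE cr ir).
  by congr (Rintegral _ _ _); rewrite -eRe.
rewrite (Rintegral_substitution dF cF' F0 DE ci ii).
by congr (Rintegral _ _ _); rewrite -eIm.
Qed.

Lemma bigcup_itv_setT (F : R -> R) (a b : R) : 0 < a ->
  (forall n, a * n.+1%:R + b <= F n.+1%:R) ->
  (forall n, F (- n.+1%:R) <= - (a * n.+1%:R) + b) ->
  \bigcup_n `[F (- n.+1%:R), F n.+1%:R]%classic = setT.
Proof.
move=> a0 F1 F2; apply/seteqP; split => // x _.
have [n hn] : exists n, `|x - b| <= a * n.+1%:R.
  exists (Num.truncn (`|x - b| / a)).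
  by rewrite mulrC -ler_pdivrMr// ltW// truncnS_gt.
exists n => //=; rewrite in_itv/=; move: hn (F1 n) (F2 n); rewrite ler_norml.
by move=> /andP[]; lra.
Qed.

Lemma cintegral_affine h (a b : R) : 0 < a -> ccontinuous h ->
  (cintegrable mu setT h <-> cintegrable mu setT (fun x => a%:C * h (a * x + b))) /\
  (cintegrable mu setT h ->
    cintegral mu setT h = cintegral mu setT (fun x => a%:C * h (a * x + b))).
Proof.
move=> a0 ch; apply: (@cintegral_substitution (fun x => a * x + b) (fun=> a)) => //.
- move=> x.
  apply: (is_derive_eq (is_deriveD (is_deriveM (is_derive_cst a x 1) (is_derive_id x 1))
    (is_derive_cst b x 1))).
  by rewrite /GRing.scale /=; ring.
- by move=> x; exact: cst_continuous.
- apply: (@bigcup_itv_setT (fun x => a * x + b) a b) => // n.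
  by rewrite mulrN.
Qed.

End ComplexCalculus.

(** * Majorants by multiples of 1/(1 + t^2) *)

Section Bounds.
Context {R : realType}.
Local Notation C := R[i].
Local Notation mu := (@lebesgue_measure R).
Implicit Types t x y : R.

(** The common majorant: integrable because its primitive [atan] is bounded, and every multiple
    integral below is dominated by a product of such factors. *)
Definition cauchy_fun t : R := (1 + t ^+ 2)^-1.

Lemma one_add_sqr_gt0 t : 0 < 1 + t ^+ 2.
Proof. by rewrite ltr_wpDr ?sqr_ge0. Qed.

Lemma cauchy_fun_gt0 t : 0 < cauchy_fun t.
Proof. by rewrite invr_gt0 one_add_sqr_gt0. Qed.

Lemma continuous_one_add_sqr : continuous (fun t : R => 1 + t ^+ 2).
Proof. by move=> t; apply: cvgD; [exact: cvg_cst|exact: exprn_continuous]. Qed.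

Lemma continuous_cauchy_fun : continuous cauchy_fun.
Proof.
move=> t; apply: cvgV; first by rewrite gt_eqF// one_add_sqr_gt0.
exact: continuous_one_add_sqr.
Qed.

Lemma integrable_cauchy_fun : mu.-integrable setT (EFin \o cauchy_fun).
Proof.
apply: (integrable_derivative_ge0 (F := atan) (M := pi / 2)).
- exact: continuous_cauchy_fun.
- by move=> t; rewrite ltW// cauchy_fun_gt0.
- by move=> t; rewrite ler_norml !ltW// ?atan_ltpi2// atan_gtNpi2.
Qed.

Lemma integrableMr_cauchy_fun (M : R) :
  mu.-integrable setT (EFin \o (fun t => M * cauchy_fun t)).
Proof.
apply: (eq_integrable measurableT _ _ _ (integrableZl measurableT M integrable_cauchy_fun)).
by move=> t _ /=; rewrite EFinM.
Qed.

Lemma cintegrable_cauchy (h : R -> C) (M : R) : ccontinuous h ->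
  (forall t, normc (h t) <= M * cauchy_fun t) -> cintegrable mu setT h.
Proof.
move=> ch hM.
apply: (cintegrable_dominated (mu := mu) (g := fun t => M * cauchy_fun t)) => //.
  exact: ccontinuous_measurable.
exact: integrableMr_cauchy_fun.
Qed.

Lemma one_add_sqr_le_expR t : 1 + t ^+ 2 <= 4 * expR `|t|.
Proof.
have h : 1 + `|t| / 2 <= expR (`|t| / 2) by exact: expR_ge1Dx.
have -> : expR `|t| = expR (`|t| / 2) ^+ 2.
  by rewrite expr2 -expRD -mulrDr; congr expR; field.
have h0 : 0 <= `|t| by [].
have := @lerXn2r R 2 (1 + `|t| / 2) (expR (`|t| / 2)).
rewrite !nnegrE addr_ge0 ?divr_ge0// expR_ge0 => /(_ isT isT h).
by rewrite -(real_normK (num_real t)); nra.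
Qed.

Lemma expRN_norm_le_cauchy t : expR (- `|t|) <= 4 * cauchy_fun t.
Proof.
rewrite expRN ler_pdivlMr ?one_add_sqr_gt0// mulrC ler_pdivrMr ?expR_gt0//.
exact: one_add_sqr_le_expR.
Qed.

(** With n >= rho, the inequality e^y <= n exp(e^y / n) is raised to the power n. For negative [y]
    the left side is at most 1 and the right side at least 1. *)
Lemma expR_expR_bound (rho : R) : 0 <= rho -> exists2 K : R, 0 < K &
  forall y, expR (- expR y) <= K * expR (- (rho * y)).
Proof.
move=> r0; pose n := (Num.truncn rho).+1.
have rn : rho <= n%:R by rewrite ltW// truncnS_gt.
have n0 : (0 : R) < n%:R by rewrite ltr0n.
exists (n%:R ^+ n); first exact: exprn_gt0.
move=> y; have [y0|y0] := leP 0 y; last first.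
  apply: (@le_trans _ _ 1).
    by rewrite -expR0 ler_expR oppr_le0 expR_ge0.
  rewrite -[leLHS]mulr1 ler_pM// ?exprn_ege1 ?ler1n//.
  by rewrite -expR0 ler_expR oppr_ge0 mulr_ge0_le0// ltW.
apply: (@le_trans _ _ (n%:R ^+ n * expR (- (n%:R * y)))); last first.
  by rewrite ler_pM2l ?exprn_gt0// ler_expR lerN2 ler_wpM2r.
have h : expR (n%:R * y) <= n%:R ^+ n * expR (expR y).
  have -> : expR (expR y) = expR (expR y / n%:R) ^+ n.
    by rewrite -expRM_natl; congr expR; field; rewrite gt_eqF.
  rewrite expRM_natl -exprMn; apply: lerXn2r; rewrite ?nnegrE ?mulr_ge0 ?expR_ge0//.
  rewrite -ler_pdivrMl// [leLHS]mulrC; apply: le_trans (expR_ge1Dx _).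
  by rewrite lerDr.
by rewrite !expRN ler_pdivlMr ?expR_gt0// mulrC ler_pdivrMr ?expR_gt0.
Qed.

End Bounds.

(** * The Gamma function and Cauchy's integral *)

Section CexpEstimates.
Context {R : realType}.
Local Notation C := R[i].
Implicit Types (w v c : C).

(** The choice c = conj(v) / |v| recovers the norm. Testing against unit numbers reduces the mean
    value inequality below to the real mean value theorem, whose equality form fails for complex
    values. *)
Lemma normc_le_dual v (K : R) :
  (forall c, normc c = 1 -> Re (c * v) <= K) -> normc v <= K.
Proof.
have [->|v0] := eqVneq v 0 => h.
  by have := h 1; rewrite normc1 mulr0 normc0 /= => /(_ erefl).
have n0 : normc v != 0 by apply/eqP => /eq0_normc e; rewrite e eqxx in v0.
have := h ((normc v)^-1%:C * v^*%C).
rewrite normcM normcR normc_conj ger0_norm ?invr_ge0 ?normc_ge0// mulVf// => /(_ erefl).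
apply: le_trans; rewrite -mulrA [_^* * v]mulrC -sqr_normc normC_normc.
rewrite -rmorphXn -rmorphM /= expr2 mulKf//.
Qed.

Lemma cderive_line w (t : R) : cderive_at t (fun t => cexp (t%:C * w)) (w * cexp (t%:C * w)).
Proof.
apply: (@cderive_at_cexp _ _ (fun t => t%:C * w)).
apply: (cderive_eq (cderive_atM (cderive_atR (is_derive_id t 1)) (cderive_at_cst t w))).
by rewrite mulr0 addr0 rmorph1 mul1r.
Qed.

Lemma normc_MVT (H h : R -> C) (K : R) : (forall t : R, cderive_at t H (h t)) ->
  (forall t : R, 0 < t < 1 -> normc (h t) <= K) -> H 0 = 0 -> normc (H 1) <= K.
Proof.
move=> dH hK H0; apply: normc_le_dual => c c1.
have dg t : is_derive t (1 : R) (fun t => Re (c * H t)) (Re (c * h t)).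
  have [] := cderive_atM (cderive_at_cst t c) (dH t).
  by rewrite mul0r add0r.
have cg : continuous (fun t => Re (c * H t)).
  by move=> t; apply/differentiable_continuous/derivable1_diffP; have [] := dg t.
have [s] := MVT (@ltr01 R) (fun z _ => dg z) (continuous_subspaceT cg).
rewrite in_itv /= H0 mulr0 /= !subr0 mulr1 => s01 ->.
apply: le_trans (hK s s01); apply: (le_trans (ler_norm _)).
by apply: (le_trans (normr_Re_le _)); rewrite normcM c1 mul1r.
Qed.

Lemma normc_line w (t : R) : 0 < t < 1 -> normc (t%:C * w) <= normc w.
Proof.
move=> /andP[t0 t1]; rewrite normcM normcR gtr0_norm// ler_piMl ?normc_ge0//.
exact: ltW.
Qed.

Lemma normc_cexp_le w : normc (cexp w) <= expR (normc w).
Proof. by rewrite normc_cexp ler_expR (le_trans (ler_norm _))// normr_Re_le. Qed.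

Lemma normc_cexp_sub1 w : normc (cexp w - 1) <= normc w * expR (normc w).
Proof.
have := @normc_MVT (fun t => cexp (t%:C * w) - 1) (fun t => w * cexp (t%:C * w)).
rewrite rmorph1 mul1r rmorph0 mul0r cexp0 subrr; apply => // t.
  apply: (cderive_eq (cderive_atD (cderive_line w t) (cderive_at_cst t (- 1)))).
  by rewrite addr0.
move=> t01; rewrite normcM ler_wpM2l ?normc_ge0// (le_trans (normc_cexp_le _))//.
by rewrite ler_expR normc_line.
Qed.

(** Along the segment t w the derivative is w (e^(t w) - 1), which the previous bound controls. This
    remainder later yields the complex differentiability of Cauchy's integral. *)
Lemma normc_cexp_sub1B w :
  normc (cexp w - 1 - w) <= normc w ^+ 2 * expR (normc w).
Proof.
have := @normc_MVT (fun t => cexp (t%:C * w) - 1 - t%:C * w) (fun t => w * (cexp (t%:C * w) - 1)).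
rewrite rmorph1 mul1r rmorph0 mul0r cexp0 !subrr; apply => // t.
  have d1 := cderive_atD (cderive_line w t) (cderive_at_cst t (- 1)).
  have d2 := cderive_atM (cderive_atR (is_derive_id t 1)) (cderive_at_cst t (- w)).
  have -> : (fun t0 : R => cexp (t0%:C * w) - 1 - t0%:C * w) =
            (fun t0 : R => cexp (t0%:C * w) + - 1 + t0%:C * - w).
    by apply/funext => s; rewrite mulrN.
  apply: (cderive_eq (cderive_atD d1 d2)).
  by rewrite rmorph1; ring.
move=> t01; rewrite normcM expr2 -mulrA ler_wpM2l ?normc_ge0//.
apply: (le_trans (normc_cexp_sub1 _)); apply: ler_pM; rewrite ?normc_ge0 ?expR_ge0//.
  exact: normc_line.
by rewrite ler_expR normc_line.
Qed.

End CexpEstimates.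

(** * Euler's integral as an integral over the line *)

Section GammaLine.
Context {R : realType}.
Local Notation C := R[i].
Local Notation mu := (@lebesgue_measure R).
Implicit Types (z : C) (y : R).

Definition gamma_kernel z y : C := cexp (z * y%:C - (expR y)%:C).

(* Euler's integral after the substitution t = e^y. *)
Definition gamma_line z : C := cintegral mu setT (gamma_kernel z).

Lemma normc_gamma_kernel z y : normc (gamma_kernel z y) = expR (Re z * y - expR y).
Proof. by rewrite normc_cexp cReD cReN cReM /= mulr0 subr0. Qed.

Lemma gamma_kernel_bound (s : R) : 1 <= s -> exists2 K, 0 < K &
  forall y, expR (s * y - expR y) <= K * expR (- `|y|).
Proof.
move=> s1; have s0 : 0 <= s + 1 by rewrite addr_ge0// (le_trans _ s1).
have [K K0 hK] := expR_expR_bound s0.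
have K1 : 1 <= K + 1 by rewrite lerDr ltW.
exists (K + 1) => [|y]; first by rewrite addr_gt0.
have [y0|y0] := leP 0 y.
  rewrite ger0_norm// expRD (le_trans (ler_wpM2l (expR_ge0 _) (hK y)))//.
  rewrite mulrCA -expRD mulrDl mul1r opprD addrA subrr add0r.
  by rewrite ler_wpM2r ?expR_ge0// lerDl.
rewrite ltr0_norm// opprK -[leLHS]mul1r ler_pM ?expR_ge0// ler_expR.
rewrite lerBlDr (le_trans (y := y))//; last by rewrite lerDl expR_ge0.
by nra.
Qed.

Lemma ccontinuous_gamma_kernel z : ccontinuous (gamma_kernel z).
Proof.
move=> y; apply: ccontinuous_at_cexp; apply: ccontinuous_atD.
  apply: ccontinuous_atM; first exact: ccontinuous_at_cst.
  exact: ccontinuous_atR.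
have -> : (fun x => - (expR x)%:C) = (fun x => (- expR x)%:C) :> (R -> C).
  by apply/funext => x; rewrite rmorphN.
by apply: ccontinuous_atR; apply: cvgN; exact: continuous_expR.
Qed.

(** For [y >= 0] the double exponential is bounded by a multiple of e^(-2 s y), half of which
    cancels e^(s y). For [y < 0] the factor e^(s y) decays by itself. *)
Lemma gamma_kernel_bound_gt0 (s : R) : 0 < s -> exists2 K, 0 < K &
  forall y, expR (s * y - expR y) <= K * expR (- (s * `|y|)).
Proof.
move=> s0; have s20 : 0 <= 2 * s by rewrite mulr_ge0// ltW.
have [K K0 hK] := expR_expR_bound s20.
have K1 : 1 <= K + 1 by rewrite lerDr ltW.
exists (K + 1) => [|y]; first by rewrite addr_gt0.
have [y0|y0] := leP 0 y.
  rewrite ger0_norm// expRD (le_trans (ler_wpM2l (expR_ge0 _) (hK y)))//.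
  rewrite mulrCA -expRD (_ : s * y + - (2 * s * y) = - (s * y)); last by ring.
  by rewrite ler_wpM2r ?expR_ge0// lerDl.
rewrite ltr0_norm// mulrN opprK -[leLHS]mul1r ler_pM ?expR_ge0// ler_expR.
by rewrite gerDl oppr_le0 expR_ge0.
Qed.

Lemma one_add_norm_le_expR (s : R) y : 0 < s ->
  1 + `|y| <= (1 + s^-1) * expR (s * `|y|).
Proof.
move=> s0; apply: (@le_trans _ _ ((1 + s^-1) * (1 + s * `|y|))); last first.
  by rewrite ler_wpM2l ?expR_ge1Dx// addr_ge0// invr_ge0 ltW.
have -> : (1 + s^-1) * (1 + s * `|y|) = 1 + `|y| + (s^-1 + s * `|y|).
  by field; rewrite gt_eqF.
by rewrite lerDl addr_ge0// ?invr_ge0 ?mulr_ge0// ltW.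
Qed.

Lemma expRN_norm_le_cauchy_gt0 (s : R) : 0 < s -> exists2 K, 0 < K &
  forall y, expR (- (s * `|y|)) <= K * cauchy_fun y.
Proof.
move=> s0; have s20 : 0 < s / 2 by rewrite divr_gt0.
exists ((1 + (s / 2)^-1) ^+ 2) => [|y]; first by rewrite exprn_gt0// addr_gt0 ?invr_gt0.
have h := one_add_norm_le_expR y s20.
rewrite /cauchy_fun ler_pdivlMr ?one_add_sqr_gt0// expRN mulrC ler_pdivrMr ?expR_gt0//.
have -> : expR (s * `|y|) = expR (s / 2 * `|y|) ^+ 2.
  by rewrite expr2 -expRD; congr expR; field.
rewrite -exprMn (le_trans (y := (1 + `|y|) ^+ 2))//; last first.
  by rewrite ler_sqr ?nnegrE ?addr_ge0// mulr_ge0 ?expR_ge0// addr_ge0// invr_ge0 ltW.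
by rewrite -(real_normK (num_real y)) sqrrD expr1n mul1r lerD2r lerDl mulrn_wge0.
Qed.

Lemma cintegrable_gamma_kernel_gt0 z : 0 < Re z -> cintegrable mu setT (gamma_kernel z).
Proof.
move=> z0; have [K K0 hK] := gamma_kernel_bound_gt0 z0.
have [L L0 hL] := expRN_norm_le_cauchy_gt0 z0.
apply: (@cintegrable_cauchy _ _ (K * L)); first exact: ccontinuous_gamma_kernel.
by move=> y; rewrite normc_gamma_kernel (le_trans (hK y))// -mulrA ler_pM2l.
Qed.

Lemma cintegrable_gamma_kernel z : 1 <= Re z -> cintegrable mu setT (gamma_kernel z).
Proof. by move=> z1; apply: cintegrable_gamma_kernel_gt0; apply: lt_le_trans z1. Qed.

Lemma gamma_kernelS z y : gamma_kernel (z + 1) y = (expR y)%:C * gamma_kernel z y.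
Proof.
by rewrite /gamma_kernel -cexpR -cexpD; congr cexp; ring.
Qed.

(** Integration by parts in the logarithmic variable: z times the kernel at z minus the kernel at z
    + 1 is the derivative of the kernel at z. *)
Lemma gamma_lineS_gt0 z : 0 < Re z -> gamma_line (z + 1) = z * gamma_line z.
Proof.
move=> z1; have z2 : 0 < Re (z + 1) by rewrite cReD /= addr_gt0.
apply/esym/eqP; rewrite -subr_eq0; apply/eqP.
have i1 := cintegrable_gamma_kernel_gt0 z1; have i2 := cintegrable_gamma_kernel_gt0 z2.
rewrite -cintegralZ// -cintegralB//; last exact: cintegrableZ.
have [K K0 hK] := gamma_kernel_bound_gt0 z1.
apply: (@cintegral_derivative0 _ _ (gamma_kernel z) (K * (1 + (Re z)^-1))).
- move=> t.
  have -> : (fun x => z * gamma_kernel z x - gamma_kernel (z + 1) x) =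
            (fun x => z * gamma_kernel z x + (- 1) * gamma_kernel (z + 1) x).
    by apply/funext => x; rewrite mulN1r.
  by apply: ccontinuous_atD; apply: ccontinuous_atM; try exact: ccontinuous_at_cst;
    exact: ccontinuous_gamma_kernel.
- move=> t; have dz := cderive_atM (cderive_at_cst t z) (cderive_atR (is_derive_id t 1)).
  have de := cderive_atM (cderive_at_cst t (- 1 : C)) (cderive_atR (is_derive_expR t)).
  have := cderive_at_cexp (cderive_atD dz de).
  have -> : (fun x : R => cexp (z * x%:C + -1 * (expR x)%:C)) = gamma_kernel z.
    by apply/funext => x; rewrite mulN1r.
  move=> h; apply: (cderive_eq h); rewrite gamma_kernelS /gamma_kernel rmorph1 mulN1r.
  by ring.
- move=> t; rewrite normc_gamma_kernel (le_trans (ler_wpM2r _ (hK t)))// ?addr_ge0//.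
  rewrite -mulrA ler_pM2l// expRN mulrC ler_pdivrMr ?expR_gt0//.
  exact: one_add_norm_le_expR.
- by apply: cintegrableB => //; exact: cintegrableZ.
Qed.

Lemma gamma_lineS z : 1 <= Re z -> gamma_line (z + 1) = z * gamma_line z.
Proof. by move=> z1; apply: gamma_lineS_gt0; apply: lt_le_trans z1. Qed.

Lemma gamma_line1 : gamma_line 1 = 1.
Proof.
have e : gamma_kernel 1 = (fun y => (expR (y - expR y))%:C).
  by apply/funext => y; rewrite /gamma_kernel mul1r -rmorphB /= cexpR.
have [ir _] : cintegrable mu setT (gamma_kernel 1) by exact: cintegrable_gamma_kernel.
rewrite /gamma_line e cintegral_real.
have hn (n : nat) : expR (- n.+1%:R) <= harmonic n :> R.
  rewrite expRN /harmonic /= lef_pV2 ?posrE ?expR_gt0 ?ltr0n//.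
  by apply: le_trans (expR_ge1Dx _); rewrite lerDr.
(* The primitive -exp(-e^y) tends to 0 at +oo and to -1 at -oo. *)
transitivity ((0 - (-1) : R)%:C); last by rewrite sub0r opprK.
congr (_%:C); apply: (Rintegral_derivative (F := fun y => - expR (- expR y))).
- move=> y; apply: (@continuous_comp _ _ _ (fun y : R => y - expR y) expR); last exact: continuous_expR.
  by apply: cvgB => //; exact: continuous_expR.
- move=> y; have d1 := is_deriveN (is_derive_expR y).
  have := is_deriveN (@is_derive1_comp R expR (- expR) y _ _ (is_derive_expR (- expR y)) d1).
  by move=> h; apply: (is_derive_eq h); rewrite expRD mulrN opprK mulrC.
- apply: (@squeeze_cvgr _ _ _ _ (fun n => - harmonic n) (fun=> 0)); last 2 first.
  + by rewrite -oppr0; apply: cvgN; exact: cvg_harmonic.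
  + exact: cvg_cst.
  apply: nearW => n; rewrite oppr_le0 expR_ge0 andbT lerN2 (le_trans _ (hn n))//.
  by rewrite ler_expR lerN2 (le_trans _ (expR_ge1Dx _))// lerDr.
- apply: (@squeeze_cvgr _ _ _ _ (fun=> - 1) (fun n => - 1 + harmonic n)); last 2 first.
  + exact: cvg_cst.
  + by rewrite -[X in _ --> X]addr0; apply: cvgD; [exact: cvg_cst|exact: cvg_harmonic].
  apply: nearW => n; rewrite lerN2 -expR0 ler_expR oppr_le0 expR_ge0 /= expR0.
  rewrite -lerBlDl opprK addrC lerBlDr -lerBlDl (le_trans _ (expR_ge1Dx _))//.
  by rewrite lerD2l lerN2.
- by move: ir; rewrite e.
Qed.

End GammaLine.

Section GammaIdentities.
Context {R : realType}.
Local Notation C := R[i].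
Local Notation mu := (@lebesgue_measure R).
Implicit Types (z : C) (y : R).

Lemma bigcup_itv_expR :
  \bigcup_n `[expR (- n.+1%:R), expR n.+1%:R]%classic = `]0, +oo[%classic :> set R.
Proof.
apply/seteqP; split => x /=.
  by move=> [n _] /=; rewrite !in_itv/= andbT => /andP[+ _]; apply: lt_le_trans; exact: expR_gt0.
rewrite in_itv/= andbT => x0.
have : (\bigcup_i sym_itv i : set R) (ln x) by rewrite bigcup_sym_itv.
case=> n _; rewrite /sym_itv /= in_itv /= => /andP[a b].
exists n => //=; rewrite in_itv/=.
by move: a b; rewrite -(ler_expR _ (ln x)) -(ler_expR (ln x)) lnK ?posrE// => -> ->.
Qed.

Lemma euler_integral_gamma_line z : 0 < Re z -> euler_integral z = gamma_line z.
Proof.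
move=> z1; pose h t : C := cpow t (z - 1) * (expR (- t))%:C.
have ch y : (`]0, +oo[%classic : set R) y -> ccontinuous_at y h.
  rewrite /= in_itv/= andbT => y0; apply: ccontinuous_atM.
    apply: ccontinuous_at_cexp; apply: ccontinuous_atM; first exact: ccontinuous_at_cst.
    by apply: ccontinuous_atR; exact: continuous_ln.
  apply: ccontinuous_atR; apply: continuous_comp; last exact: continuous_expR.
  exact: oppr_continuous.
have [i1 i2] := cintegral_substitution (@is_derive_expR R) (@continuous_expR R)
  (@expR_gt0 R) bigcup_itv_expR ch.
have e : (fun x : R => (expR x)%:C * h (expR x)) = gamma_kernel z.
  apply/funext => y; rewrite /h /cpow expRK.
  rewrite -[X in X * _]cexpR -[X in _ * (_ * X)]cexpR -!cexpD rmorphN.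
  by congr cexp; rewrite /=; ring.
rewrite e in i1 i2; rewrite /euler_integral i2//.
by apply/i1; exact: cintegrable_gamma_kernel_gt0.
Qed.

Lemma gamma_line_4 : gamma_line (4 : C) = 6.
Proof.
have -> : (4 : C) = 1 + 1 + 1 + 1 by ring.
do 3 (rewrite gamma_lineS; last by rewrite ?cReD /=; lra).
by rewrite gamma_line1; ring.
Qed.

(** Continuity at 4, which is to contradict a sequence of zeros converging to 4. Since |y| e^|y| <=
    e^(2y) + e^(-2y), the difference of the kernels is controlled by the kernels at 6 and 2. *)
Lemma gamma_line_lipschitz_4 : exists M : R, forall h : C, normc h <= 1 ->
  normc (gamma_line (4 + h) - gamma_line 4) <= normc h * M.
Proof.
have r2 : 1 <= (2 : R) by lra.
have r6 : 1 <= (6 : R) by lra.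
have [K2 K20 h2] := gamma_kernel_bound r2; have [K6 K60 h6] := gamma_kernel_bound r6.
exists (2 * \int[mu]_y (((K2 + K6) * 4) * cauchy_fun y)) => h h1.
have i4 : cintegrable mu setT (gamma_kernel (4 : C)).
  by apply: cintegrable_gamma_kernel => /=; lra.
have ih : cintegrable mu setT (gamma_kernel (4 + h)).
  apply: cintegrable_gamma_kernel; rewrite cReD /=.
  by have := normr_Re_le h; rewrite ler_norml => /andP[]; lra.
rewrite -cintegralB// mulrCA -RintegralZl//; last exact: integrableMr_cauchy_fun.
apply: cintegral_bound.
- by apply: cmeasurableB; apply: ccontinuous_measurable; exact: ccontinuous_gamma_kernel.
- move=> y.
  have -> : gamma_kernel (4 + h) y - gamma_kernel 4 y =
    gamma_kernel 4 y * (cexp (h * y%:C) - 1).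
    by rewrite mulrBr mulr1 -cexpD; congr (cexp _ - _); ring.
  rewrite normcM normc_gamma_kernel.
  have b1 := normc_cexp_sub1 (h * y%:C).
  have hy : normc (h * y%:C) <= `|y|.
    by rewrite normcM normcR ler_piMl.
  have b2 : normc (cexp (h * y%:C) - 1) <= normc h * (`|y| * expR `|y|).
    apply: (le_trans b1); rewrite normcM normcR -mulrA ler_wpM2l ?normc_ge0//.
    by rewrite ler_wpM2l// ler_expR ler_piMl.
  apply: (le_trans (ler_wpM2l (expR_ge0 _) b2)); rewrite mulrCA ler_wpM2l ?normc_ge0//.
  apply: (@le_trans _ _ ((K2 + K6) * expR (- `|y|))); last first.
    by rewrite -mulrA ler_pM2l ?addr_gt0// expRN_norm_le_cauchy.
  have b3 : `|y| * expR `|y| <= expR (2 * y) + expR (- (2 * y)).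
    apply: (@le_trans _ _ (expR `|y| * expR `|y|)).
      by rewrite ler_wpM2r ?expR_ge0// (le_trans _ (expR_ge1Dx _))// lerDr.
    rewrite -expRD; have [y0|y0] := leP 0 y.
      by rewrite ger0_norm// (_ : y + y = 2 * y) ?lerDl ?expR_ge0//; ring.
    by rewrite ltr0_norm// (_ : - y + - y = - (2 * y)) ?lerDr ?expR_ge0//; ring.
  apply: (le_trans (ler_wpM2l (expR_ge0 _) b3)).
  rewrite mulrDr -!expRD [leRHS](_ : _ = K6 * expR (- `|y|) + K2 * expR (- `|y|)) ?lerD//; last by ring.
    by apply: le_trans (h6 y); rewrite ler_expR /=; lra.
  by apply: le_trans (h2 y); rewrite ler_expR /=; lra.
- apply: (eq_integrable measurableT _ _ _ (integrableMr_cauchy_fun (normc h * ((K2 + K6) * 4)))).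
  by move=> y _ /=; rewrite !mulrA.
Qed.

End GammaIdentities.

(** * Cauchy's integral and its shifts *)

Section CauchyIntegrals.
Context {R : realType}.
Local Notation C := R[i].
Local Notation mu := (@lebesgue_measure R).
Implicit Types (z lambda : C) (t x y : R).

Lemma cmeasurable_comp d d' (T : measurableType d) (T' : measurableType d')
    (h : T' -> C) (f : T -> T') :
  cmeasurable h -> measurable_fun setT f -> cmeasurable (fun u : T => h (f u)).
Proof.
by move=> [mr mi] mf; split; [exact: measurableT_comp mr mf|exact: measurableT_comp mi mf].
Qed.

Definition log1sqr t : R := ln (1 + t ^+ 2).

Lemma log1sqr_ge0 t : 0 <= log1sqr t.
Proof. by rewrite ln_ge0// lerDl sqr_ge0. Qed.

Lemma continuous_log1sqr : continuous log1sqr.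
Proof.
move=> t; rewrite /log1sqr; apply: continuous_comp.
  exact: continuous_one_add_sqr.
by apply: continuous_ln; exact: one_add_sqr_gt0.
Qed.

Lemma expR_log1sqr t : expR (log1sqr t) = 1 + t ^+ 2.
Proof. by rewrite lnK// posrE one_add_sqr_gt0. Qed.

Lemma is_derive_log1sqr t : is_derive t (1 : R) log1sqr (2 * t / (1 + t ^+ 2)).
Proof.
have d1 := is_deriveD (is_derive_cst (1 : R) t (1 : R)) (is_deriveX 2 (is_derive_id t (1 : R))).
have := @is_derive1_comp R (@ln R) _ t _ _ (@is_derive1_ln R _ _) d1.
move=> /(_ (one_add_sqr_gt0 t)) h; apply: (is_derive_eq h).
by rewrite /GRing.scale /=; ring.
Qed.

(* (1 + t^2)^(-(lambda/2 + 1)) ((1 + i t) / |1 + i t|)^delta *)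
Definition cauchy_kernel lambda (delta : int) t : C :=
  cexp (- (lambda / 2 + 1) * (log1sqr t)%:C + 'i%C * delta%:~R * (atan t)%:C).

Definition cauchy_integral lambda (delta : int) : C :=
  cintegral mu setT (cauchy_kernel lambda delta).

Lemma ccontinuous_cauchy_kernel lambda delta : ccontinuous (cauchy_kernel lambda delta).
Proof.
move=> t; apply: ccontinuous_at_cexp; apply: ccontinuous_atD; apply: ccontinuous_atM;
  try exact: ccontinuous_at_cst; apply: ccontinuous_atR.
  exact: continuous_log1sqr.
exact: continuous_atan.
Qed.

Lemma Re_half z : Re (z / 2) = Re z / 2.
Proof.
have -> : (2 : C)^-1 = (2^-1 : R)%:C by rewrite fmorphV rmorph_nat.
by rewrite cReM Re_realc Im_realc mulr0 subr0.
Qed.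

Lemma Re_mulrR z x : Re (z * x%:C) = Re z * x.
Proof. by rewrite cReM Re_realc Im_realc mulr0 subr0. Qed.

Lemma Re_iM z : Re ('i%C * z) = - Im z.
Proof. by rewrite cReM /= mul0r mul1r sub0r. Qed.

Lemma normc_cauchy_kernel lambda delta t :
  normc (cauchy_kernel lambda delta t) = expR (- (Re lambda / 2 + 1) * log1sqr t).
Proof.
rewrite normc_cexp cReD !Re_mulrR cReN cReD Re_half Re_iM -(rmorph_int (real_complex R)) /=.
by rewrite oppr0 mul0r addr0.
Qed.

Lemma cauchy_kernel_bound lambda delta t : 0 <= Re lambda ->
  normc (cauchy_kernel lambda delta t) <= cauchy_fun t.
Proof.
move=> l0; rewrite normc_cauchy_kernel /cauchy_fun -expR_log1sqr -expRN ler_expR.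
by rewrite mulNr lerN2 ler_peMl ?log1sqr_ge0// lerDr divr_ge0.
Qed.

Lemma cintegrable_cauchy_kernel lambda delta : 0 <= Re lambda ->
  cintegrable mu setT (cauchy_kernel lambda delta).
Proof.
move=> l0; apply: (@cintegrable_cauchy _ _ 1); first exact: ccontinuous_cauchy_kernel.
by move=> t; rewrite mul1r cauchy_kernel_bound.
Qed.

End CauchyIntegrals.

Section CauchyRecurrence.
Context {R : realType}.
Local Notation C := R[i].
Local Notation mu := (@lebesgue_measure R).
Implicit Types (z lambda nu : C) (t x y : R) (delta : int).

Lemma mul_iR x : 'i%C * x%:C = 0 +i* x.
Proof. by apply: complex_eqP; rewrite !(cReM, cImM) /=; ring. Qed.

Lemma cexp_im x : cexp (0 +i* x) = cos x +i* sin x.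
Proof. by rewrite /cexp /= expR0 mul1r. Qed.

Lemma cexp_atan t : cexp ('i%C * (atan t)%:C) = (expR (- (log1sqr t / 2)))%:C * (1 +i* t).
Proof.
have c : cos (atan t) = expR (- (log1sqr t / 2)).
  rewrite cos_atan expRN; congr (_^-1).
  rewrite -expR_log1sqr (_ : expR (log1sqr t) = expR (log1sqr t / 2) ^+ 2).
    by rewrite sqrtr_sqr ger0_norm ?expR_ge0.
  by rewrite expr2 -expRD; congr expR; field.
have s : sin (atan t) = expR (- (log1sqr t / 2)) * t.
  by rewrite -c -[X in _ = _ * X]atanK /tan mulrC divfK// c gt_eqF// expR_gt0.
by rewrite mul_iR cexp_im; apply: complex_eqP; rewrite !(cReM, cImM) /= ?c ?s; ring.
Qed.

Lemma cauchy_kernelD lambda nu delta (e : int) t :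
  cauchy_kernel (lambda + nu) (delta + e) t =
  cauchy_kernel lambda delta t * cexp (- (nu / 2) * (log1sqr t)%:C + 'i%C * e%:~R * (atan t)%:C).
Proof. by rewrite /cauchy_kernel -cexpD rmorphD /=; congr cexp; field. Qed.

Lemma cexp_half (x : R) : cexp (- (1 / 2) * x%:C) = (expR (- (x / 2)))%:C.
Proof.
rewrite -cexpR; congr cexp; rewrite rmorphN fmorph_div rmorph_nat /=.
by field.
Qed.

(** Raising delta by 1 multiplies the kernel by e^(i atan t) = (1 + i t) (1 + t^2)^(-1/2), and the
    root is absorbed by raising lambda. *)
Lemma cauchy_kernel_shift1 lambda delta t :
  cauchy_kernel lambda (delta + 1) t = cauchy_kernel (lambda + 1) delta t * (1 +i* t).
Proof.
have := cauchy_kernelD lambda 0 delta 1 t; rewrite addr0 => ->.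
have := cauchy_kernelD lambda 1 delta 0 t; rewrite addr0 => ->.
rewrite mul0r oppr0 mul0r add0r mulr0 mul0r addr0 mulr1 cexp_atan cexp_half.
by rewrite mulrA.
Qed.

Lemma cauchy_kernel_shiftN1 lambda delta t :
  cauchy_kernel lambda (delta - 1) t = cauchy_kernel (lambda + 1) delta t * (1 -i* t).
Proof.
have := cauchy_kernelD lambda 0 delta (-1) t; rewrite addr0 rmorphN1 => ->.
have := cauchy_kernelD lambda 1 delta 0 t; rewrite addr0 => ->.
rewrite mul0r oppr0 mul0r add0r mulr0 mul0r addr0 cexp_half.
rewrite -[RHS]mulrA; congr (_ * _).
rewrite (_ : 'i%C * (-1) * (atan t)%:C = Num.conj ('i%C * (atan t)%:C)); last first.
  rewrite mul_iR mulrN1 mulNr mul_iR.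
  by apply: complex_eqP; rewrite /= ?oppr0.
rewrite -conj_cexp cexp_atan rmorphM /=.
by congr (_ * _); apply: complex_eqP; rewrite /= ?oppr0.
Qed.

Lemma cauchy_integral_sum nu delta : 0 <= Re nu ->
  cauchy_integral nu (delta + 1) + cauchy_integral nu (delta - 1) =
  2 * cauchy_integral (nu + 1) delta.
Proof.
move=> n0; have n1 : 0 <= Re (nu + 1) by rewrite cReD /= addr_ge0.
rewrite /cauchy_integral -(cintegralZ 2 (cintegrable_cauchy_kernel delta n1)).
rewrite -(cintegralD (cintegrable_cauchy_kernel (delta + 1) n0) (cintegrable_cauchy_kernel (delta - 1) n0)).
congr cintegral; apply/funext => t.
rewrite cauchy_kernel_shift1 cauchy_kernel_shiftN1 -mulrDr mulrC; congr (_ * _).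
by apply: complex_eqP; rewrite /= ?subrr ?addr0//; ring.
Qed.

(** The integrand of the difference of the two sides is a total derivative, namely that of 2 i times
    the kernel at (nu - 1, delta). The bound [1 <= Re nu] makes this primitive decay like 1/(1 +
    t^2). *)
Lemma cauchy_integral_diff nu delta : 1 <= Re nu ->
  (nu + 1) * (cauchy_integral nu (delta - 1) - cauchy_integral nu (delta + 1)) =
  2 * delta%:~R * cauchy_integral (nu + 1) delta.
Proof.
move=> n1; have n0 : 0 <= Re nu by apply: le_trans n1.
have n2 : 0 <= Re (nu + 1) by rewrite cReD /= addr_ge0.
have i1 := cintegrable_cauchy_kernel (delta - 1) n0.
have i2 := cintegrable_cauchy_kernel (delta + 1) n0.
have i3 := cintegrable_cauchy_kernel delta n2.
have lam0 : 0 <= Re (nu - 1) by rewrite cReD /= subr_ge0.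
pose H := cauchy_kernel (nu - 1) delta.
pose h t := (nu + 1) * (cauchy_kernel nu (delta - 1) t - cauchy_kernel nu (delta + 1) t)
  - 2 * delta%:~R * cauchy_kernel (nu + 1) delta t.
have hi : cintegrable mu setT h.
  by apply: cintegrableB; apply: cintegrableZ => //; exact: cintegrableB.
have : cintegral mu setT h = 0.
  apply: (@cintegral_derivative0 _ _ (fun t => 2 * 'i%C * H t) 4).
  - move=> t; apply: ccontinuous_atB; apply: ccontinuous_atM.
    + exact: ccontinuous_at_cst.
    + by apply: ccontinuous_atB; exact: ccontinuous_cauchy_kernel.
    + exact: ccontinuous_at_cst.
    + exact: ccontinuous_cauchy_kernel.
  - move=> t.
    have d1 := cderive_atM (cderive_at_cst t (- ((nu - 1) / 2 + 1)))
       (cderive_atR (is_derive_log1sqr t)).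
    have d2 := cderive_atM (cderive_at_cst t ('i%C * delta%:~R : C))
       (cderive_atR (is_derive1_atan t)).
    have d3 := cderive_atM (cderive_at_cst t (2 * 'i%C : C)) (cderive_at_cexp (cderive_atD d1 d2)).
    apply: (cderive_eq d3); rewrite /h cauchy_kernel_shift1 cauchy_kernel_shiftN1.
    have -> : cexp (- ((nu - 1) / 2 + 1) * (log1sqr t)%:C + 'i%C * delta%:~R * (atan t)%:C)
       = (1 + t ^+ 2)%:C * cauchy_kernel (nu + 1) delta t.
      rewrite -expR_log1sqr -cexpR -cexpD; congr cexp; by field.
    have t0 : (1 + t ^+ 2)%:C != 0 :> C.
      by rewrite (inj_eq (@complexI _)) gt_eqF// one_add_sqr_gt0.
    rewrite !mul0r !add0r fmorph_div fmorphV /=.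
    have -> : 1 +i* t = 1 + 'i%C * t%:C by rewrite mul_iR; apply: complex_eqP; rewrite /= ?addr0 ?add0r.
    have -> : 1 -i* t = 1 - 'i%C * t%:C by rewrite mul_iR; apply: complex_eqP; rewrite /= ?subr0 ?sub0r ?addr0.
    have i2' : ('i%C : C) ^+ 2 = -1 by exact: sqr_i.
    rewrite rmorphM rmorph_nat /=.
    move: t0 i2'; move: (1 + t ^+ 2)%:C ('i%C : C) (cauchy_kernel _ _ _) t%:C => T I K X T0 I2.
    rewrite -[- 1](_ : I ^+ 2 = _)//.
    field: I2 => //.
  - move=> t; rewrite (normcM _ (H t)) normcM.
    have -> : normc ('i%C : C) = 1 by rewrite /= expr0n expr1n add0r sqrtr1.
    rewrite mulr1 (_ : normc (2 : C) = 2); last first.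
      by rewrite -(rmorph_nat (real_complex R)) normcR ger0_norm.
    rewrite -mulrA (_ : 4 = 2 * 2) ?ler_pM2l//; last by ring.
    have hH : normc (H t) <= cauchy_fun t by exact: cauchy_kernel_bound.
    apply: (@le_trans _ _ (cauchy_fun t * (1 + `|t|))).
      by apply: ler_wpM2r => //; exact: addr_ge0.
    rewrite /cauchy_fun mulrC ler_pdivrMr ?one_add_sqr_gt0//.
    by rewrite -(real_normK (num_real t)); nra.
  - exact: hi.
rewrite cintegralB; [|by apply: cintegrableZ; exact: cintegrableB|exact: cintegrableZ].
rewrite !cintegralZ//; last exact: cintegrableB.
by rewrite cintegralB// => /eqP; rewrite subr_eq0 => /eqP.
Qed.

(** The shift (nu, delta) to (nu + 1, delta + 1) alters only the exponent of 1 - i t. The relation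
    results from eliminating the value at (nu, delta + 2) between the sum and difference relations
    at [delta + 1]. *)
Lemma cauchy_integral_up nu delta : 1 <= Re nu ->
  (nu + delta%:~R + 2) * cauchy_integral (nu + 1) (delta + 1) =
  (nu + 1) * cauchy_integral nu delta.
Proof.
move=> n1; have n0 : 0 <= Re nu by apply: le_trans n1.
have := cauchy_integral_sum (delta + 1) n0.
have := cauchy_integral_diff (delta + 1) n1.
rewrite addrK rmorphD /= => h1 h2.
move/(congr1 (fun z => z * (nu + 1))): h2; rewrite mulrDl => h2.
apply: (@mulfI _ 2); first by rewrite pnatr_eq0.
have -> : 2 * ((nu + 1) * cauchy_integral nu delta) =
  (cauchy_integral nu (delta + 1 + 1) * (nu + 1) + cauchy_integral nu delta * (nu + 1)) +
  (nu + 1) * (cauchy_integral nu delta - cauchy_integral nu (delta + 1 + 1)) by ring.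
by rewrite h1 h2; ring.
Qed.

Lemma cauchy_integral_down nu delta : 1 <= Re nu ->
  (nu - delta%:~R + 2) * cauchy_integral (nu + 1) (delta - 1) =
  (nu + 1) * cauchy_integral nu delta.
Proof.
move=> n1; have n0 : 0 <= Re nu by apply: le_trans n1.
have := cauchy_integral_sum (delta - 1) n0.
have := cauchy_integral_diff (delta - 1) n1.
rewrite subrK rmorphD rmorphN1 /= => h1 h2.
move/(congr1 (fun z => z * (nu + 1))): h2; rewrite mulrDl => h2.
apply: (@mulfI _ 2); first by rewrite pnatr_eq0.
have -> : 2 * ((nu + 1) * cauchy_integral nu delta) =
  (cauchy_integral nu delta * (nu + 1) + cauchy_integral nu (delta - 1 - 1) * (nu + 1)) -
  (nu + 1) * (cauchy_integral nu (delta - 1 - 1) - cauchy_integral nu delta) by ring.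
by rewrite h1 h2; ring.
Qed.

End CauchyRecurrence.

(** * The duplication relation *)

Section GammaSquare.
Context {R : realType}.
Local Notation C := R[i].
Local Notation mu := (@lebesgue_measure R).
Implicit Types (z lambda x : C) (t y eta : R).

Lemma gamma_line_shift z (b : R) : 1 <= Re z ->
  gamma_line z = cintegral mu setT (fun y => gamma_kernel z (y + b)).
Proof.
move=> z1; have [_ h] := cintegral_affine b (@ltr01 R) (ccontinuous_gamma_kernel z).
rewrite /gamma_line h; last exact: cintegrable_gamma_kernel.
by congr cintegral; apply/funext => y; rewrite !mul1r.
Qed.

Lemma cintegrable_gamma_kernel_shift z (b : R) : 1 <= Re z ->
  cintegrable mu setT (fun y => gamma_kernel z (y + b)).
Proof.
move=> z1; have [[h _] _] := cintegral_affine b (@ltr01 R) (ccontinuous_gamma_kernel z).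
rewrite (_ : (fun y => _) = (fun y => 1%:C * gamma_kernel z (1 * y + b))).
  exact/h/cintegrable_gamma_kernel.
by apply/funext => y; rewrite !mul1r.
Qed.

Lemma cmeasurable_gamma_kernel z : cmeasurable (gamma_kernel z).
Proof. exact/ccontinuous_measurable/ccontinuous_gamma_kernel. Qed.

Lemma integrable_const_cauchy (K : R) :
  mu.-integrable setT (EFin \o (fun y => K * cauchy_fun y)).
Proof. exact: integrableMr_cauchy_fun. Qed.

(** For [eta >= 0] the rate 3s/2 in the bound for exp(-e^(eta + y)) leaves e^(s y / 2) e^(-s eta /
    2), where s/2 >= 1. For [eta < 0] the second double exponential is dropped and e^(s eta) decays
    by itself. *)
Lemma gamma_square_domination (s : R) : 2 <= s -> exists2 K : R, 0 < K & forall y eta : R,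
  expR (s * y - expR y) * expR (s * (eta + y) - expR (eta + y)) <=
  (K * cauchy_fun y) * (4 * cauchy_fun eta).
Proof.
move=> s2; have h1 : 0 <= 3 * s / 2 by rewrite divr_ge0 ?mulr_ge0// (le_trans _ s2).
have [K K0 hK] := expR_expR_bound h1.
have h2 : 1 <= s / 2 by rewrite ler_pdivlMr ?mul1r.
have h3 : 1 <= 2 * s by lra.
have [K2 K20 hK2] := gamma_kernel_bound h2; have [K3 K30 hK3] := gamma_kernel_bound h3.
exists ((K * K2 + K3) * 4) => [|y eta]; first by rewrite mulr_gt0 ?addr_gt0 ?mulr_gt0.
have main : expR (s * y - expR y) * expR (s * (eta + y) - expR (eta + y)) <=
    (K * K2 + K3) * expR (- `|y|) * expR (- `|eta|).
  have [e0|e0] := leP 0 eta.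
    apply: (@le_trans _ _ (K * K2 * expR (- `|y|) * expR (- `|eta|))); last first.
      by rewrite !ler_wpM2r ?expR_ge0// lerDl ltW.
    rewrite (expRD (s * (eta + y))) mulrCA mulrA.
    apply: (le_trans (ler_wpM2l _ (hK (eta + y)))); first by rewrite mulr_ge0 ?expR_ge0.
    rewrite [leLHS]mulrCA [leRHS](_ : _ = K * (K2 * expR (- `|y|) * expR (- `|eta|))); last by ring.
    rewrite ler_pM2l// -!expRD.
    apply: (@le_trans _ _ (expR (s / 2 * y - expR y) * expR (- eta))).
      rewrite -expRD ler_expR; nra.
    by rewrite (ger0_norm e0) ler_wpM2r ?expR_ge0.
  apply: (@le_trans _ _ (K3 * expR (- `|y|) * expR (- `|eta|))); last first.
    by rewrite !ler_wpM2r ?expR_ge0// lerDr mulr_ge0 ?ltW.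
  apply: (@le_trans _ _ (expR (2 * s * y - expR y) * expR (- `|eta|))); last first.
    by rewrite ler_wpM2r ?expR_ge0.
  rewrite -!expRD ler_expR ltr0_norm// opprK.
  have := expR_ge0 (eta + y); nra.
apply: (le_trans main).
have -> : (K * K2 + K3) * 4 * cauchy_fun y * (4 * cauchy_fun eta) =
  (K * K2 + K3) * ((4 * cauchy_fun y) * (4 * cauchy_fun eta)) by ring.
rewrite -mulrA ler_pM2l ?addr_gt0 ?mulr_gt0// ler_pM ?expR_ge0//; exact: expRN_norm_le_cauchy.
Qed.

Definition log1exp eta : R := ln (1 + expR eta).

Lemma expR_log1exp eta : expR (log1exp eta) = 1 + expR eta.
Proof. by rewrite lnK// posrE addr_gt0// expR_gt0. Qed.

(** Because e^y + e^(y + eta) = e^(y + log(1 + e^eta)), the product of two kernels is a translate of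
    a single kernel, up to a factor depending on eta alone. *)
Lemma gamma_square_kernel x y eta :
  gamma_kernel x y * gamma_kernel x (y + eta) =
  cexp (x * (eta - 2 * log1exp eta)%:C) * gamma_kernel (2 * x) (y + log1exp eta).
Proof.
rewrite /gamma_kernel -!cexpD; congr cexp.
have -> : expR (y + log1exp eta) = expR y + expR (y + eta).
  by rewrite expRD expR_log1exp mulrDr mulr1 expRD.
by rewrite !(rmorphD, rmorphN, rmorphM) /=; ring.
Qed.

(** These are sinh(eta / 2) and its derivative cosh(eta / 2) / 2. *)
Let sh (eta : R) : R := (expR (eta / 2) - expR (- (eta / 2))) / 2.
Let sh' (eta : R) : R := (expR (eta / 2) + expR (- (eta / 2))) / 4.

Let sh'_gt0 eta : 0 < sh' eta.
Proof. by rewrite divr_gt0// addr_gt0 ?expR_gt0. Qed.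

Let is_derive_sh eta : is_derive eta (1 : R) sh (sh' eta).
Proof.
have d0 := is_deriveM (is_derive_id eta (1 : R)) (is_derive_cst (2^-1 : R) eta (1 : R)).
have d1 := @is_derive1_comp R expR _ eta _ _ (is_derive_expR _) d0.
have d2 := @is_derive1_comp R expR _ eta _ _ (is_derive_expR _) (is_deriveN d0).
have d3 := is_deriveM (is_deriveB d1 d2) (is_derive_cst (2^-1 : R) eta (1 : R)).
apply: (is_derive_eq d3); rewrite /sh' /GRing.scale /=.
by rewrite !(mulr0, add0r, mulr1); field.
Qed.

Let continuous_sh' : continuous sh'.
Proof.
move=> eta; apply: cvgM; last exact: cvg_cst.
have c1 : continuous_at eta (fun e : R => e / 2) by apply: cvgM; [exact: cvg_id|exact: cvg_cst].
apply: cvgD; apply: continuous_comp; try exact: continuous_expR; first exact: c1.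
by apply: cvgN; exact: c1.
Qed.

Let sqr_sh eta : 1 + sh eta ^+ 2 = (2 * sh' eta) ^+ 2.
Proof.
rewrite /sh /sh' expRN.
have := expR_gt0 (eta / 2); move: (expR _) => e e0.
by field; rewrite gt_eqF.
Qed.

Let bigcup_sh : \bigcup_n `[sh (- n.+1%:R), sh n.+1%:R]%classic = setT.
Proof.
have h n : 4^-1 * n.+1%:R + 0 <= sh n.+1%:R.
  rewrite addr0 /sh; have := expR_ge1Dx (n.+1%:R / 2 : R).
  have : expR (- (n.+1%:R / 2 : R)) <= 1.
    by rewrite -expR0 ler_expR oppr_le0 divr_ge0.
  by lra.
apply: (@bigcup_itv_setT _ _ (4^-1) 0) => //.
move=> n; have := h n; rewrite /sh mulNr opprK; lra.
Qed.

(** The integrand is (2 cosh(eta / 2))^(-2 x). With t = sinh(eta / 2), Cauchy's kernel at 2 x - 1 is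
    cosh^(-2 x - 1), and dt supplies the missing power of cosh. *)
Lemma cintegral_logistic x : 1 <= Re x ->
  cintegrable mu setT (fun eta => cexp (x * (eta - 2 * log1exp eta)%:C)) /\
  cintegral mu setT (fun eta => cexp (x * (eta - 2 * log1exp eta)%:C)) =
  2 * cexp (- (2 * x) * (ln 2)%:C) * cauchy_integral (2 * x - 1) 0.
Proof.
move=> x1.
have l0 : 0 <= Re (2 * x - 1).
  rewrite mulrDl mul1r !(cReD, cReN) /=; lra.
have ch y : (setT : set R) y -> ccontinuous_at y (cauchy_kernel (2 * x - 1) 0).
  by move=> _; exact: ccontinuous_cauchy_kernel.
have [i1 i2] := cintegral_substitution is_derive_sh continuous_sh' sh'_gt0 bigcup_sh ch.
rewrite /cauchy_integral i2; last exact: cintegrable_cauchy_kernel.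
have i3 := i1.1 (cintegrable_cauchy_kernel 0 l0).
rewrite -cintegralZ//.
suff -> : (fun eta => cexp (x * (eta - 2 * log1exp eta)%:C)) = (fun eta =>
    2 * cexp (- (2 * x) * (ln 2)%:C) * ((sh' eta)%:C * cauchy_kernel (2 * x - 1) 0 (sh eta))).
  by split => //; exact: cintegrableZ.
apply/funext => eta; rewrite /cauchy_kernel mulr0 mul0r addr0 /log1sqr sqr_sh.
set u := 2 * sh' eta; have u0 : 0 < u by rewrite mulr_gt0.
have -> : (sh' eta)%:C = 2^-1 * cexp (ln u)%:C.
  have e : u%:C = 2 * (sh' eta)%:C.
    by rewrite /u; apply: complex_eqP; rewrite !(cReM, cImM) /=; ring.
  by rewrite cexpR lnK ?posrE// e mulKf// pnatr_eq0.
have -> : ln (u ^+ 2) = 2 * ln u by rewrite lnXn// mulr_natl.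
have -> : log1exp eta = eta / 2 + ln 2 + ln u.
  apply: expR_inj; rewrite expR_log1exp !expRD !lnK ?posrE//.
  rewrite /u /sh' expRN; have -> : expR eta = expR (eta / 2) ^+ 2.
    by rewrite expr2 -expRD; congr expR; field.
  by have := expR_gt0 (eta / 2); move: (expR _) => e e0; field; rewrite gt_eqF.
rewrite !realcE; move: (ln u)%:C (ln 2)%:C eta%:C => U L E.
transitivity (cexp (- (2 * x) * L) * (cexp U * cexp (- ((2 * x - 1) / 2 + 1) * (2 * U)))); last first.
  by move: (cexp _) (cexp U) (cexp _) => a b c; field.
rewrite -!cexpD; congr cexp; by field.
Qed.

(* Legendre's duplication in disguise: in the double integral for Gamma(x)^2,
   integrate first along the diagonal; the remaining integral is brought to
   Cauchy's form by t = sinh(eta / 2). *)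
Lemma gamma_line_square x : 2 <= Re x ->
  gamma_line x ^+ 2 =
  gamma_line (2 * x) * (2 * cexp (- (2 * x) * (ln 2)%:C) * cauchy_integral (2 * x - 1) 0).
Proof.
move=> x2; have x1 : 1 <= Re x by apply: le_trans x2; lra.
have x4 : 1 <= Re (2 * x) by rewrite mulrDl mul1r cReD; lra.
have ik := cintegrable_gamma_kernel x1.
have [K K0 hK] := gamma_square_domination x2.
pose h (p : R * R) := gamma_kernel x p.1 * gamma_kernel x (p.1 + p.2).
have mh : cmeasurable h.
  apply: cmeasurableM; apply: cmeasurable_comp; try exact: cmeasurable_gamma_kernel.
    exact: measurable_fst.
  by apply: measurable_funD.
have hh y eta : normc (h (y, eta)) <= (K * cauchy_fun y) * (4 * cauchy_fun eta).
  by rewrite normcM !normc_gamma_kernel /= [y + eta]addrC.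
have pos (k : R) : 0 < k -> forall y, 0 <= k * cauchy_fun y.
  by move=> k0 y; rewrite mulr_ge0 ?ltW ?cauchy_fun_gt0.
have [_ e1 e2] := cFubini (integrable_const_cauchy K) (integrable_const_cauchy 4)
  (pos _ K0) (pos 4 (ltr0Sn _ _)) mh hh.
have shift_mul y (c : C) : c * gamma_line x =
    cintegral mu setT (fun eta => c * gamma_kernel x (y + eta)).
  have e : (fun eta => gamma_kernel x (eta + y)) = (fun eta => gamma_kernel x (y + eta)).
    by apply/funext => t; rewrite addrC.
  have i := cintegrable_gamma_kernel_shift y x1; rewrite e in i.
  by rewrite (cintegralZ c i) -e -(gamma_line_shift y x1).
have [li le] := cintegral_logistic x1.
transitivity (cintegral mu setT (fun y => cintegral mu setT (fun eta => h (y, eta)))).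
  rewrite expr2 {1}/gamma_line -(cintegralZr _ ik).
  by congr cintegral; apply/funext => y; rewrite (shift_mul y).
rewrite -e1 e2 -le -(cintegralZ (gamma_line (2 * x)) li).
congr cintegral; apply/funext => eta; rewrite /h /=.
under eq_fun do rewrite gamma_square_kernel.
have i := cintegrable_gamma_kernel_shift (log1exp eta) x4.
by rewrite (cintegralZ _ i) -(gamma_line_shift (log1exp eta) x4) mulrC.
Qed.

End GammaSquare.

Section GammaGauss.
Context {R : realType}.
Local Notation C := R[i].
Local Notation mu := (@lebesgue_measure R).
Implicit Types (z lambda x kappa : C) (t y eta : R).

(* By gamma_line_square a zero at z would give a zero at (z + 4) / 2, hence
   zeros converging to 4, where the value is 3! = 6. *)
Lemma gamma_line_neq0 z : 4 <= Re z -> gamma_line z != 0.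
Proof.
move=> z4; apply/eqP => gz0.
pose s n : C := (2^-1 ^+ n : R)%:C * (z - 4).
have sS n : s n.+1 = s n / 2.
  by rewrite /s exprS realcM realcV realc_nat; field.
have Rs n : 0 <= Re (s n).
  by rewrite /s mulrC Re_mulrR cReD cReN /= mulr_ge0 ?exprn_ge0 ?subr_ge0.
have zero n : gamma_line (4 + s n) = 0.
  elim: n => [|n IH]; first by rewrite /s expr0 mul1r addrC subrK.
  have zero_up : forall w : C, 1 <= Re w -> gamma_line w = 0 -> gamma_line (w + 1) = 0.
    by move=> w w1 w0; rewrite gamma_lineS// w0 mulr0.
  (* The functional equation carries the zero at 4 + s n to 8 + s n, which is twice 4 + s n.+1. *)
  have h8 : gamma_line (4 + s n + 1 + 1 + 1 + 1) = 0.
    apply: (zero_up _ _); first by have := Rs n; rewrite !cReD /= => h; lra.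
    apply: (zero_up _ _); first by have := Rs n; rewrite !cReD /= => h; lra.
    apply: (zero_up _ _); first by have := Rs n; rewrite !cReD /= => h; lra.
    by apply: (zero_up _ _); first by have := Rs n; rewrite !cReD /= => h; lra.
  have e : 2 * (4 + s n.+1) = 4 + s n + 1 + 1 + 1 + 1 by rewrite sS; field.
  have r2 : 2 <= Re (4 + s n.+1) by rewrite cReD /=; move: (Rs n.+1); lra.
  have := gamma_line_square r2; rewrite e h8 mul0r => /eqP.
  by rewrite expf_eq0 => /andP[_ /eqP].
have [M hM] := @gamma_line_lipschitz_4 R.
have [n [n1 n2]] : exists n, normc (s n) <= 1 /\ normc (s n) * M < 6.
  (* Once 2^n exceeds |z - 4| (1 + |M|), the product |s n| (1 + |M|) is at most 1, which gives both
     bounds at once. *)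
  pose B := normc (z - 4) * (1 + `|M|).
  have B0 : 0 <= B by rewrite mulr_ge0 ?normc_ge0 ?addr_ge0.
  exists (Num.truncn B).+1.
  set n := (_).+1; have hn : B < n%:R by exact: truncnS_gt.
  have h2 : n%:R <= 2 ^+ n :> R by rewrite -natrX ler_nat ltnW// ltn_expl.
  have nE : normc (s n) * (1 + `|M|) <= 1.
    rewrite /s normcM normcR ger0_norm ?exprn_ge0// exprVn -mulrA mulrC ler_pdivrMr ?exprn_gt0// mul1r.
    by rewrite (le_trans (ltW hn)).
  have := normc_ge0 (s n); have := ler_norm M; have := normr_ge0 M.
  by move=> *; split; nra.
have := hM _ n1; rewrite zero sub0r gamma_line_4.
have -> : normc (- 6 : C) = 6.
  by rewrite -realc_nat -realcN normcR normrN ger0_norm.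
by move=> /le_lt_trans /(_ n2); rewrite ltxx.
Qed.

Lemma ccontinuous_gauss_fun : ccontinuous (fun t : R => (gauss_fun t)%:C).
Proof. by move=> t; apply: ccontinuous_atR; exact: continuous_gauss_fun. Qed.

Lemma cintegrable_gauss_fun : cintegrable mu setT (fun t : R => (gauss_fun t)%:C).
Proof. by split => /=; [exact: integrableT_gauss|exact: integrable0]. Qed.

Lemma cintegral_gauss (a : R) :
  cintegrable mu setT (fun t => (expR (- (expR a * t ^+ 2)))%:C) /\
  cintegral mu setT (fun t => (expR (- (expR a * t ^+ 2)))%:C) =
  (Num.sqrt pi * expR (- (a / 2)))%:C.
Proof.
have b0 : 0 < expR (a / 2) by exact: expR_gt0.
have [[i _] e] := cintegral_affine 0 b0 ccontinuous_gauss_fun.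
have fE : (fun t => (expR (- (expR a * t ^+ 2)))%:C) =
    (fun t => (expR (- (a / 2)))%:C * ((expR (a / 2))%:C * (gauss_fun (expR (a / 2) * t + 0))%:C)).
  apply/funext => t; rewrite -!realcM; congr (_%:C).
  rewrite mulrA -expRD addNr expR0 mul1r addr0 /gauss_fun exprMn.
  by rewrite (_ : expR a = expR (a / 2) ^+ 2)// expr2 -expRD; congr expR; field.
have i' := i cintegrable_gauss_fun; rewrite fE; split; first exact: cintegrableZ.
rewrite cintegralZ// -e; last exact: cintegrable_gauss_fun.
by rewrite cintegral_real /Rintegral integralT_gauss /= -realcM mulrC.
Qed.

(** At the parameter 2 kappa - 2 Cauchy's kernel is (1 + t^2)^(-kappa); translating y by log(1 +
    t^2) produces the opposite power. *)
Lemma cauchy_kernel_shift_gamma kappa t y :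
  cauchy_kernel (2 * kappa - 2) 0 t * gamma_kernel kappa (y + log1sqr t) =
  gamma_kernel kappa y * (expR (- (expR y * t ^+ 2)))%:C.
Proof.
rewrite /cauchy_kernel /gamma_kernel -(cexpR (- _)) -!cexpD; congr cexp.
have -> : expR (y + log1sqr t) = expR y + expR y * t ^+ 2.
  by rewrite expRD expR_log1sqr mulrDr mulr1.
rewrite mulr0 mul0r addr0 !realcE.
by field.
Qed.

(** From e^(-x) <= 1/(1 + x) follows exp(-e^y t^2) <= (1 + e^(-y)) / (1 + t^2); the term e^(-y)
    lowers the exponent s by 1. *)
Lemma gamma_gauss_domination (s : R) : 3 <= s -> exists2 K : R, 0 < K & forall t y : R,
  expR (s * y - expR y) * expR (- (expR y * t ^+ 2)) <= (1 * cauchy_fun t) * (K * cauchy_fun y).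
Proof.
move=> s3; have h1 : 1 <= s by lra.
have h2 : 1 <= s - 1 by lra.
have [K1 K10 hK1] := gamma_kernel_bound h1; have [K2 K20 hK2] := gamma_kernel_bound h2.
exists ((K1 + K2) * 4) => [|t y]; first by rewrite mulr_gt0 ?addr_gt0.
have e0 := expR_gt0 y.
have b1 : expR (- (expR y * t ^+ 2)) <= (1 + expR (- y)) * cauchy_fun t.
  rewrite /cauchy_fun ler_pdivlMr ?one_add_sqr_gt0// expRN mulrC ler_pdivrMr ?expR_gt0//.
  have := expR_ge1Dx (expR y * t ^+ 2); move: (expR (expR y * t ^+ 2)) => e he.
  apply: (@le_trans _ _ ((1 + expR (- y)) * (1 + expR y * t ^+ 2))).
    have := mulVf (lt0r_neq0 e0); rewrite -expRN => hv.
    have := expR_gt0 (- y); have := sqr_ge0 t.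
    by move: hv; move: (t ^+ 2) (expR (- y)) (expR y) e0 => T V E *; nra.
  by rewrite ler_wpM2l// addr_ge0 ?expR_ge0.
apply: (le_trans (ler_wpM2l (expR_ge0 _) b1)).
rewrite mul1r [leRHS]mulrC mulrA; apply: ler_wpM2r; first by rewrite ltW// cauchy_fun_gt0.
apply: (@le_trans _ _ ((K1 + K2) * expR (- `|y|))); last first.
  by rewrite -mulrA ler_pM2l ?addr_gt0 ?expRN_norm_le_cauchy.
rewrite mulrDr mulr1 -expRD mulrDl lerD//.
by apply: le_trans (hK2 y); rewrite ler_expR; lra.
Qed.

(* Write (1 + t^2)^(-kappa) Gamma(kappa) as an integral of exp(- (1 + t^2) e^y)
   and integrate first in t. *)
Lemma cauchy_integral_gauss kappa : 3 <= Re kappa ->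
  cauchy_integral (2 * kappa - 2) 0 * gamma_line kappa =
  (Num.sqrt pi)%:C * gamma_line (kappa - 2^-1).
Proof.
move=> k3; have k1 : 1 <= Re kappa by lra.
have r0 : 0 <= Re (2 * kappa - 2) by rewrite mulrDl mul1r !(cReD, cReN) /=; lra.
have khalf : 1 <= Re (kappa - 2^-1).
  by rewrite -realc_nat -realcV cReD cReN Re_realc; lra.
have [K K0 hK] := gamma_gauss_domination k3.
pose h (p : R * R) := gamma_kernel kappa p.2 * (expR (- (expR p.2 * p.1 ^+ 2)))%:C.
have mh : cmeasurable h.
  apply: cmeasurableM; first by apply: cmeasurable_comp; [exact: cmeasurable_gamma_kernel|exact: measurable_snd].
  apply: cmeasurableR; apply: measurableT_comp => //; apply: measurableT_comp => //.
  apply: measurable_funM; first by apply: measurableT_comp.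
  by apply: measurable_funX.
have hh t y : normc (h (t, y)) <= (1 * cauchy_fun t) * (K * cauchy_fun y).
  by rewrite normcM normc_gamma_kernel normcR ger0_norm ?expR_ge0.
have pos (k : R) : 0 < k -> forall y, 0 <= k * cauchy_fun y.
  by move=> k0 y; rewrite mulr_ge0 ?ltW ?cauchy_fun_gt0.
have [_ e1 e2] := cFubini (integrable_const_cauchy 1) (integrable_const_cauchy K)
  (pos _ ltr01) (pos _ K0) mh hh.
transitivity (cintegral mu setT (fun t => cintegral mu setT (fun y => h (t, y)))).
  rewrite {1}/cauchy_integral -(cintegralZr _ (cintegrable_cauchy_kernel 0 r0)).
  congr cintegral; apply/funext => t; rewrite (gamma_line_shift (log1sqr t) k1).
  rewrite -(cintegralZ _ (cintegrable_gamma_kernel_shift (log1sqr t) k1)).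
  by congr cintegral; apply/funext => y; rewrite cauchy_kernel_shift_gamma.
rewrite -e1 e2 /gamma_line -(cintegralZ _ (cintegrable_gamma_kernel khalf)).
congr cintegral; apply/funext => y; rewrite /h /=.
have [i e] := cintegral_gauss y.
rewrite (cintegralZ _ i) e realcM mulrCA; congr (_ * _).
rewrite -cexpR /gamma_kernel -cexpD; congr cexp; rewrite !realcE.
by field.
Qed.

(** The Gauss quotients at kappa and kappa - 1/2 telescope to Gamma(kappa - 1) / Gamma(kappa). This
    product is what a radial integral over the plane becomes when it is computed one Cartesian
    coordinate at a time. *)
Lemma cauchy_integral_mul kappa : 5 <= Re kappa ->
  (kappa - 1) * (cauchy_integral (2 * kappa - 2) 0 * cauchy_integral (2 * kappa - 3) 0) = (pi : R)%:C.
Proof.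
move=> k5.
have k3 : 3 <= Re kappa by lra.
have Rh : Re (kappa - 2^-1) = Re kappa - 2^-1 by rewrite -realc_nat -realcV cReD cReN Re_realc.
have k3' : 3 <= Re (kappa - 2^-1) by rewrite Rh; lra.
have g1 := cauchy_integral_gauss k3; have g2 := cauchy_integral_gauss k3'.
have e1 : 2 * (kappa - 2^-1) - 2 = 2 * kappa - 3 by field.
have e2 : kappa - 2^-1 - 2^-1 = kappa - 1 by field.
have g3 : gamma_line kappa = (kappa - 1) * gamma_line (kappa - 1).
  by rewrite -gamma_lineS ?subrK// cReD cReN /=; lra.
have n1 : gamma_line (kappa - 1) != 0 by apply: gamma_line_neq0; rewrite cReD cReN /=; lra.
have n2 : gamma_line (kappa - 2^-1) != 0 by apply: gamma_line_neq0; rewrite Rh; lra.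
have n3 : gamma_line kappa != 0 by apply: gamma_line_neq0; lra.
rewrite e1 e2 in g2; rewrite g3 in g1 n3.
have sp : (Num.sqrt pi)%:C * (Num.sqrt pi)%:C = (pi : R)%:C :> C.
  by rewrite -realcM -expr2 sqr_sqrtr// pi_ge0.
apply: (mulIf n1); apply: (mulIf n2).
rewrite -sp.
transitivity ((cauchy_integral (2 * kappa - 2) 0 * ((kappa - 1) * gamma_line (kappa - 1))) *
   (cauchy_integral (2 * kappa - 3) 0 * gamma_line (kappa - 2^-1))); first by ring.
by rewrite g1 g2; ring.
Qed.

(** The Gauss relation is squared and Gamma(x)^2, x = (lambda + 1)/2, is replaced by means of
    [gamma_line_square]. Both relations contain Cauchy's integral at lambda, so one factor cancels;
    it is nonzero because Gamma(x) is. *)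
Lemma cauchy_integral_gamma0 lambda : 8 <= Re lambda ->
  cauchy_integral lambda 0 * gamma_line (lambda / 2 + 1) ^+ 2 =
  (pi : R)%:C * cpow 2 (- lambda) * gamma_line (lambda + 1).
Proof.
move=> l8; set x := (lambda + 1) / 2; set kappa := lambda / 2 + 1.
have Rx : 4 <= Re x by rewrite /x Re_half cReD /=; lra.
have Rk : 3 <= Re kappa by rewrite /kappa cReD Re_half /=; lra.
have g1 := cauchy_integral_gauss Rk; have g2 := gamma_line_square (le_trans (_ : 2 <= 4) Rx).
have e1 : 2 * kappa - 2 = lambda by rewrite /kappa; field.
have e2 : kappa - 2^-1 = x by rewrite /x /kappa; field.
have e3 : 2 * x = lambda + 1 by rewrite /x; field.
have e4 : 2 * x - 1 = lambda by rewrite /x; field.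
rewrite e1 e2 in g1; rewrite e4 e3 in g2.
have r24 : 2 <= 4 :> R by lra.
have {}g2 := g2 r24.
have nx := gamma_line_neq0 Rx.
have sp : (Num.sqrt pi)%:C ^+ 2 = (pi : R)%:C :> C.
  by rewrite -realcX sqr_sqrtr// pi_ge0.
have p2 : 2 * cexp (- (lambda + 1) * (ln 2)%:C) = cpow 2 (- lambda) :> C.
  rewrite /cpow -[X in X * _ = _](_ : cexp (ln 2 : R)%:C = 2); last by rewrite cexpR lnK ?posrE// realc_nat.
  by rewrite -cexpD; congr cexp; ring.
have c0 : cauchy_integral lambda 0 != 0.
  apply/eqP => c0; move: g2; rewrite c0 !mulr0 => /eqP.
  by rewrite expf_eq0 (negbTE nx).
apply: (mulfI c0).
transitivity ((cauchy_integral lambda 0 * gamma_line kappa) ^+ 2); first by ring.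
by rewrite g1 exprMn sp g2 p2; ring.
Qed.

End GammaGauss.

(** * Gamma off its poles and the value of Cauchy's integral *)

Section GammaFunction.
Context {R : realType}.
Local Notation C := R[i].
Implicit Types (z lambda : C) (delta : int) (n m : nat).

Definition rising z n : C := \prod_(i < n) (z + i%:R).

Lemma rising0 z : rising z 0 = 1. Proof. by rewrite /rising big_ord0. Qed.

Lemma risingS z n : rising z n.+1 = rising z n * (z + n%:R).
Proof. by rewrite /rising big_ord_recr. Qed.

Lemma risingD z n m : rising z (n + m) = rising z n * rising (z + n%:R) m.
Proof.
elim: m => [|m IH]; first by rewrite addn0 rising0 mulr1.
by rewrite addnS !risingS IH natrD -!mulrA addrA.
Qed.

Lemma risingSl z n : rising z n.+1 = z * rising (z + 1) n.
Proof. by rewrite -add1n risingD risingS rising0 mul1r addr0. Qed.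

Definition nonpole z := forall n, z + n%:R != 0.

Lemma rising_neq0 z n : nonpole z -> rising z n != 0.
Proof. by move=> hz; apply/prodf_neq0 => i _. Qed.

Lemma nonpoleD z n : nonpole z -> nonpole (z + n%:R).
Proof. by move=> hz m; rewrite -addrA -natrD. Qed.

Lemma Re_nat n : Re (n%:R : C) = n%:R.
Proof. by rewrite -realc_nat. Qed.

Lemma nonpole_gt0 z : 0 < Re z -> nonpole z.
Proof.
move=> z0 n; apply/eqP => /(congr1 (@complex.Re R)); rewrite cReD Re_nat /=.
by move/eqP; rewrite gt_eqF// ltr_wpDr.
Qed.

Lemma gamma_line_rising z n : 0 < Re z -> gamma_line (z + n%:R) = rising z n * gamma_line z.
Proof.
move=> z0; elim: n => [|n IH]; first by rewrite addr0 rising0 mul1r.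
rewrite -natr1 addrA gamma_lineS_gt0 ?IH ?risingS; first by ring.
by rewrite cReD Re_nat ltr_wpDr.
Qed.

(** [Gamma] is defined with the least admissible shift; off the poles every larger shift gives the
    same value. *)
Lemma GammaE z n : nonpole z -> 0 < Re (z + n%:R) ->
  Gamma z = gamma_line (z + n%:R) / rising z n.
Proof.
move=> hz; rewrite cReD Re_nat => zn; rewrite /Gamma.
set p := Num.truncn _.
have zp : 0 < Re (z + p%:R).
  by rewrite cReD Re_nat; have := truncnS_gt (1 - Re z); rewrite -/p -natr1; lra.
have pn : (p <= n)%N.
  by rewrite leqNgt truncn_gt_nat -natr1; apply/negP => h; lra.
rewrite euler_integral_gamma_line// -(subnKC pn) natrD addrA (gamma_line_rising (n - p) zp).
rewrite risingD -[\prod_(i < p) _]/(rising z p).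
have := rising_neq0 p hz; have := rising_neq0 (n - p) (nonpoleD p hz).
by move=> h1 h2; field; rewrite h1 h2.
Qed.

Lemma Gamma_gamma_line z : 0 < Re z -> Gamma z = gamma_line z.
Proof.
move=> z0; rewrite (@GammaE _ 0) ?addr0//; last exact: nonpole_gt0.
by rewrite rising0 divr1.
Qed.

Lemma exists_nat_Re_ge z (B : R) : exists n, B <= Re (z + n%:R).
Proof.
exists (Num.truncn (B - Re z)).+1; rewrite cReD Re_nat -lerBlDl ltW//.
exact: truncnS_gt.
Qed.

Lemma Gamma_neq0 z : nonpole z -> Gamma z != 0.
Proof.
move=> hz; have [n zn] := exists_nat_Re_ge z 4.
rewrite (GammaE hz (lt_le_trans _ zn))//.
by rewrite mulf_neq0 ?invr_neq0 ?gamma_line_neq0 ?rising_neq0.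
Qed.

Lemma Gamma_rising z n : nonpole z -> Gamma (z + n%:R) = rising z n * Gamma z.
Proof.
move=> hz; have [N zN] := exists_nat_Re_ge (z + n%:R) 4.
have z0 : 0 < Re (z + n%:R + N%:R) by apply: lt_le_trans zN.
rewrite (GammaE (nonpoleD n hz) z0) (@GammaE z (n + N)) ?natrD ?addrA//.
rewrite risingD.
have := rising_neq0 n hz; have := rising_neq0 N (nonpoleD n hz).
by move=> h1 h2; field; rewrite h1 h2.
Qed.

Lemma GammaS z : nonpole z -> Gamma (z + 1) = z * Gamma z.
Proof. by move=> hz; rewrite -[X in z + X]/(1%:R) Gamma_rising// risingS rising0 mul1r addr0. Qed.

Lemma cpowD (x : R) z w : cpow x (z + w) = cpow x z * cpow x w.
Proof. by rewrite /cpow mulrDl cexpD. Qed.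

Lemma cpow2N1 : cpow 2 (- 1) = 2^-1 :> C.
Proof. by rewrite /cpow mulN1r cexpN cexpR lnK ?posrE// realc_nat. Qed.

Lemma Re_intr delta : Re (delta%:~R : C) = delta%:~R.
Proof. by rewrite -(rmorph_int (real_complex R)). Qed.

(** Induction on |delta|, with a boolean recording the sign of delta. Each step raises lambda by 1
    and moves delta by 1, which accounts for |delta| in the bound; 8 is the bound for
    [delta = 0]. *)
Lemma cauchy_integral_gamma lambda delta : 8 + `|delta|%:~R <= Re lambda ->
  cauchy_integral lambda delta *
    (Gamma (1 + (lambda - delta%:~R) / 2) * Gamma (1 + (lambda + delta%:~R) / 2)) =
  (pi : R)%:C * cpow 2 (- lambda) * Gamma (lambda + 1).
Proof.
have pos (l : C) (d : int) : 8 + `|d|%:~R <= Re l ->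
    0 < Re (1 + (l - d%:~R) / 2) /\ 0 < Re (1 + (l + d%:~R) / 2).
  have h1 : (d%:~R : R) <= `|d|%:~R by rewrite ler_int ler_norm.
  have h2 : - (d%:~R : R) <= `|d|%:~R by rewrite -rmorphN ler_int -normrN ler_norm.
  by move=> h; rewrite !cReD !Re_half !cReD cReN Re_intr /=; split; lra.
have step (l : C) (d : int) (e : bool) : 8 + `|d|%:~R <= Re l ->
  cauchy_integral l d * (Gamma (1 + (l - d%:~R) / 2) * Gamma (1 + (l + d%:~R) / 2)) =
    (pi : R)%:C * cpow 2 (- l) * Gamma (l + 1) ->
  let d' : int := if e then d + 1 else d - 1 in
  cauchy_integral (l + 1) d' * (Gamma (1 + (l + 1 - d'%:~R) / 2) * Gamma (1 + (l + 1 + d'%:~R) / 2)) =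
    (pi : R)%:C * cpow 2 (- (l + 1)) * Gamma (l + 1 + 1).
  move=> ld IH; have [p1 p2] := pos _ _ ld.
  have l8 : 8 <= Re l by apply: le_trans ld; rewrite lerDl ler0z.
  have l1 : 1 <= Re l by lra.
  have npl : nonpole (l + 1) by apply: nonpole_gt0; rewrite cReD /=; lra.
  rewrite (GammaS npl) opprD cpowD cpow2N1.
  have -> : (pi : R)%:C * (cpow 2 (- l) / 2) * ((l + 1) * Gamma (l + 1)) =
    (l + 1) / 2 * (cauchy_integral l d * (Gamma (1 + (l - d%:~R) / 2) * Gamma (1 + (l + d%:~R) / 2))).
    by rewrite IH; ring.
  case: e => /=.
    have u := cauchy_integral_up d l1.
    have -> : 1 + (l + 1 - (d + 1)%:~R) / 2 = 1 + (l - d%:~R) / 2 by rewrite rmorphD /=; field.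
    have -> : 1 + (l + 1 + (d + 1)%:~R) / 2 = 1 + (l + d%:~R) / 2 + 1 by rewrite rmorphD /=; field.
    rewrite (GammaS (nonpole_gt0 p2)).
    have -> (a b c : C) : a * (b * ((1 + (l + d%:~R) / 2) * c)) = ((l + d%:~R + 2) * a) / 2 * (b * c).
      by field.
    by rewrite u; field.
  have u := cauchy_integral_down d l1.
  have -> : 1 + (l + 1 - (d - 1)%:~R) / 2 = 1 + (l - d%:~R) / 2 + 1 by rewrite rmorphB /=; field.
  have -> : 1 + (l + 1 + (d - 1)%:~R) / 2 = 1 + (l + d%:~R) / 2 by rewrite rmorphB /=; field.
  rewrite (GammaS (nonpole_gt0 p1)).
  have -> (a b c : C) : a * ((1 + (l - d%:~R) / 2) * b * c) = ((l - d%:~R + 2) * a) / 2 * (b * c).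
    by field.
  by rewrite u; field.
have main n (e : bool) (l : C) : 8 + n%:R <= Re l -> let d : int := if e then n%:Z else - n%:Z in
  cauchy_integral l d * (Gamma (1 + (l - d%:~R) / 2) * Gamma (1 + (l + d%:~R) / 2)) =
    (pi : R)%:C * cpow 2 (- l) * Gamma (l + 1).
  elim: n l => [|n IH] l hl.
    have d0 : (if e then Posz 0 else - Posz 0) = 0 by case: e.
    rewrite /= d0 /= subr0 addr0 -expr2.
    have l8 : 8 <= Re l by move: hl; rewrite addr0.
    have h0 : 0 < Re (1 + l / 2) by rewrite cReD Re_half /=; lra.
    rewrite (Gamma_gamma_line h0) [X in gamma_line X]addrC cauchy_integral_gamma0//.
    by rewrite Gamma_gamma_line// cReD /=; lra.
  have hl' : 8 + n%:R <= Re (l - 1) by rewrite cReD cReN /=; move: hl; rewrite -natr1; lra.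
  have hd : `|if e then n%:Z else - n%:Z| = n%:Z by case: (e); rewrite ?normrN.
  have := step (l - 1) (if e then n%:Z else - n%:Z) e _ (IH (l - 1) hl').
  rewrite subrK; have -> : (if e then (if e then n%:Z else - n%:Z) + 1 else (if e then n%:Z else - n%:Z) - 1)
     = (if e then n.+1%:Z else - n.+1%:Z) by case: (e); lia.
  by apply; rewrite hd.
case: delta => n hn.
  by apply: (main n true).
rewrite NegzE in hn *; apply: (main n.+1 false).
by move: hn; rewrite normrN.
Qed.

End GammaFunction.

(** * Integrals over the opposite unipotent group *)

Section Haar.
Context {R : realType}.
Local Notation C := R[i].
Local Notation mu := (@lebesgue_measure R).

Lemma sigma_finite_plane : sigma_finite setT (mu \x mu)%E.
Proof.
exists (fun n => sym_itv n `*` sym_itv n).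
  apply/seteqP; split => // -[x y] _.
  have hx : (\bigcup_i sym_itv i : set R) x by rewrite bigcup_sym_itv.
  have hy : (\bigcup_i sym_itv i : set R) y by rewrite bigcup_sym_itv.
  case: hx => n _ hn; case: hy => m _ hm; exists (maxn n m) => //; split => /=.
    by move: hn; apply/subsetPset/sym_itv_nd/leq_maxl.
  by move: hm; apply/subsetPset/sym_itv_nd/leq_maxr.
move=> n; split; first by apply: measurableX; exact: measurable_sym_itv.
rewrite product_measure1E; [|exact: measurable_sym_itv..].
have fi : mu (sym_itv n) \is a fin_num.
  have := lebesgue_measure_itv (`[- n.+1%:R, n.+1%:R] : interval R).
  by rewrite /sym_itv => ->; case: ifPn.
by rewrite lte_mul_pinfty// ltey_eq fi.
Qed.

(** The product measure packed with its sigma-finiteness, so that Fubini's theorem applies a second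
    time for the third coordinate. *)
Definition plane_measure : {sigma_finite_measure set _ -> \bar R} :=
  HB.pack (product_measure1 mu mu) (Measure_isSigmaFinite.Build _ _ _ _ sigma_finite_plane).

Lemma cauchy_fun_ge0 (y : R) : 0 <= cauchy_fun y. Proof. exact: ltW (cauchy_fun_gt0 y). Qed.

Lemma cFubini3_cauchy (h : R * R * R -> C) : cmeasurable h ->
  (forall x y w, normc (h (x, y, w)) <= cauchy_fun x * cauchy_fun y * cauchy_fun w) ->
  [/\ cintegrable ((mu \x mu) \x mu)%E setT h,
      cintegral ((mu \x mu) \x mu)%E setT h =
        cintegral (mu \x mu)%E setT (fun p => cintegral mu setT (fun w => h (p, w))) &
      cintegral ((mu \x mu) \x mu)%E setT h =
        cintegral mu setT (fun w => cintegral (mu \x mu)%E setT (fun p => h (p, w)))].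
Proof.
move=> mh hg.
pose g (p : R * R) : R := cauchy_fun p.1 * cauchy_fun p.2.
have ig : plane_measure.-integrable setT (EFin \o g) :=
  integrable_prodM integrable_cauchy_fun integrable_cauchy_fun cauchy_fun_ge0 cauchy_fun_ge0.
have pg p : 0 <= g p by rewrite mulr_ge0 ?cauchy_fun_ge0.
have hg' (p : R * R) (w : R) : normc (h (p, w)) <= g p * cauchy_fun w.
  by case: p => x y; exact: hg.
exact: (cFubini ig integrable_cauchy_fun pg cauchy_fun_ge0 mh hg').
Qed.

End Haar.

Section IwasawaKernel.
Context {R : realType}.
Local Notation C := R[i].
Local Notation mu := (@lebesgue_measure R).
Implicit Types (lambda kappa : C) (delta : int) (r w t x y : R).

Definition sqnorm (p : R * R) : R := p.1 ^+ 2 + p.2 ^+ 2.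

(* With r = |z|^2 and u = r - 2 i w, these are log |1 + u| and - arg (1 + u). *)
Definition iwasawa_log r w : R := ln ((1 + r) ^+ 2 + 4 * w ^+ 2) / 2.

Definition iwasawa_arg r w : R := atan (2 * w / (1 + r)).

Definition iwasawa_kernel lambda delta r w : C :=
  cexp (- (lambda + 2) * (iwasawa_log r w)%:C + 'i%C * delta%:~R * (iwasawa_arg r w)%:C).

Lemma sqnorm_ge0 (p : R * R) : 0 <= sqnorm p.
Proof. by rewrite addr_ge0 ?sqr_ge0. Qed.

Lemma one_add_gt0 r : 0 <= r -> 0 < 1 + r.
Proof. by move=> r0; rewrite ltr_wpDr. Qed.

(** With w = (1 + r) t / 2 one has 1 + u = (1 + r) (1 - i t), so the variables r and t separate. *)
Lemma iwasawa_log_scaled r t : 0 <= r ->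
  iwasawa_log r ((1 + r) / 2 * t) = ln (1 + r) + log1sqr t / 2.
Proof.
move=> /one_add_gt0 r0; rewrite /iwasawa_log.
have -> : (1 + r) ^+ 2 + 4 * ((1 + r) / 2 * t) ^+ 2 = (1 + r) ^+ 2 * (1 + t ^+ 2) by field.
by rewrite lnM ?posrE ?exprn_gt0 ?one_add_sqr_gt0// lnXn// -/(log1sqr t) -mulr_natl; field.
Qed.

Lemma iwasawa_arg_scaled r t : 0 <= r -> iwasawa_arg r ((1 + r) / 2 * t) = atan t.
Proof.
move=> /one_add_gt0 r0; rewrite /iwasawa_arg; congr atan.
by field; rewrite gt_eqF.
Qed.

Lemma iwasawa_scaling r w : 0 <= r -> w = (1 + r) / 2 * (2 * w / (1 + r)).
Proof. by move=> /one_add_gt0 r0; field; rewrite gt_eqF. Qed.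

Lemma cexp_iwasawa r w : 0 <= r ->
  cexp (- (iwasawa_log r w)%:C + 'i%C * (iwasawa_arg r w)%:C) * ((1 + r) -i* (2 * w)) = 1.
Proof.
move=> r0; have r1 := one_add_gt0 r0.
set t := 2 * w / (1 + r); have wE : 2 * w = (1 + r) * t by rewrite /t; field; rewrite gt_eqF.
have e1 : expR (- iwasawa_log r w) * expR (- (log1sqr t / 2)) = ((1 + r) * (1 + t ^+ 2))^-1.
  rewrite (iwasawa_scaling w r0) -/t iwasawa_log_scaled// -expRD.
  rewrite (_ : _ + _ = - (ln (1 + r) + log1sqr t)); last by field.
  by rewrite expRN expRD expR_log1sqr lnK ?posrE.
rewrite cexpD -realcN cexpR /iwasawa_arg -/t cexp_atan mulrA -realcM e1 wE.
have h0 := one_add_sqr_gt0 t.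
by apply: complex_eqP; rewrite !(cReM, cImM) /=; field; rewrite ?gt_eqF// mulf_neq0 ?gt_eqF.
Qed.

Lemma cexp_iwasawa_conj r w : 0 <= r ->
  cexp (- (iwasawa_log r w)%:C - 'i%C * (iwasawa_arg r w)%:C) * ((1 + r) +i* (2 * w)) = 1.
Proof.
move=> r0; have := cexp_iwasawa w r0; move/(congr1 (@Num.conj _)).
rewrite rmorphM rmorph1 /= conj_cexp => h; rewrite -[RHS]h; congr (cexp _ * _).
  by rewrite !mul_iR; apply: complex_eqP; rewrite /= ?oppr0 ?addr0 ?add0r ?opprK.
by apply: complex_eqP; rewrite /= ?opprK.
Qed.

Lemma iwasawa_log_ge_ln r w : 0 <= r -> ln (1 + r) <= iwasawa_log r w.
Proof.
move=> r0; have r1 := one_add_gt0 r0.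
rewrite (iwasawa_scaling w r0) iwasawa_log_scaled// lerDl divr_ge0//.
exact: log1sqr_ge0.
Qed.

Lemma iwasawa_log_ge_log1sqr r w : 0 <= r -> log1sqr w <= 2 * iwasawa_log r w.
Proof.
move=> r0; have r1 := one_add_gt0 r0.
rewrite /iwasawa_log mulrC divfK ?pnatr_eq0// ler_ln ?posrE ?one_add_sqr_gt0//; last first.
  by rewrite ltr_wpDr ?exprn_gt0// mulr_ge0// sqr_ge0.
by have := sqr_ge0 w; nra.
Qed.

(** In logarithms, (1 + x^2) (1 + y^2) <= (1 + x^2 + y^2)^2; radial kernels thereby get product
    majorants. *)
Lemma log1sqr_sqnorm x y : log1sqr x + log1sqr y <= 2 * ln (1 + sqnorm (x, y)).
Proof.
have r1 := one_add_gt0 (sqnorm_ge0 (x, y)).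
have -> : 2 * ln (1 + sqnorm (x, y)) = ln ((1 + sqnorm (x, y)) ^+ 2).
  by rewrite lnXn// mulr_natl.
rewrite /log1sqr -lnM ?posrE ?one_add_sqr_gt0// ler_ln ?posrE ?mulr_gt0 ?exprn_gt0 ?one_add_sqr_gt0//.
rewrite /sqnorm /=; have := sqr_ge0 x; have := sqr_ge0 y.
by move: (x ^+ 2) (y ^+ 2) => a b ? ?; nra.
Qed.

Lemma normc_iwasawa_kernel lambda delta r w :
  normc (iwasawa_kernel lambda delta r w) = expR (- (Re lambda + 2) * iwasawa_log r w).
Proof.
rewrite normc_cexp cReD !Re_mulrR cReN cReD Re_iM -(rmorph_int (real_complex R)) /=.
by rewrite oppr0 mul0r addr0.
Qed.

Lemma cauchy_funE t : cauchy_fun t = expR (- log1sqr t).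
Proof. by rewrite expRN expR_log1sqr. Qed.

(** Of the four or more powers of 1/|1 + u|, two are spent on |1 + u| >= 1 + r and two on |1 + u|^2
    >= 1 + w^2. *)
Lemma iwasawa_kernel_bound lambda delta x y w : 2 <= Re lambda ->
  normc (iwasawa_kernel lambda delta (sqnorm (x, y)) w) <=
  (1 + sqnorm (x, y)) ^- 2 * cauchy_fun w.
Proof.
move=> l2; have r0 := sqnorm_ge0 (x, y); have r1 := one_add_gt0 r0.
rewrite normc_iwasawa_kernel -exprVn -[X in _ <= X^-1 ^+ 2 * _]lnK ?posrE//.
rewrite -expRN expr2 -!expRD cauchy_funE -expRD ler_expR.
have := iwasawa_log_ge_ln w r0; have := iwasawa_log_ge_log1sqr w r0.
have : 0 <= ln (1 + sqnorm (x, y)) by rewrite ln_ge0// lerDl.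
by move: (iwasawa_log _ _) (ln _) (log1sqr w) => s a b *; nra.
Qed.

Lemma sqnorm_bound x y : (1 + sqnorm (x, y)) ^- 2 <= cauchy_fun x * cauchy_fun y.
Proof.
have r1 := one_add_gt0 (sqnorm_ge0 (x, y)).
rewrite -exprVn -[X in X^-1 ^+ 2]lnK ?posrE// -expRN expr2 -!expRD !cauchy_funE -expRD ler_expR.
by have := log1sqr_sqnorm x y; lra.
Qed.

Lemma measurable_sqnorm : measurable_fun setT (sqnorm : R * R -> R).
Proof.
apply: measurable_funD; apply: measurable_funX; [exact: measurable_fst|exact: measurable_snd].
Qed.

Lemma cmeasurable_iwasawa_kernel lambda delta :
  cmeasurable (fun p : R * R * R => iwasawa_kernel lambda delta (sqnorm p.1) p.2).
Proof.
have m1 : measurable_fun setT (fun p : R * R * R => 1 + sqnorm p.1).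
  apply: measurable_funD => //; apply: measurableT_comp => //; exact: measurable_sqnorm.
have m2 : measurable_fun setT (fun p : R * R * R => p.2) by exact: measurable_snd.
apply: cmeasurable_cexp; apply: cmeasurableD; apply: cmeasurableM;
  try exact: cmeasurable_cst; apply: cmeasurableR.
  apply: measurable_funM => //; apply: measurableT_comp => //.
  apply: measurable_funD; first exact: measurable_funX.
  by apply: measurable_funM => //; exact: measurable_funX.
rewrite /iwasawa_arg.
(* The reciprocal is rewritten as exp(-log), so that measurability follows from that of exp and
   log. *)
have -> : (fun p : R * R * R => atan (2 * p.2 / (1 + sqnorm p.1))) =
          (fun p => atan (2 * p.2 * expR (- ln (1 + sqnorm p.1)))).
  by apply/funext => p; rewrite expRN lnK// posrE one_add_gt0// sqnorm_ge0.
apply: (@measurableT_comp _ _ _ _ _ _ atan).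
  by apply: continuous_measurable_fun => t; exact: continuous_atan.
apply: measurable_funM; first exact: measurable_funM.
by apply: measurableT_comp => //; apply: measurableT_comp => //; apply: measurableT_comp.
Qed.

End IwasawaKernel.

Section HaarIntegral.
Context {R : realType}.
Local Notation C := R[i].
Local Notation mu := (@lebesgue_measure R).
Implicit Types (lambda kappa : C) (delta : int) (r w t x y : R).

Definition radial_kernel kappa (p : R * R) : C := cexp (- kappa * (ln (1 + sqnorm p))%:C).

Lemma normc_radial_kernel kappa p :
  normc (radial_kernel kappa p) = expR (- Re kappa * ln (1 + sqnorm p)).
Proof. by rewrite normc_cexp Re_mulrR cReN. Qed.

Lemma radial_kernel_bound kappa x y : 2 <= Re kappa ->
  normc (radial_kernel kappa (x, y)) <= cauchy_fun x * cauchy_fun y.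
Proof.
move=> k2; rewrite normc_radial_kernel !cauchy_funE -expRD ler_expR.
have := log1sqr_sqnorm x y.
have : 0 <= ln (1 + sqnorm (x, y)) by rewrite ln_ge0// lerDl sqnorm_ge0.
by move: (ln _) => l *; nra.
Qed.

Lemma cmeasurable_radial_kernel kappa : cmeasurable (radial_kernel kappa).
Proof.
apply: cmeasurable_cexp; apply: cmeasurableM; first exact: cmeasurable_cst.
apply: cmeasurableR; apply: measurableT_comp => //.
by apply: measurable_funD => //; exact: measurable_sqnorm.
Qed.

(** The substitution y = sqrt(1 + x^2) t separates the variables: 1 + x^2 + y^2 = (1 + x^2) (1 +
    t^2). *)
Lemma radial_kernel_scaled kappa x t :
  radial_kernel kappa (x, expR (log1sqr x / 2) * t) =
  cexp (- kappa * (log1sqr x)%:C) * cauchy_kernel (2 * kappa - 2) 0 t.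
Proof.
rewrite /radial_kernel /cauchy_kernel -cexpD; congr cexp.
have -> : ln (1 + sqnorm (x, expR (log1sqr x / 2) * t)) = log1sqr x + log1sqr t.
  have e : expR (log1sqr x / 2) ^+ 2 = 1 + x ^+ 2.
    by rewrite -expR_log1sqr expr2 -expRD; congr expR; field.
  rewrite /log1sqr -lnM ?posrE ?one_add_sqr_gt0//; congr ln.
  by rewrite /sqnorm /= exprMn e; ring.
by rewrite realcD; field.
Qed.

Lemma ccontinuous_radial_kernel kappa x : ccontinuous (fun y => radial_kernel kappa (x, y)).
Proof.
have cs : continuous (fun y : R => 1 + (x ^+ 2 + y ^+ 2)).
  by move=> z; do 2 (apply: cvgD; first exact: cvg_cst); exact: exprn_continuous.
move=> y; apply: ccontinuous_at_cexp; apply: ccontinuous_atM; first exact: ccontinuous_at_cst.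
apply: ccontinuous_atR; apply: (continuous_comp (cs y)).
by apply: continuous_ln; exact/one_add_gt0/(sqnorm_ge0 (x, y)).
Qed.

Lemma radial_integral kappa : 5 <= Re kappa ->
  cintegrable (mu \x mu)%E setT (radial_kernel kappa) /\
  cintegral (mu \x mu)%E setT (radial_kernel kappa) = (pi : R)%:C / (kappa - 1).
Proof.
move=> k5; have k2 : 2 <= Re kappa by lra.
have [ic e _] := cFubini integrable_cauchy_fun integrable_cauchy_fun
  cauchy_fun_ge0 cauchy_fun_ge0 (cmeasurable_radial_kernel kappa)
  (fun x y => radial_kernel_bound x y k2).
split => //; rewrite e.
have Rk : 0 <= Re (2 * kappa - 2) by rewrite mulrDl mul1r !(cReD, cReN) /=; lra.
have Rk3 : 0 <= Re (2 * kappa - 3) by rewrite mulrDl mul1r !(cReD, cReN) /=; lra.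
(* The Jacobian sqrt(1 + x^2) lowers the exponent of 1 + x^2 from kappa to kappa - 1/2, hence the
   parameter from 2 kappa - 2 to 2 kappa - 3. *)
have inner x : cintegral mu setT (fun y => radial_kernel kappa (x, y)) =
    cauchy_integral (2 * kappa - 2) 0 * cauchy_kernel (2 * kappa - 3) 0 x.
  have a0 : 0 < expR (log1sqr x / 2) by exact: expR_gt0.
  have [_ h] := cintegral_affine 0 a0 (ccontinuous_radial_kernel kappa x).
  rewrite h.
    rewrite [RHS]mulrC /cauchy_integral -(cintegralZ _ (cintegrable_cauchy_kernel 0 Rk)).
    congr cintegral; apply/funext => t; rewrite addr0 radial_kernel_scaled mulrA; congr (_ * _).
    rewrite -cexpR -cexpD /cauchy_kernel; congr cexp; rewrite !realcE.
    by field.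
  apply: (@cintegrable_cauchy _ _ (cauchy_fun x)); first exact: ccontinuous_radial_kernel.
  by move=> y; exact: radial_kernel_bound.
under eq_fun do rewrite inner.
rewrite cintegralZ; last exact: cintegrable_cauchy_kernel.
have n1 : kappa - 1 != 0.
  apply/eqP => /(congr1 (@complex.Re R)); rewrite cReD cReN /= => h; lra.
by apply: (mulfI n1); rewrite cauchy_integral_mul// mulrC divfK.
Qed.

(* A point p = ((x, y), w) stands for nbar (x + i y) w. *)
Definition haar_kernel lambda delta (p : R * R * R) : C :=
  iwasawa_kernel lambda delta (sqnorm p.1) p.2.

Lemma haar_kernel_bound lambda delta x y w : 2 <= Re lambda ->
  normc (haar_kernel lambda delta (x, y, w)) <= cauchy_fun x * cauchy_fun y * cauchy_fun w.
Proof.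
move=> l2; apply: (le_trans (iwasawa_kernel_bound _ _ _ _ l2)).
by apply: ler_wpM2r; [exact: cauchy_fun_ge0|exact: sqnorm_bound].
Qed.

Lemma iwasawa_kernel_scaled lambda delta r t : 0 <= r ->
  iwasawa_kernel lambda delta r ((1 + r) / 2 * t) =
  cexp (- (lambda + 2) * (ln (1 + r))%:C) * cauchy_kernel lambda delta t.
Proof.
move=> r0; rewrite /iwasawa_kernel iwasawa_log_scaled// iwasawa_arg_scaled//.
rewrite /cauchy_kernel -cexpD; congr cexp; rewrite !realcE.
by field.
Qed.

Lemma ccontinuous_iwasawa_kernel lambda delta r : 0 <= r -> ccontinuous (iwasawa_kernel lambda delta r).
Proof.
move=> r0 w; have r1 := one_add_gt0 r0.
apply: ccontinuous_at_cexp; apply: ccontinuous_atD; apply: ccontinuous_atM;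
  try exact: ccontinuous_at_cst; apply: ccontinuous_atR.
  apply: cvgM; last exact: cvg_cst.
  apply: (@continuous_comp _ _ _ (fun w => (1 + r) ^+ 2 + 4 * w ^+ 2) (@ln R)).
    apply: cvgD; first exact: cvg_cst.
    by apply: cvgM; [exact: cvg_cst|exact: exprn_continuous].
  by apply: continuous_ln; rewrite ltr_wpDr ?exprn_gt0// mulr_ge0// sqr_ge0.
apply: (@continuous_comp _ _ _ (fun w => 2 * w / (1 + r)) (@atan R)); last exact: continuous_atan.
by apply: cvgM; [apply: cvgM; [exact: cvg_cst|exact: cvg_id]|exact: cvg_cst].
Qed.

(** The integral in w is Cauchy's integral times (1 + r)^(-lambda - 1) / 2, the Jacobian (1 + r) / 2
    being included; the remaining power of 1 + r integrates to pi / lambda over the plane. *)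
Lemma haar_integral lambda delta : 4 <= Re lambda ->
  cintegral ((mu \x mu) \x mu)%E setT (haar_kernel lambda delta) =
  (pi : R)%:C / (2 * lambda) * cauchy_integral lambda delta.
Proof.
move=> l4; have l2 : 2 <= Re lambda by lra.
have l0 : 0 <= Re lambda by lra.
have [_ -> _] := cFubini3_cauchy (cmeasurable_iwasawa_kernel lambda delta)
  (fun x y w => haar_kernel_bound delta x y w l2).
have inner p : cintegral mu setT (fun w => haar_kernel lambda delta (p, w)) =
    cauchy_integral lambda delta / 2 * radial_kernel (lambda + 1) p.
  rewrite /haar_kernel /=; have r0 := sqnorm_ge0 p; have r1 := one_add_gt0 r0.
  have a0 : 0 < (1 + sqnorm p) / 2 by rewrite divr_gt0.
  have [_ h] := cintegral_affine 0 a0 (ccontinuous_iwasawa_kernel lambda delta r0).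
  rewrite -[LHS]/(cintegral mu setT (iwasawa_kernel lambda delta (sqnorm p))) h.
    rewrite [RHS](_ : _ = radial_kernel (lambda + 1) p / 2 * cauchy_integral lambda delta); last by ring.
    rewrite /cauchy_integral -(cintegralZ _ (cintegrable_cauchy_kernel delta l0)).
    congr cintegral; apply/funext => t; rewrite addr0 iwasawa_kernel_scaled// mulrA; congr (_ * _).
    rewrite /radial_kernel realcM realcV realc_nat -[X in X%:C / 2]lnK ?posrE// -cexpR.
    rewrite mulrAC -cexpD; congr (cexp _ / 2); ring.
  apply: (@cintegrable_cauchy _ _ ((1 + sqnorm p) ^- 2)); first exact: ccontinuous_iwasawa_kernel.
  by case: p {r0 r1 a0 h} => x y w; exact: iwasawa_kernel_bound.
under eq_fun do rewrite inner.
have k5 : 5 <= Re (lambda + 1) by rewrite cReD /=; lra.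
have [ri re] := radial_integral k5.
rewrite (cintegralZ _ ri) re addrK.
have n0 : lambda != 0 by apply/eqP => /(congr1 (@complex.Re R)) /= h; lra.
by field.
Qed.

End HaarIntegral.

(** * Rotation invariance of plane integrals *)

Section Rotation.
Context {R : realType}.
Local Notation C := R[i].
Local Notation mu := (@lebesgue_measure R).
Implicit Types (H : R * R -> C) (x y t : R).

(** A class stable under shears: continuity is required along all affine lines, so sections stay
    continuous after a shear, and the decay survives up to a constant. *)
Definition planar H : Prop :=
  [/\ cmeasurable H,
      forall a b c d : R, ccontinuous (fun t => H (a * t + b, c * t + d)) &
      exists2 M : R, 0 <= M & forall p, normc (H p) <= M * (1 + sqnorm p) ^- 2].

Lemma planar_bound H (M : R) : 0 <= M ->
  (forall p, normc (H p) <= M * (1 + sqnorm p) ^- 2) ->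
  forall x y, normc (H (x, y)) <= (M * cauchy_fun x) * (1 * cauchy_fun y).
Proof.
move=> M0 hM x y; apply: (le_trans (hM _)); rewrite mul1r -mulrA ler_wpM2l//.
exact: sqnorm_bound.
Qed.

Lemma planar_Fubini H : planar H ->
  [/\ cintegrable (mu \x mu)%E setT H,
   cintegral (mu \x mu)%E setT H =
     cintegral mu setT (fun x => cintegral mu setT (fun y => H (x, y))) &
   cintegral (mu \x mu)%E setT H =
     cintegral mu setT (fun y => cintegral mu setT (fun x => H (x, y)))].
Proof.
move=> [mH _ [M M0 hM]].
have pos (k : R) : 0 <= k -> forall y, 0 <= k * cauchy_fun y.
  by move=> k0 y; rewrite mulr_ge0// cauchy_fun_ge0.
exact: (cFubini (integrable_const_cauchy M) (integrable_const_cauchy 1)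
  (pos _ M0) (pos 1 ler01) mH (planar_bound M0 hM)).
Qed.

Lemma inv_sqr_le (K a b : R) : 0 < a -> 0 < b -> 0 < K -> a <= K * b ->
  b ^- 2 <= K ^+ 2 * a ^- 2.
Proof.
move=> a0 b0 K0 h; rewrite ler_pdivlMr ?exprn_gt0// mulrC ler_pdivrMr ?exprn_gt0//.
by rewrite -exprMn ler_sqr// nnegrE ?mulr_ge0// ltW// ?mulr_gt0.
Qed.

Lemma sqnorm_shear (tau x y : R) :
  1 + (x ^+ 2 + y ^+ 2) <= (3 + 2 * tau ^+ 2) * (1 + ((x + tau * y) ^+ 2 + y ^+ 2)).
Proof.
have h : x ^+ 2 <= 2 * (x + tau * y) ^+ 2 + 2 * tau ^+ 2 * y ^+ 2.
  have -> : 2 * (x + tau * y) ^+ 2 + 2 * tau ^+ 2 * y ^+ 2 = x ^+ 2 + (x + 2 * tau * y) ^+ 2 by ring.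
  by rewrite lerDl sqr_ge0.
have := sqr_ge0 (x + tau * y); have := sqr_ge0 y; have := sqr_ge0 tau.
by move: h; move: (x ^+ 2) (y ^+ 2) (tau ^+ 2) ((x + tau * y) ^+ 2) => X Y T Z; nra.
Qed.

Lemma sqnorm_shear_inv (tau x y : R) :
  (1 + ((x + tau * y) ^+ 2 + y ^+ 2)) ^- 2 <=
  (3 + 2 * tau ^+ 2) ^+ 2 * (1 + (x ^+ 2 + y ^+ 2)) ^- 2.
Proof.
apply: inv_sqr_le; last exact: sqnorm_shear.
- exact: (one_add_gt0 (sqnorm_ge0 (x, y))).
- exact: (one_add_gt0 (sqnorm_ge0 (x + tau * y, y))).
- by rewrite ltr_wpDr// mulr_ge0// sqr_ge0.
Qed.

Definition shear1 (tau : R) H (p : R * R) : C := H (p.1 + tau * p.2, p.2).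
Definition shear2 (tau : R) H (p : R * R) : C := H (p.1, p.2 + tau * p.1).

Lemma planar_shear1 tau H : planar H -> planar (shear1 tau H).
Proof.
move=> [mH cH [M M0 hM]]; split.
- apply: (cmeasurable_comp mH); apply: measurable_fun_pair => //.
  by apply: measurable_funD => //; exact: measurable_funM.
- move=> a b c d; have := cH (a + tau * c) (b + tau * d) c d.
  rewrite /shear1 /=; congr ccontinuous; apply/funext => t; congr (H (_, _)); ring.
- exists (M * (3 + 2 * tau ^+ 2) ^+ 2); first by rewrite mulr_ge0// sqr_ge0.
  move=> [x y]; apply: (le_trans (hM _)); rewrite -mulrA ler_wpM2l//.
  exact: sqnorm_shear_inv.
Qed.

Lemma planar_shear2 tau H : planar H -> planar (shear2 tau H).
Proof.
move=> [mH cH [M M0 hM]]; split.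
- apply: (cmeasurable_comp mH); apply: measurable_fun_pair => //.
  by apply: measurable_funD => //; exact: measurable_funM.
- move=> a b c d; have := cH a b (c + tau * a) (d + tau * b).
  rewrite /shear2 /=; congr ccontinuous; apply/funext => t; congr (H (_, _)); ring.
- exists (M * (3 + 2 * tau ^+ 2) ^+ 2); first by rewrite mulr_ge0// sqr_ge0.
  move=> [x y]; apply: (le_trans (hM _)); rewrite -mulrA ler_wpM2l//.
  rewrite /sqnorm /= [x ^+ 2 + (_) ^+ 2]addrC [x ^+ 2 + y ^+ 2]addrC.
  exact: sqnorm_shear_inv.
Qed.

Lemma cintegral_translation (h : R -> C) (b : R) : ccontinuous h -> cintegrable mu setT h ->
  cintegral mu setT (fun t => h (t + b)) = cintegral mu setT h.
Proof.
move=> ch ih; have [_ e] := cintegral_affine b (@ltr01 R) ch.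
by rewrite e//; congr cintegral; apply/funext => t; rewrite !mul1r.
Qed.

Lemma planar_section1 H y : planar H ->
  ccontinuous (fun x => H (x, y)) /\ cintegrable mu setT (fun x => H (x, y)).
Proof.
move=> [_ cH [M M0 hM]].
have c : ccontinuous (fun x => H (x, y)).
  by have := cH 1 0 0 y; congr ccontinuous; apply/funext => t; congr (H (_, _)); ring.
split => //; apply: (@cintegrable_cauchy _ _ (M * (1 * cauchy_fun y))) => // x.
by rewrite mulrAC; exact: planar_bound.
Qed.

Lemma planar_section2 H x : planar H ->
  ccontinuous (fun y => H (x, y)) /\ cintegrable mu setT (fun y => H (x, y)).
Proof.
move=> [_ cH [M M0 hM]].
have c : ccontinuous (fun y => H (x, y)).
  by have := cH 0 x 1 0; congr ccontinuous; apply/funext => t; congr (H (_, _)); ring.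
split => //; apply: (@cintegrable_cauchy _ _ (M * cauchy_fun x)) => // y.
by rewrite -[cauchy_fun y]mul1r; exact: planar_bound.
Qed.

Lemma cintegral_shear1 tau H : planar H ->
  cintegral (mu \x mu)%E setT (shear1 tau H) = cintegral (mu \x mu)%E setT H.
Proof.
move=> pH; have [_ _ ->] := planar_Fubini (planar_shear1 tau pH).
have [_ _ ->] := planar_Fubini pH; congr cintegral; apply/funext => y.
have [c i] := planar_section1 y pH.
by rewrite -(cintegral_translation (tau * y) c i).
Qed.

Lemma cintegral_shear2 tau H : planar H ->
  cintegral (mu \x mu)%E setT (shear2 tau H) = cintegral (mu \x mu)%E setT H.
Proof.
move=> pH; have [_ -> _] := planar_Fubini (planar_shear2 tau pH).
have [_ -> _] := planar_Fubini pH; congr cintegral; apply/funext => x.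
have [c i] := planar_section2 x pH.
by rewrite -(cintegral_translation (tau * x) c i).
Qed.

(* A rotation is a product of three shears. *)
Lemma cintegral_rotation (c s : R) H : planar H -> c ^+ 2 + s ^+ 2 = 1 -> s != 0 ->
  cintegral (mu \x mu)%E setT (fun p => H (c * p.1 - s * p.2, s * p.1 + c * p.2)) =
  cintegral (mu \x mu)%E setT H.
Proof.
(* For c = cos th and s = sin th this [tau] is - tan(th / 2). *)
move=> pH cs s0; pose tau := (c - 1) / s.
rewrite -(cintegral_shear1 tau pH) -(cintegral_shear2 s (planar_shear1 tau pH)).
rewrite -(cintegral_shear1 tau (planar_shear2 s (planar_shear1 tau pH))).
congr cintegral; apply/funext => -[x y]; rewrite /shear1 /shear2 /=.
have e : s * tau = c - 1 by rewrite mulrC divfK.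
have e2 : tau * (c + 1) = - s.
  apply: (mulIf s0); rewrite mulrAC [tau * s]mulrC e.
  have : s ^+ 2 = 1 - c ^+ 2 by rewrite -cs; ring.
  by move=> h; rewrite mulNr -expr2 h; ring.
congr (H (_, _)).
  have -> : x + tau * y + tau * (y + s * (x + tau * y)) =
    x * (1 + s * tau) + y * (tau * (s * tau + 1 + 1)) by ring.
  by rewrite e subrK e2; ring.
have -> : y + s * (x + tau * y) = s * x + y * (1 + s * tau) by ring.
by rewrite e; ring.
Qed.

Lemma cos_lt1 (x : R) : 0 < x <= 1 -> cos x != 1.
Proof.
move=> /andP[x0 x1]; apply/eqP => h.
have h2 := cos2Dsin2 x; rewrite h expr1n in h2.
have s0 : sin x = 0.
  by apply/eqP; rewrite -sqrf_eq0 -[X in _ == X](subrr 1) -[X in _ == X - _]h2 [1 + _]addrC addrK.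
have : 0 < sin x.
  apply: sin_gt0_pi; rewrite x0 /= (le_lt_trans x1)//.
  by apply: lt_le_trans (pi_ge2 _); rewrite ltr1n.
by rewrite s0 ltxx.
Qed.

(** Rotation by the angle 1/|m| multiplies the integral by e^i or e^(-i), whose real part cos 1
    differs from 1. For this angle [sin th] is nonzero, as the decomposition into shears
    requires. *)
Lemma cintegral_angular0 (m : int) H : planar H -> m != 0 ->
  (forall (th : R) p, H (cos th * p.1 - sin th * p.2, sin th * p.1 + cos th * p.2) =
    cexp ('i%C * m%:~R * th%:C) * H p) ->
  cintegral (mu \x mu)%E setT H = 0.
Proof.
move=> pH m0 hH; pose th : R := `|m|%:~R^-1.
have m1 : 1 <= `|m|%:~R :> R by rewrite (ler_int R 1) -gtz0_ge1 normr_gt0.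
have th0 : 0 < th by rewrite invr_gt0 (lt_le_trans _ m1).
have th1 : th <= 1 by rewrite invf_le1// (lt_le_trans _ m1).
have s0 : sin th != 0.
  rewrite gt_eqF//; apply: sin_gt0_pi; rewrite th0 /= (le_lt_trans th1)//.
  by apply: lt_le_trans (pi_ge2 _); rewrite ltr1n.
have := cintegral_rotation pH (cos2Dsin2 th) s0.
under eq_fun do rewrite hH.
have [iH _ _] := planar_Fubini pH.
rewrite cintegralZ// => /eqP; rewrite -subr_eq0 -[X in _ - X]mul1r -mulrBl mulf_eq0 => /orP[|/eqP//].
rewrite subr_eq0 => /eqP/(congr1 (@complex.Re R)).
have -> : 'i%C * m%:~R * th%:C = 0 +i* (m%:~R * th).
  by rewrite -(rmorph_int (real_complex R)) /= -mulrA -realcM mul_iR.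
rewrite cexp_im /= => /eqP; rewrite (negbTE (_ : cos _ != 1))//.
case: (ltrP 0 m) => hm.
  rewrite /th gtr0_norm// divff ?intr_eq0//; apply: cos_lt1; by rewrite ltr01 lexx.
rewrite /th ler0_norm// rmorphN /= invrN mulrN divff ?intr_eq0// cosN.
by apply: cos_lt1; rewrite ltr01 lexx.
Qed.

End Rotation.

(** * Recurrences of the Zernike polynomials *)

Section DiscPolynomials.
Context {F : numFieldType}.
Implicit Types (Z Y : F) (a b k : nat).

(* The Zernike polynomials of the unit disc, with Y in place of the conjugate
   of the variable Z. *)
Definition disc_poly a b Z Y : F :=
  \sum_(k < a.+1) ('C(a, k) * 'C(b, k))%:R *
    ((Z * Y - 1) ^+ k * Z ^+ (a - k) * Y ^+ (b - k)).

Lemma disc_polyE N a b Z Y : (a < N)%N ->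
  disc_poly a b Z Y = \sum_(k < N) ('C(a, k) * 'C(b, k))%:R *
    ((Z * Y - 1) ^+ k * Z ^+ (a - k) * Y ^+ (b - k)).
Proof.
move=> aN; rewrite /disc_poly (big_ord_widen_cond N xpredT (fun k : nat =>
  ('C(a, k) * 'C(b, k))%:R * ((Z * Y - 1) ^+ k * Z ^+ (a - k) * Y ^+ (b - k))) aN).
rewrite [RHS](bigID (fun k : 'I_N => (k < a.+1)%N)) /= [X in _ = _ + X]big1 ?addr0//.
by move=> k; rewrite -leqNgt => ak; rewrite (bin_small ak) mul0n mul0r.
Qed.

Lemma disc_poly0 b Z Y : disc_poly 0 b Z Y = Y ^+ b.
Proof. by rewrite /disc_poly big_ord1 /= !bin0 muln1 !subn0 !expr0 !mul1r. Qed.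

Lemma disc_polyS0 a Z Y : disc_poly a.+1 0 Z Y = Z * disc_poly a 0 Z Y.
Proof.
have h n (f : nat -> F) : \sum_(k < n.+1) ('C(n, k) * 'C(0, k))%:R * f k = f 0.
  rewrite big_ord_recl !bin0 muln1 mul1r big1 ?addr0// => i _.
  by rewrite bin0n muln0 mul0r.
rewrite /disc_poly (h a.+1 (fun k => (Z * Y - 1) ^+ k * Z ^+ (a.+1 - k) * Y ^+ (0 - k))).
rewrite (h a (fun k => (Z * Y - 1) ^+ k * Z ^+ (a - k) * Y ^+ (0 - k))).
by rewrite !subn0 exprS !expr0; ring.
Qed.

Lemma disc_poly_coef a b k :
  (a.+1%:R * ('C(a.+1, k.+1) * 'C(b.+1, k.+1))%:R : F) =
  (a + b).+2%:R * ('C(a, k.+1) * 'C(b.+1, k.+1))%:R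
  - b.+1%:R * ('C(a, k.+1) * 'C(b, k.+1))%:R + b.+1%:R * ('C(a, k) * 'C(b, k))%:R.
Proof.
have e1 : (b.+1%:R * 'C(b, k)%:R : F) = k.+1%:R * 'C(b.+1, k.+1)%:R.
  by rewrite -!natrM mul_bin_diag.
have e2 : ('C(b.+1, k.+1)%:R : F) = 'C(b, k.+1)%:R + 'C(b, k)%:R.
  by rewrite binS natrD.
have e3 : ('C(a.+1, k.+1)%:R : F) = 'C(a, k.+1)%:R + 'C(a, k)%:R.
  by rewrite binS natrD.
have e4 : (a.+1%:R * 'C(a, k)%:R : F) = k.+1%:R * 'C(a.+1, k.+1)%:R.
  by rewrite -!natrM mul_bin_diag.
have -> : (a + b).+2%:R = a.+1%:R + b.+1%:R :> F by rewrite -natrD; congr (_%:R); lia.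
rewrite !natrM e3 in e4 *.
set A0 := 'C(a, k)%:R in e3 e4 *; set A1 := 'C(a, k.+1)%:R in e3 e4 *.
set B := 'C(b.+1, k.+1)%:R in e1 e2 *.
have eb : 'C(b, k.+1)%:R = B - 'C(b, k)%:R :> F by rewrite e2 addrK.
rewrite eb; move: e1 e4; move: ('C(b, k)%:R) (a.+1%:R) (b.+1%:R) (k.+1%:R) => B0 n m l e1 e4.
have -> : m * (A0 * B0) = A0 * (m * B0) by ring.
have -> : m * (A1 * (B - B0)) = A1 * (m * B - m * B0) by ring.
rewrite e1; have -> : n * ((A1 + A0) * B) = n * A1 * B + (n * A0) * B by ring.
by rewrite e4; ring.
Qed.

(** Everything is expanded in the products q^k Z^(a+1-k) Y^(b+1-k) with q = Z Y - 1, after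
    multiplying the polynomial of index (a, b) by 1 = Z Y - q. Comparing coefficients leaves the
    binomial identity [disc_poly_coef]. *)
Lemma disc_polySS a b Z Y :
  a.+1%:R * disc_poly a.+1 b.+1 Z Y =
  (a + b).+2%:R * (Z * disc_poly a b.+1 Z Y) - b.+1%:R * disc_poly a b Z Y.
Proof.
set q := Z * Y - 1; have q1 : Z * Y - q = 1 by rewrite /q opprB addrC subrK.
have aN : (a < a.+2)%N by [].
pose t k := q ^+ k * Z ^+ (a.+1 - k) * Y ^+ (b.+1 - k).
have E1 : disc_poly a.+1 b.+1 Z Y = \sum_(k < a.+2) ('C(a.+1, k) * 'C(b.+1, k))%:R * t k by [].
have E2 : Z * disc_poly a b.+1 Z Y = \sum_(k < a.+2) ('C(a, k) * 'C(b.+1, k))%:R * t k.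
  rewrite (disc_polyE b.+1 Z Y aN) mulr_sumr; apply: eq_bigr => k _.
  have [ka|ak] := leqP k a; last by rewrite (bin_small ak) mul0n !mul0r mulr0.
  by rewrite /t (subSn ka) exprS -/q; ring.
have E3 : disc_poly a b Z Y = \sum_(k < a.+2) ('C(a, k) * 'C(b, k))%:R * t k
    - \sum_(k < a.+1) ('C(a, k) * 'C(b, k))%:R * t k.+1.
  rewrite -[LHS]mulr1 -[X in _ * X = _]q1 mulrBr; congr (_ - _).
    rewrite (disc_polyE b Z Y aN) mulr_suml; apply: eq_bigr => k _.
    have [ka|ak] := leqP k a; last by rewrite (bin_small ak) mul0n !mul0r.
    have [kb|bk] := leqP k b; last by rewrite (bin_small bk) muln0 !mul0r.
    by rewrite /t (subSn ka) (subSn kb) !exprS -/q; ring.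
  rewrite /disc_poly mulr_suml; apply: eq_bigr => k _.
  by rewrite /t !subSS exprS -/q; ring.
pose S c := \sum_(k < a.+1) (c k.+1 : F) * t k.+1.
have recl (c : nat -> F) : \sum_(k < a.+2) c k * t k = c 0 * t 0 + S c.
  by rewrite big_ord_recl; congr (_ + _); apply: eq_bigr => k _; rewrite lift0.
rewrite E1 E2 E3 (recl (fun k => ('C(a.+1, k) * 'C(b.+1, k))%:R)).
rewrite (recl (fun k => ('C(a, k) * 'C(b.+1, k))%:R)) (recl (fun k => ('C(a, k) * 'C(b, k))%:R)).
rewrite !bin0 !muln1 !mul1r.
set S4 := (\sum_(k < a.+1) _).
have key : a.+1%:R * S (fun k => ('C(a.+1, k) * 'C(b.+1, k))%:R) =
    (a + b).+2%:R * S (fun k => ('C(a, k) * 'C(b.+1, k))%:R)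
    - b.+1%:R * S (fun k => ('C(a, k) * 'C(b, k))%:R) + b.+1%:R * S4.
  rewrite /S /S4 !mulr_sumr -sumrB -big_split /=; apply: eq_bigr => k _.
  by rewrite !mulrA disc_poly_coef; ring.
have e : (a + b).+2%:R = a.+1%:R + b.+1%:R :> F by rewrite -natrD; congr (_%:R); lia.
by rewrite mulrDr key e; ring.
Qed.

End DiscPolynomials.

Section DiscIntegral.
Context {R : realType}.
Local Notation C := R[i].
Local Notation mu := (@lebesgue_measure R).
Local Notation haar := ((mu \x mu) \x mu)%E.
Implicit Types (lambda : C) (delta : int) (p : R * R * R) (a b k : nat).

Definition haar_bound p : R := cauchy_fun p.1.1 * cauchy_fun p.1.2 * cauchy_fun p.2.

Lemma cintegrable_haar (h : R * R * R -> C) (M : R) : cmeasurable h ->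
  (forall p, normc (h p) <= M * haar_bound p) -> cintegrable haar setT h.
Proof.
move=> mh hM; pose K := `|M| + 1; have K0 : 0 < K by rewrite ltr_wpDl.
have K0' : K%:C != 0 :> C by rewrite (inj_eq (@complexI _)) gt_eqF.
have mh' : cmeasurable (fun p => K^-1%:C * h p).
  by apply: cmeasurableM => //; exact: cmeasurable_cst.
have [|i _ _] := cFubini3_cauchy mh'.
  move=> x y w; rewrite normcM normcR ger0_norm ?invr_ge0 ?(ltW K0)//.
  rewrite ler_pdivrMl// (le_trans (hM _))// /haar_bound /=; apply: ler_wpM2r.
    by rewrite !mulr_ge0 ?cauchy_fun_ge0.
  by rewrite (le_trans (ler_norm _))// lerDl.
have := cintegrableZ K%:C i; congr cintegrable; apply/funext => p.
by rewrite mulrA -realcM divff ?gt_eqF// mul1r.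
Qed.

(* zeta = (1 - u) / (1 + u) for u = |z|^2 - 2 i w, and its conjugate. *)
Definition cayley p : C := 2 * haar_kernel (-1) 1 p - 1.
Definition cayley_conj p : C := 2 * haar_kernel (-1) (-1) p - 1.

(** The exponent in the kernel is lambda + 2, whence the extra 2. In particular the factor
    [haar_kernel (-1) 1], which is 1/(1 + u), shifts (lambda, delta) by (1, 1). *)
Lemma haar_kernelM lambda nu delta (e : int) p :
  haar_kernel lambda delta p * haar_kernel nu e p = haar_kernel (lambda + nu + 2) (delta + e) p.
Proof.
by rewrite /haar_kernel /iwasawa_kernel -cexpD rmorphD /=; congr cexp; ring.
Qed.

Lemma conj_realc (x : R) : Num.conj (x%:C : C) = x%:C.
Proof. by rewrite conj_Creal// complex_real. Qed.

Lemma conj_complexi : Num.conj ('i%C : C) = - 'i%C.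
Proof. by apply: complex_eqP; rewrite /= ?oppr0. Qed.

Lemma haar_kernel_conj lambda delta p :
  Num.conj (haar_kernel lambda delta p) = haar_kernel (Num.conj lambda) (- delta) p.
Proof.
rewrite /haar_kernel /iwasawa_kernel conj_cexp; congr cexp.
move: (iwasawa_log _ _) (iwasawa_arg _ _) => s t.
rewrite rmorphD /= !rmorphM /= rmorphN /= rmorphD /= rmorph_nat !conj_realc.
by rewrite conj_complexi rmorph_int rmorphN /=; ring.
Qed.

Lemma cayley_conjE p : Num.conj (cayley p) = cayley_conj p.
Proof.
by rewrite /cayley rmorphB /= rmorphM /= haar_kernel_conj rmorph1 rmorph_nat rmorphN1.
Qed.

Lemma haar_kernel_inv p :
  haar_kernel (-1) 1 p * (1 + (sqnorm p.1)%:C - 2 * 'i%C * p.2%:C) = 1.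
Proof.
have := cexp_iwasawa p.2 (sqnorm_ge0 p.1).
rewrite /haar_kernel /iwasawa_kernel => h; rewrite -[RHS]h; congr (cexp _ * _); first by ring.
by apply: complex_eqP; rewrite !(cReD, cReN, cReM, cImD, cImN, cImM) /=; ring.
Qed.

Lemma haar_kernel_inv_conj p :
  haar_kernel (-1) (-1) p * (1 + (sqnorm p.1)%:C + 2 * 'i%C * p.2%:C) = 1.
Proof.
have := cexp_iwasawa_conj p.2 (sqnorm_ge0 p.1).
rewrite /haar_kernel /iwasawa_kernel => h; rewrite -[RHS]h; congr (cexp _ * _); first by ring.
by apply: complex_eqP; rewrite !(cReD, cReN, cReM, cImD, cImN, cImM) /=; ring.
Qed.

(** This is 1 - |zeta|^2 = 4 Re u / |1 + u|^2 with Re u = |z|^2, so zeta stays in the unit disc and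
    the Zernike polynomials are bounded on it. *)
Lemma cayley_mul p : cayley p * cayley_conj p =
  1 - 4 * (sqnorm p.1)%:C * haar_kernel (-1) 1 p * haar_kernel (-1) (-1) p.
Proof.
have := haar_kernel_inv p; have := haar_kernel_inv_conj p.
rewrite /cayley /cayley_conj.
set U := haar_kernel (-1) 1 p; set V := haar_kernel (-1) (-1) p.
move: (sqnorm p.1)%:C ('i%C : C) (p.2%:C) => r I w hV hU.
transitivity (1 + 4 * U * V - 2 * U * (V * (1 + r + 2 * I * w))
    - 2 * V * (U * (1 + r - 2 * I * w))); last by ring.
by rewrite hU hV; ring.
Qed.

Lemma haar_kernel_pair p :
  haar_kernel (-1) 1 p * haar_kernel (-1) (-1) p = (expR (- (2 * iwasawa_log (sqnorm p.1) p.2)))%:C.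
Proof.
rewrite haar_kernelM subrr /haar_kernel /iwasawa_kernel mulr0 mul0r addr0 -cexpR.
by congr cexp; rewrite !realcE; ring.
Qed.

Lemma cayley_sqnorm_ge0 p : cayley p * cayley_conj p =
  (1 - 4 * sqnorm p.1 * expR (- (2 * iwasawa_log (sqnorm p.1) p.2)))%:C.
Proof.
rewrite cayley_mul -mulrA haar_kernel_pair.
by move: (sqnorm _) (iwasawa_log _ _) => r s; rewrite realcD realcN !realcM realc_nat.
Qed.

Lemma normc_sqr_real (z : C) (x : R) : z * Num.conj z = x%:C -> normc z ^+ 2 = x.
Proof.
move=> h; apply: (@complexI R); rewrite -h realcX -normC_normc.
exact: (sqr_normc z).
Qed.

Lemma normc_cayley_le1 p : normc (cayley p) <= 1.
Proof.
have h : normc (cayley p) ^+ 2 <= 1.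
  rewrite (normc_sqr_real (_ : _ = (1 - 4 * sqnorm p.1 * expR (- (2 * iwasawa_log (sqnorm p.1) p.2)))%:C)).
    by rewrite gerDl oppr_le0 !mulr_ge0 ?expR_ge0 ?sqnorm_ge0.
  by rewrite cayley_conjE cayley_sqnorm_ge0.
by rewrite -(expr1n R 2) ler_sqr ?nnegrE ?normc_ge0 in h.
Qed.

Lemma normc_cayley_conj_le1 p : normc (cayley_conj p) <= 1.
Proof. by rewrite -cayley_conjE normc_conj normc_cayley_le1. Qed.

Lemma cmeasurable_cayley : cmeasurable cayley.
Proof.
apply: cmeasurableB; last exact: cmeasurable_cst.
by apply: cmeasurableM; [exact: cmeasurable_cst|exact: cmeasurable_iwasawa_kernel].
Qed.

Lemma cmeasurable_cayley_conj : cmeasurable cayley_conj.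
Proof.
apply: cmeasurableB; last exact: cmeasurable_cst.
by apply: cmeasurableM; [exact: cmeasurable_cst|exact: cmeasurable_iwasawa_kernel].
Qed.

Lemma cintegrable_haar_mul lambda delta (h : R * R * R -> C) (M : R) : 2 <= Re lambda ->
  cmeasurable h -> (forall p, normc (h p) <= M) ->
  cintegrable haar setT (fun p => haar_kernel lambda delta p * h p).
Proof.
move=> l2 mh hM; apply: (@cintegrable_haar _ M).
  by apply: cmeasurableM => //; exact: cmeasurable_iwasawa_kernel.
move=> [[x y] w]; rewrite normcM mulrC ler_pM ?normc_ge0//.
exact: haar_kernel_bound.
Qed.

Lemma cmeasurable_disc_poly a b : cmeasurable (fun p => disc_poly a b (cayley p) (cayley_conj p)).
Proof.
apply: cmeasurable_sum => k; apply: cmeasurableM; first exact: cmeasurable_cst.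
apply: cmeasurableM; last by apply: cmeasurableX; exact: cmeasurable_cayley_conj.
apply: cmeasurableM; apply: cmeasurableX; last exact: cmeasurable_cayley.
apply: cmeasurableB; last exact: cmeasurable_cst.
by apply: cmeasurableM; [exact: cmeasurable_cayley|exact: cmeasurable_cayley_conj].
Qed.

Lemma disc_poly_bounded a b : exists M : R, forall p,
  normc (disc_poly a b (cayley p) (cayley_conj p)) <= M.
Proof.
exists (\sum_(k < a.+1) (('C(a, k) * 'C(b, k))%:R * (2 ^+ k * 1 * 1))) => p.
rewrite /disc_poly.
elim/big_ind2 : _ => [|u v x y hu hv|k _]; first by rewrite normc0.
  by apply: (le_trans (le_normcD _ _)); exact: lerD.
rewrite !normcM -realc_nat normcR ger0_norm// ler_wpM2l//.
rewrite !normcX; have c1 := normc_cayley_le1 p; have c2 := normc_cayley_conj_le1 p.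
apply: ler_pM; rewrite ?mulr_ge0 ?exprn_ge0 ?normc_ge0//; last by rewrite exprn_ile1 ?normc_ge0.
apply: ler_pM; rewrite ?exprn_ge0 ?normc_ge0//; last by rewrite exprn_ile1 ?normc_ge0.
apply: lerXn2r; rewrite ?nnegrE ?normc_ge0//.
apply: (le_trans (le_normcD _ _)); rewrite normcN normc1 normcM.
rewrite (_ : 2 = 1 + 1)// lerD// -[leRHS]mulr1 ler_pM ?normc_ge0//.
Qed.

Definition disc_integral lambda delta a b : C :=
  cintegral haar setT (fun p => haar_kernel lambda delta p * disc_poly a b (cayley p) (cayley_conj p)).

Lemma cintegrable_disc lambda delta a b : 2 <= Re lambda ->
  cintegrable haar setT (fun p => haar_kernel lambda delta p * disc_poly a b (cayley p) (cayley_conj p)).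
Proof.
move=> l2; have [M hM] := disc_poly_bounded a b.
by apply: cintegrable_haar_mul hM => //; exact: cmeasurable_disc_poly.
Qed.

End DiscIntegral.

(** * Integrals of the Zernike polynomials *)

Section DiscRatio.
Context {R : realType}.
Local Notation C := R[i].
Local Notation mu := (@lebesgue_measure R).
Local Notation haar := ((mu \x mu) \x mu)%E.
Implicit Types (lambda A B : C) (delta : int) (p : R * R * R) (a b k : nat).

(** The integral of the Zernike polynomial relative to the case P = 1, for A = (lambda + delta) / 2
    and B = (lambda - delta) / 2. The shifts of (lambda, delta) raise A or B by 1, and the three
    recurrences below mirror those of the polynomials. *)
Definition disc_ratio A B a b : C :=
  (-1) ^+ (a + b) * (rising (1 - A) b * rising (1 - B) a) /
  (rising (1 + B) b * rising (1 + A) a).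

Lemma disc_ratio0S A B b : nonpole (1 + B) ->
  disc_ratio A B 0 b.+1 = (A + B) / (1 + B) * disc_ratio A (B + 1) 0 b - disc_ratio A B 0 b.
Proof.
move=> hB; rewrite /disc_ratio !rising0 !add0n !mulr1 exprS.
have B1 : 1 + B != 0 by have := hB 0; rewrite addr0.
have Bb : 1 + B + b%:R != 0 by [].
have r0 : rising (1 + B) b != 0 by exact: rising_neq0.
have -> : rising (1 + (B + 1)) b = rising (1 + B) b * (1 + B + b%:R) / (1 + B).
  by rewrite -risingS risingSl [1 + (B + 1)]addrA mulrC mulKf.
rewrite !risingS; move: (rising _ _) (rising _ _) r0 ((-1) ^+ b) => r q q0 s.
by move: (b%:R : C) Bb => x Bb; field; rewrite q0 B1 Bb.
Qed.

Lemma disc_ratioS0 A B a : nonpole (1 + A) ->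
  disc_ratio A B a.+1 0 = (A + B) / (1 + A) * disc_ratio (A + 1) B a 0 - disc_ratio A B a 0.
Proof.
move=> hA; have := disc_ratio0S B a hA; rewrite /disc_ratio !rising0 !addn0 !add0n.
by rewrite !mulr1 !mul1r [B + A]addrC.
Qed.

Lemma disc_ratioSS A B a b : nonpole (1 + A) -> nonpole (1 + B) ->
  a.+1%:R * disc_ratio A B a.+1 b.+1 =
  (a + b).+2%:R * ((A + B) / (1 + A) * disc_ratio (A + 1) B a b.+1 - disc_ratio A B a b.+1)
  - b.+1%:R * disc_ratio A B a b.
Proof.
move=> hA hB; rewrite /disc_ratio !addSn !addnS !exprS.
have A1 : 1 + A != 0 by have := hA 0; rewrite addr0.
have Aa : 1 + A + a%:R != 0 by [].
have Bb : 1 + B + b%:R != 0 by [].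
have q0 : rising (1 + A) a != 0 by exact: rising_neq0.
have p0 : rising (1 + B) b != 0 by exact: rising_neq0.
have -> : rising (1 + (A + 1)) a = rising (1 + A) a * (1 + A + a%:R) / (1 + A).
  by rewrite -risingS risingSl [1 + (A + 1)]addrA mulrC mulKf.
have -> : rising (1 - (A + 1)) b.+1 = - A * rising (1 - A) b.
  by rewrite risingSl; congr (_ * rising _ _); ring.
rewrite !risingS -!natr1 natrD.
move: (rising (1 - A) b) (rising (1 - B) a) (rising _ _) (rising _ _) q0 p0 => r s q' p' q0 p0.
move: ((-1) ^+ (a + b)) (a%:R : C) (b%:R : C) Aa Bb => e x y Aa Bb.
by field; rewrite A1 Aa Bb p0 q0.
Qed.

Definition haar_total lambda delta : C :=
  (pi : R)%:C / (2 * lambda) * cauchy_integral lambda delta.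

Lemma Re_gt0_neq0 (z : C) : 0 < Re z -> z != 0.
Proof. by move=> h; apply/eqP => z0; move: h; rewrite z0 ltxx. Qed.

Lemma Re_halfD lambda delta : Re (1 + (lambda + delta%:~R) / 2) = 1 + (Re lambda + delta%:~R) / 2.
Proof. by rewrite cReD Re_half cReD Re_intr. Qed.

Lemma Re_halfB lambda delta : Re (1 + (lambda - delta%:~R) / 2) = 1 + (Re lambda - delta%:~R) / 2.
Proof. by rewrite cReD Re_half cReD cReN Re_intr. Qed.

(** The summand |delta| makes the range stable under the shifts of (lambda, delta) by (1, 1) and (1,
    -1), and keeps both 1 + A and 1 + B in the right half plane. *)
Definition convergence_range lambda delta : Prop := 4 + `|delta|%:~R <= Re lambda.

Lemma large_half lambda delta : convergence_range lambda delta ->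
  [/\ 4 <= Re lambda, 0 < Re (1 + (lambda + delta%:~R) / 2)
    & 0 < Re (1 + (lambda - delta%:~R) / 2)].
Proof.
rewrite /convergence_range Re_halfD Re_halfB intr_norm => h.
have h1 := ler_norm (delta%:~R : R); have h2 := ler_norm (- (delta%:~R : R)).
have h3 := normr_ge0 (delta%:~R : R).
by rewrite normrN in h2; split; lra.
Qed.

Lemma large_shift lambda delta (e : int) : `|e| = 1 -> convergence_range lambda delta -> convergence_range (lambda + 1) (delta + e).
Proof.
rewrite /convergence_range cReD => e1 h; have : `|delta + e|%:~R <= `|delta|%:~R + 1 :> R.
  by rewrite -[1]/(1%:~R) -intrD ler_int -e1 ler_normD.
by rewrite [Re 1]/=; lra.
Qed.

(** As lambda = A + B, the factor on the right is the coefficient (A + B) / (1 + A) in the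
    recurrences of [disc_ratio]. *)
Lemma haar_total_up lambda delta : convergence_range lambda delta ->
  2 * haar_total (lambda + 1) (delta + 1) =
  lambda / (1 + (lambda + delta%:~R) / 2) * haar_total lambda delta.
Proof.
move=> h; have [l4 hA _] := large_half h.
have l1 : 1 <= Re lambda by lra.
have := cauchy_integral_up delta l1; rewrite /haar_total.
have A0 := Re_gt0_neq0 hA.
have l0 : lambda != 0 by apply: Re_gt0_neq0; lra.
have l10 : lambda + 1 != 0 by apply: Re_gt0_neq0; rewrite cReD [Re 1]/=; lra.
have t0 : (2 : C) != 0 by rewrite pnatr_eq0.
have e0 : 1 + (lambda + delta%:~R) / 2 = (lambda + delta%:~R + 2) / 2 by field.
have A2 : lambda + delta%:~R + 2 != 0.
  by apply: contraNneq A0 => h0; rewrite e0 h0 mul0r.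
move=> e; have -> : cauchy_integral (lambda + 1) (delta + 1) =
    (lambda + 1) / (lambda + delta%:~R + 2) * cauchy_integral lambda delta.
  by apply: (mulfI A2); rewrite e; field.
rewrite e0; move: (lambda + delta%:~R + 2) A2 => T A2.
by field; rewrite l0 l10 A2.
Qed.

Lemma haar_total_down lambda delta : convergence_range lambda delta ->
  2 * haar_total (lambda + 1) (delta - 1) =
  lambda / (1 + (lambda - delta%:~R) / 2) * haar_total lambda delta.
Proof.
move=> h; have [l4 _ hA] := large_half h.
have l1 : 1 <= Re lambda by lra.
have := cauchy_integral_down delta l1; rewrite /haar_total.
have A0 := Re_gt0_neq0 hA.
have l0 : lambda != 0 by apply: Re_gt0_neq0; lra.
have l10 : lambda + 1 != 0 by apply: Re_gt0_neq0; rewrite cReD [Re 1]/=; lra.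
have t0 : (2 : C) != 0 by rewrite pnatr_eq0.
have e0 : 1 + (lambda - delta%:~R) / 2 = (lambda - delta%:~R + 2) / 2 by field.
have A2 : lambda - delta%:~R + 2 != 0.
  by apply: contraNneq A0 => h0; rewrite e0 h0 mul0r.
move=> e; have -> : cauchy_integral (lambda + 1) (delta - 1) =
    (lambda + 1) / (lambda - delta%:~R + 2) * cauchy_integral lambda delta.
  by apply: (mulfI A2); rewrite e; field.
rewrite e0; move: (lambda - delta%:~R + 2) A2 => T A2.
by field; rewrite l0 l10 A2.
Qed.

Lemma haar_kernel_cayley lambda delta p :
  haar_kernel lambda delta p * cayley p =
  2 * haar_kernel (lambda + 1) (delta + 1) p - haar_kernel lambda delta p.
Proof.
rewrite /cayley mulrBr mulr1 mulrCA haar_kernelM.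
by have -> : lambda + -1 + 2 = lambda + 1 by ring.
Qed.

Lemma haar_kernel_cayley_conj lambda delta p :
  haar_kernel lambda delta p * cayley_conj p =
  2 * haar_kernel (lambda + 1) (delta - 1) p - haar_kernel lambda delta p.
Proof.
rewrite /cayley_conj mulrBr mulr1 mulrCA haar_kernelM.
by have -> : lambda + -1 + 2 = lambda + 1 by ring.
Qed.

Lemma cintegral_cayley lambda delta a b : convergence_range lambda delta ->
  cintegral haar setT (fun p => haar_kernel lambda delta p *
    (cayley p * disc_poly a b (cayley p) (cayley_conj p))) =
  2 * disc_integral (lambda + 1) (delta + 1) a b - disc_integral lambda delta a b.
Proof.
move=> h; have [l4 _ _] := large_half h.
have l2 : 2 <= Re lambda by lra.
have l3 : 2 <= Re (lambda + 1) by rewrite cReD [Re 1]/=; lra.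
rewrite /disc_integral -(cintegralZ 2 (cintegrable_disc (delta + 1) a b l3)).
rewrite -(cintegralB (cintegrableZ 2 (cintegrable_disc (delta + 1) a b l3)) (cintegrable_disc delta a b l2)).
congr cintegral; apply/funext => p; rewrite mulrA haar_kernel_cayley; ring.
Qed.

Lemma cintegral_cayley_conj lambda delta a b : convergence_range lambda delta ->
  cintegral haar setT (fun p => haar_kernel lambda delta p *
    (cayley_conj p * disc_poly a b (cayley p) (cayley_conj p))) =
  2 * disc_integral (lambda + 1) (delta - 1) a b - disc_integral lambda delta a b.
Proof.
move=> h; have [l4 _ _] := large_half h.
have l2 : 2 <= Re lambda by lra.
have l3 : 2 <= Re (lambda + 1) by rewrite cReD [Re 1]/=; lra.
rewrite /disc_integral -(cintegralZ 2 (cintegrable_disc (delta - 1) a b l3)).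
rewrite -(cintegralB (cintegrableZ 2 (cintegrable_disc (delta - 1) a b l3)) (cintegrable_disc delta a b l2)).
congr cintegral; apply/funext => p; rewrite mulrA haar_kernel_cayley_conj; ring.
Qed.

Lemma disc_integral0S lambda delta b : convergence_range lambda delta ->
  disc_integral lambda delta 0 b.+1 =
  2 * disc_integral (lambda + 1) (delta - 1) 0 b - disc_integral lambda delta 0 b.
Proof.
move=> h; rewrite -cintegral_cayley_conj//; congr cintegral; apply/funext => p.
by rewrite !disc_poly0 exprS.
Qed.

Lemma disc_integralS0 lambda delta a : convergence_range lambda delta ->
  disc_integral lambda delta a.+1 0 =
  2 * disc_integral (lambda + 1) (delta + 1) a 0 - disc_integral lambda delta a 0.
Proof.
by move=> h; rewrite -cintegral_cayley//; congr cintegral; apply/funext => p; rewrite disc_polyS0.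
Qed.

Lemma disc_integralSS lambda delta a b : convergence_range lambda delta ->
  a.+1%:R * disc_integral lambda delta a.+1 b.+1 =
  (a + b).+2%:R * (2 * disc_integral (lambda + 1) (delta + 1) a b.+1
                   - disc_integral lambda delta a b.+1)
  - b.+1%:R * disc_integral lambda delta a b.
Proof.
move=> h; have [l4 _ _] := large_half h.
have l2 : 2 <= Re lambda by lra.
have l3 : 2 <= Re (lambda + 1) by rewrite cReD [Re 1]/=; lra.
rewrite -cintegral_cayley// /disc_integral.
have i1 : cintegrable haar setT (fun p => haar_kernel lambda delta p *
    (cayley p * disc_poly a b.+1 (cayley p) (cayley_conj p))).
  have := cintegrableB (cintegrableZ 2 (cintegrable_disc (delta + 1) a b.+1 l3)) (cintegrable_disc delta a b.+1 l2).
  by congr cintegrable; apply/funext => p; rewrite [RHS]mulrA haar_kernel_cayley; ring.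
have i2 := cintegrable_disc delta a b l2.
rewrite -(cintegralZ _ (cintegrable_disc delta a.+1 b.+1 l2)) -(cintegralZ _ i1) -(cintegralZ _ i2).
rewrite -(cintegralB (cintegrableZ _ i1) (cintegrableZ _ i2)).
congr cintegral; apply/funext => p; rewrite mulrCA disc_polySS; ring.
Qed.

Lemma half_shift lambda delta :
  [/\ (lambda + 1 + (delta + 1)%:~R) / 2 = (lambda + delta%:~R) / 2 + 1,
      (lambda + 1 - (delta + 1)%:~R) / 2 = (lambda - delta%:~R) / 2,
      (lambda + 1 + (delta - 1)%:~R) / 2 = (lambda + delta%:~R) / 2 &
      (lambda + 1 - (delta - 1)%:~R) / 2 = (lambda - delta%:~R) / 2 + 1].
Proof. by split; rewrite ?intrD ?rmorphN1; field. Qed.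

(** The induction on [a] is uniform in lambda, delta and b, since the recurrences shift the
    parameters. The case [a = 0] is an induction on b through the conjugate shift to (lambda + 1,
    delta - 1). *)
Lemma disc_integral_ratio lambda delta a b : convergence_range lambda delta ->
  disc_integral lambda delta a b = haar_total lambda delta *
    disc_ratio ((lambda + delta%:~R) / 2) ((lambda - delta%:~R) / 2) a b.
Proof.
elim: a lambda delta b => [|a IH] lambda delta b; last first.
  move=> h; have [l4 hA hB] := large_half h; have h' := large_shift (normr1 _) h.
  have E := haar_total_up h; have [e1 e2 _ _] := half_shift lambda delta.
  have nA := nonpole_gt0 hA; have nB := nonpole_gt0 hB.
  have sAB : (lambda + delta%:~R) / 2 + (lambda - delta%:~R) / 2 = lambda by field.
  case: b => [|b].
    rewrite disc_integralS0// !IH// e1 e2 mulrA E disc_ratioS0// sAB; ring.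
  have aS : (a.+1%:R : C) != 0 by rewrite pnatr_eq0.
  apply: (mulfI aS); rewrite disc_integralSS// !IH// e1 e2 mulrA E [RHS]mulrCA disc_ratioSS// sAB.
  ring.
elim: b lambda delta => [|b IH] lambda delta h; have [l4 hA hB] := large_half h.
  rewrite /disc_ratio !rising0 !mulr1 divr1 mulr1 /disc_integral /haar_total -(haar_integral _ l4).
  by congr cintegral; apply/funext => p; rewrite disc_poly0 mulr1.
have h' : convergence_range (lambda + 1) (delta - 1) by apply: large_shift h; rewrite normrN1.
have E := haar_total_down h; have [_ _ e1 e2] := half_shift lambda delta.
have sAB : (lambda + delta%:~R) / 2 + (lambda - delta%:~R) / 2 = lambda by field.
rewrite disc_integral0S// !IH// e1 e2 mulrA E disc_ratio0S ?sAB; last exact: nonpole_gt0.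
ring.
Qed.

End DiscRatio.

(** * Monomials in the entries of kappa and their rotation weights *)

Section HaarTerm.
Context {R : realType}.
Local Notation C := R[i].
Local Notation mu := (@lebesgue_measure R).
Local Notation haar := ((mu \x mu) \x mu)%E.
Implicit Types (lambda : C) (delta : int) (p : R * R * R) (i j k l : nat).

(* 2 z / |1 + u| for u = |z|^2 - 2 i w, which has squared norm 1 - |zeta|^2. *)
Definition horo p : C :=
  2 * (p.1.1 +i* p.1.2) * (expR (- iwasawa_log (sqnorm p.1) p.2))%:C.

Lemma mul_conj_pair (x y : R) : (x +i* y) * Num.conj (x +i* y) = (x ^+ 2 + y ^+ 2)%:C.
Proof. by apply: complex_eqP; rewrite ?(cReM, cImM) /=; ring. Qed.

Lemma horo_conj p : horo p * Num.conj (horo p) = 1 - cayley p * cayley_conj p.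
Proof.
rewrite cayley_mul -mulrA haar_kernel_pair /horo !rmorphM /= conj_realc rmorph_nat.
move: (iwasawa_log _ _) => s; have -> : - (2 * s) = - s - s by ring.
rewrite expRD realcM.
have := mul_conj_pair p.1.1 p.1.2; rewrite -/(sqnorm p.1).
move: (p.1.1 +i* p.1.2) (Num.conj _) (expR _)%:C (sqnorm p.1)%:C => z z' e r zz.
by rewrite opprD opprK addrA subrr add0r -zz; ring.
Qed.

Lemma normc_horo_le1 p : normc (horo p) <= 1.
Proof.
have h : normc (horo p) ^+ 2 <= 1.
  rewrite (normc_sqr_real (_ : _ = (1 - normc (cayley p) ^+ 2)%:C)).
    by rewrite gerBl sqr_ge0.
  rewrite horo_conj realcD realcN; congr (_ - _).
  by rewrite -cayley_conjE realcX -normC_normc -(sqr_normc (cayley p)).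
by rewrite -(expr1n R 2) ler_sqr ?nnegrE ?normc_ge0 in h.
Qed.

Lemma cmeasurable_horo : cmeasurable horo.
Proof.
have -> : horo = fun p => 2 * (p.1.1 +i* p.1.2) * (haar_kernel (-1) 0 p).
  apply/funext => p; rewrite /horo /haar_kernel /iwasawa_kernel mulr0 mul0r addr0 -cexpR.
  by congr (_ * cexp _); rewrite realcN; ring.
apply: cmeasurableM; last exact: cmeasurable_iwasawa_kernel.
apply: cmeasurableM; first exact: cmeasurable_cst.
by split => /=; [exact: measurableT_comp|exact: measurableT_comp].
Qed.

(** A rotation of z fixes zeta and the kernel and multiplies [horo] by e^(i t), so such a term has
    weight k - l. *)
Definition haar_term lambda delta i j k l p : C :=
  haar_kernel lambda delta p *
  (cayley p ^+ i * cayley_conj p ^+ j * (horo p ^+ k * Num.conj (horo p) ^+ l)).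

Lemma haar_term_mul1 i j k l p :
  normc (cayley p ^+ i * cayley_conj p ^+ j * (horo p ^+ k * Num.conj (horo p) ^+ l)) <= 1.
Proof.
have h (z : C) n : normc z <= 1 -> normc (z ^+ n) <= 1.
  by move=> z1; rewrite normcX exprn_ile1 ?normc_ge0.
have m (z w : C) : normc z <= 1 -> normc w <= 1 -> normc (z * w) <= 1.
  by move=> z1 w1; rewrite normcM -[leRHS]mulr1 ler_pM ?normc_ge0.
apply: (m _ _); apply: (m _ _); apply: (h _ _); rewrite ?normc_conj.
- exact: normc_cayley_le1.
- exact: normc_cayley_conj_le1.
- exact: normc_horo_le1.
- exact: normc_horo_le1.
Qed.

Lemma cmeasurable_haar_term_mul i j k l : cmeasurable (fun p =>
  cayley p ^+ i * cayley_conj p ^+ j * (horo p ^+ k * Num.conj (horo p) ^+ l)).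
Proof.
apply: cmeasurableM; apply: cmeasurableM; apply: cmeasurableX.
- exact: cmeasurable_cayley.
- exact: cmeasurable_cayley_conj.
- exact: cmeasurable_horo.
- exact: (cmeasurable_conj cmeasurable_horo).
Qed.

Lemma cintegrable_haar_term lambda delta i j k l : 2 <= Re lambda ->
  cintegrable haar setT (haar_term lambda delta i j k l).
Proof.
move=> l2; apply: (@cintegrable_haar_mul _ lambda delta _ 1 l2).
  exact: cmeasurable_haar_term_mul.
by move=> p; exact: haar_term_mul1.
Qed.

Lemma ccontinuous_haar_kernel_line lambda delta (a b c d w : R) :
  ccontinuous (fun t => haar_kernel lambda delta (a * t + b, c * t + d, w)).
Proof.
move=> t; pose r (t : R) : R := 1 + sqnorm (a * t + b, c * t + d).
have cl (u v : R) : continuous (fun t : R => u * t + v).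
  move=> x; apply: cvgD; last exact: cvg_cst.
  by apply: cvgM; [exact: cvg_cst|exact: cvg_id].
have cs (u v : R) : continuous (fun t : R => (u * t + v) ^+ 2).
  move=> x; apply: (@continuous_comp _ _ _ (fun t => u * t + v) (fun y : R => y ^+ 2)).
    exact: cl.
  exact: exprn_continuous.
have cr : continuous r.
  by move=> x; apply: cvgD; [exact: cvg_cst|apply: cvgD; exact: cs].
have r0 x : 0 < r x by apply: one_add_gt0; exact: sqnorm_ge0.
apply: ccontinuous_at_cexp; apply: ccontinuous_atD; apply: ccontinuous_atM;
  try exact: ccontinuous_at_cst; apply: ccontinuous_atR.
  apply: cvgM; last exact: cvg_cst.
  apply: (@continuous_comp _ _ _ (fun x => r x ^+ 2 + 4 * w ^+ 2) (@ln R)).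
    apply: cvgD; last exact: cvg_cst.
    by apply: (@continuous_comp _ _ _ r (fun y : R => y ^+ 2)); [exact: cr|exact: exprn_continuous].
  by apply: continuous_ln; rewrite ltr_wpDr ?exprn_gt0// mulr_ge0// sqr_ge0.
apply: (@continuous_comp _ _ _ (fun x => 2 * w / r x) (@atan R)); last exact: continuous_atan.
apply: cvgM; first exact: cvg_cst.
by apply: cvgV; [rewrite gt_eqF|exact: cr].
Qed.

Lemma ccontinuousM (h1 h2 : R -> C) : ccontinuous h1 -> ccontinuous h2 ->
  ccontinuous (fun t => h1 t * h2 t).
Proof. by move=> c1 c2 t; exact: ccontinuous_atM. Qed.

Lemma ccontinuousX (h : R -> C) n : ccontinuous h -> ccontinuous (fun t => h t ^+ n).
Proof.
move=> ch; elim: n => [|n IH].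
  by move=> t; exact: ccontinuous_at_cst.
have -> : (fun t => h t ^+ n.+1) = (fun t => h t * h t ^+ n) by apply/funext => t; rewrite exprS.
exact: ccontinuousM.
Qed.

Lemma ccontinuous_conj (h : R -> C) : ccontinuous h -> ccontinuous (fun t => Num.conj (h t)).
Proof.
move=> ch t; have [c1 c2] := ch t.
have -> : (fun t => Num.conj (h t)) = (fun t => Re (h t) -i* Im (h t)).
  by apply/funext => x; case: (h x).
by split=> //; move: c2; exact: cvgN.
Qed.

Lemma ccontinuous_haar_term lambda delta i j k l (a b c d w : R) :
  ccontinuous (fun t => haar_term lambda delta i j k l (a * t + b, c * t + d, w)).
Proof.
have cl (u v : R) : continuous (fun t : R => u * t + v).
  move=> x; apply: cvgD; last exact: cvg_cst.
  by apply: cvgM; [exact: cvg_cst|exact: cvg_id].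
have cc (e : int) : ccontinuous (fun t => 2 * haar_kernel (-1) e (a * t + b, c * t + d, w) - 1).
  move=> t; apply: ccontinuous_atB; last exact: ccontinuous_at_cst.
  apply: ccontinuous_atM; first exact: ccontinuous_at_cst.
  exact: ccontinuous_haar_kernel_line.
have ch : ccontinuous (fun t => horo (a * t + b, c * t + d, w)).
  have -> : horo = fun p => 2 * (p.1.1 +i* p.1.2) * (haar_kernel (-1) 0 p).
    apply/funext => p; rewrite /horo /haar_kernel /iwasawa_kernel mulr0 mul0r addr0 -cexpR.
    by congr (_ * cexp _); rewrite realcN; ring.
  apply: ccontinuousM; last exact: ccontinuous_haar_kernel_line.
  move=> t; apply: ccontinuous_atM; first exact: ccontinuous_at_cst.
  by split; exact: cl.
apply: ccontinuousM; first exact: ccontinuous_haar_kernel_line.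
apply: ccontinuousM; apply: ccontinuousM; apply: ccontinuousX => //.
  exact: cc.
  exact: cc.
exact: ccontinuous_conj.
Qed.

Lemma planar_haar_term lambda delta i j k l (w : R) : 2 <= Re lambda ->
  planar (fun q => haar_term lambda delta i j k l (q, w)).
Proof.
move=> l2; split.
- apply: (cmeasurable_comp (h := haar_term lambda delta i j k l) (f := fun q => (q, w))).
    apply: cmeasurableM; first exact: cmeasurable_iwasawa_kernel.
    exact: cmeasurable_haar_term_mul.
  by apply: measurable_fun_pair => //; exact: measurable_id.
- by move=> a b c d; exact: ccontinuous_haar_term.
- exists (cauchy_fun w); first exact: cauchy_fun_ge0.
  move=> [x y]; rewrite normcM mulrC [leRHS]mulrC -[leRHS]mul1r.
  apply: ler_pM; rewrite ?normc_ge0 ?haar_term_mul1//.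
  exact: iwasawa_kernel_bound.
Qed.

Lemma sqnorm_rotation (th x y : R) :
  sqnorm (cos th * x - sin th * y, sin th * x + cos th * y) = sqnorm (x, y).
Proof.
rewrite /sqnorm /=.
have -> : (cos th * x - sin th * y) ^+ 2 + (sin th * x + cos th * y) ^+ 2 =
  (cos th ^+ 2 + sin th ^+ 2) * (x ^+ 2 + y ^+ 2) by ring.
by rewrite cos2Dsin2 mul1r.
Qed.

Lemma haar_term_rotation lambda delta i j k l (th w : R) (q : R * R) :
  haar_term lambda delta i j k l ((cos th * q.1 - sin th * q.2, sin th * q.1 + cos th * q.2), w) =
  cexp ('i%C * (k%:Z - l%:Z)%:~R * th%:C) * haar_term lambda delta i j k l (q, w).
Proof.
case: q => x y /=; rewrite /haar_term /cayley /cayley_conj /haar_kernel /= sqnorm_rotation.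
set q' := (_, _, w).
have -> : horo q' = cexp ('i%C * th%:C) * horo (x, y, w).
  rewrite /horo /= sqnorm_rotation mulrA mulrCA; congr (_ * _ * _).
  rewrite /cexp mul_iR /= expR0 mul1r.
  by apply: complex_eqP; rewrite /=; ring.
have -> : cexp ('i%C * (k%:Z - l%:Z)%:~R * th%:C) =
    cexp ('i%C * th%:C) ^+ k * Num.conj (cexp ('i%C * th%:C)) ^+ l.
  rewrite conj_cexp rmorphM /= conj_realc conj_complexi -!cexp_natr -cexpD intrD mulrNz.
  by congr cexp; rewrite -!pmulrn; ring.
by rewrite rmorphM !exprMn; ring.
Qed.

Lemma cintegral_haar_term0 lambda delta i j k l : 2 <= Re lambda -> k != l ->
  cintegral haar setT (haar_term lambda delta i j k l) = 0.
Proof.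
move=> l2 kl.
have mh : cmeasurable (haar_term lambda delta i j k l).
  by apply: cmeasurableM; [exact: cmeasurable_iwasawa_kernel|exact: cmeasurable_haar_term_mul].
have [|_ _ ->] := cFubini3_cauchy mh.
  move=> x y w; rewrite normcM -[leRHS]mulr1; apply: ler_pM; rewrite ?normc_ge0 ?haar_term_mul1//.
  exact: haar_kernel_bound.
have h w : cintegral (mu \x mu)%E setT (fun q => haar_term lambda delta i j k l (q, w)) = 0.
  apply: (@cintegral_angular0 R (k%:Z - l%:Z)).
  - exact: planar_haar_term.
  - by rewrite subr_eq0 eqz_nat.
  - by move=> th q; exact: haar_term_rotation.
rewrite (_ : (fun w => _) = (fun=> 0 * 0 : C)); last by apply/funext => w; rewrite h mul0r.
by rewrite (cintegralZ 0 (cintegrable0 mu)) mul0r.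
Qed.

End HaarTerm.

(** * The Iwasawa decomposition *)

Section MatrixExponential.
Context {R : realType}.
Local Notation C := R[i].
Local Notation M3 := 'M[C]_3.
Implicit Types (X A B D : M3) (u v : nat -> R).

Lemma cvg_realc u (a : R) : u @ \oo --> a -> (fun n => (u n)%:C : C^o) @ \oo --> (a%:C : C^o).
Proof.
move=> ua; apply/cvgrPdist_lt => e e0.
have [ei e1] : Im e = 0 /\ 0 < Re e by move: e0; rewrite ltcE /= => /andP[/eqP -> ->].
near=> n; rewrite -realcN -realcD /= normc_def /= expr0n addr0 sqrtr_sqr ltcE /= ei eqxx /=.
by near: n; move/cvgrPdist_lt : ua; apply.
Unshelve. all: by end_near. Qed.

(** Entrywise convergence gives convergence in the matrix topology used by [expmx]; the limit is
    then identified entry by entry, where limits are unique. *)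
Lemma expmx_cvg X (L : M3) :
  (forall i j, (fun n => (\sum_(0 <= k < n) (k`!%:R^-1 *: X ^+ k)) i j : C^o) @ \oo --> (L i j : C^o)) ->
  expmx X = L.
Proof.
move=> h.
pose S : nat -> 'M[C^o]_3 := fun n => \sum_(0 <= k < n) (k`!%:R^-1 *: X ^+ k).
have SL : S @ \oo --> (L : 'M[C^o]_3).
  move=> A [P LP PA].
  have hP : \forall n \near \oo, forall ij, P ij.1 ij.2 (S n ij.1 ij.2).
    by apply: filter_forall => -[i j]; exact: (h i j _ (LP i j)).
  change (\forall n \near \oo, A (S n)).
  by apply: filterS hP => n hn; apply: PA => i j; exact: (hn (i, j)).
have Sl : S @ \oo --> lim (S @ \oo) by apply/cvg_ex; exists L.
have ci i j : continuous (fun M : 'M[C^o]_3 => (M i j : C^o)).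
  move=> M A MA; exists (fun i' j' => if (i' == i) && (j' == j) then A else setT).
    by move=> i' j'; case: ifP => [/andP[/eqP -> /eqP ->]//|_]; exact: filterT.
  by move=> N /(_ i j); rewrite !eqxx.
apply/matrixP => i j.
have h1 := continuous_cvg _ (ci i j _) SL; have h2 := continuous_cvg _ (ci i j _) Sl.
exact: (cvg_unique (@norm_hausdorff _ _) (h2 _) (h1 _)).
Unshelve. all: by end_near. Qed.

(** The exponentials in use come from X^3 = 0, X^3 = X or X^3 = -X, so their partial sums are
    eventually combinations of two scalar series plus a constant matrix. *)
Lemma expmx_series X A B D u v (a b : R) (N : nat) :
  (forall n, (N <= n)%N -> \sum_(0 <= k < n) (k`!%:R^-1 *: X ^+ k) =
     (u n)%:C *: A + (v n)%:C *: B + D) ->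
  u @ \oo --> a -> v @ \oo --> b -> expmx X = a%:C *: A + b%:C *: B + D.
Proof.
move=> hS ua vb; apply: expmx_cvg => i j.
have h : (fun n => (u n)%:C * A i j + (v n)%:C * B i j + D i j : C^o) @ \oo -->
    (a%:C * A i j + b%:C * B i j + D i j : C^o).
  apply: cvgD; last exact: cvg_cst.
  by apply: cvgD; apply: (@cvgZr_tmp _ (C^o)); exact: cvg_realc.
rewrite !mxE; apply: cvg_trans h; apply: near_eq_cvg; near=> n.
rewrite hS ?mxE//; near: n; exact: nbhs_infty_ge.
Unshelve. all: by end_near. Qed.

Lemma expmx0 : expmx (0 : M3) = 1%:M.
Proof.
have := @expmx_series 0 0 0 1%:M (fun=> 0) (fun=> 0) 0 0 1%N.
rewrite !scaler0 !add0r; apply; [|exact: cvg_cst|exact: cvg_cst].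
case=> // n _; rewrite big_nat_recl// big1 ?addr0 ?expr0 ?fact0 ?invr1 ?scale1r//.
by move=> k _; rewrite exprS mul0r scaler0.
Qed.

Lemma expmx_nilpotent X : X ^+ 3 = 0 -> expmx X = 1%:M + X + 2^-1 *: X ^+ 2.
Proof.
move=> X3.
have := @expmx_series X 0 0 (1%:M + X + 2^-1 *: X ^+ 2) (fun=> 0) (fun=> 0) 0 0 3%N.
rewrite !scaler0 !add0r; apply; [|exact: cvg_cst|exact: cvg_cst].
case=> [|[|[|n]]]// _; rewrite 3?big_nat_recl// big1 ?addr0.
  by rewrite addrA expr0 expr1 fact0 !invr1 !scale1r.
by move=> k _; rewrite -[k.+3]addn3 exprD X3 mulr0 scaler0.
Qed.

Lemma cvg_expR (s : R) : series (exp_coeff s) @ \oo --> expR s.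
Proof. exact: is_cvg_series_exp_coeff. Qed.

Lemma cvg_cos (s : R) : series (cos_coeff s) @ \oo --> cos s.
Proof. rewrite unlock; exact: is_cvg_series_cos_coeff. Qed.

Lemma cvg_sin (s : R) : series (sin_coeff s) @ \oo --> sin s.
Proof. rewrite unlock; exact: is_cvg_series_sin_coeff. Qed.

Lemma exprS3 X (e : C) k : X ^+ 3 = e *: X ->
  X ^+ k.+1 = if odd k then e ^+ k./2 *: X ^+ 2 else e ^+ k./2 *: X.
Proof.
move=> X3; elim: k => [|k IH]; first by rewrite /= expr1 expr0 scale1r.
rewrite exprSr IH /= uphalf_half; case: (odd k) => /=.
  by rewrite -scalerAl -exprSr X3 scalerA -exprSr.
by rewrite add0n -scalerAl -expr2.
Qed.

Lemma expmx_terms X A B D u v (a b : R) :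
  (forall k, k`!%:R^-1 *: X ^+ k = (u k)%:C *: A + (v k)%:C *: B + (k == 0)%:R *: D) ->
  series u @ \oo --> a -> series v @ \oo --> b -> expmx X = a%:C *: A + b%:C *: B + D.
Proof.
move=> hk ua vb; apply: (@expmx_series _ _ _ _ (series u) (series v) _ _ 1%N) => // -[|n]// _.
under eq_bigr do rewrite hk.
rewrite !big_split /= -!scaler_suml /series /= !rmorph_sum /=; congr (_ + _).
by rewrite big_nat_recl//= big1 ?addr0 ?scale1r.
Qed.

(** (X^2 + X) / 2, (X^2 - X) / 2 and 1 - X^2 are the spectral projections of X for the eigenvalues
    1, -1 and 0. *)
Lemma expmx_hyperbolic X (s : R) : X ^+ 3 = X ->
  expmx (s%:C *: X) = (expR s)%:C *: (2^-1 *: (X ^+ 2 + X)) +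
    (expR (- s))%:C *: (2^-1 *: (X ^+ 2 - X)) + (1%:M - X ^+ 2).
Proof.
move=> X3; have t0 : (2 : C) != 0 by rewrite pnatr_eq0.
apply: (@expmx_terms _ _ _ _ (exp_coeff s) (exp_coeff (- s)));
  [|exact: cvg_expR|exact: cvg_expR].
have dbl (Y : M3) : 2^-1 *: (Y + Y) = Y.
  by rewrite scalerDr -scalerDl (_ : 2^-1 + 2^-1 = 1) ?scale1r//; field.
have hp : 2^-1 *: (X ^+ 2 + X) + 2^-1 *: (X ^+ 2 - X) = X ^+ 2.
  by rewrite -scalerDr addrACA subrr addr0 dbl.
have hm : 2^-1 *: (X ^+ 2 + X) - 2^-1 *: (X ^+ 2 - X) = X.
  by rewrite -scalerBr opprB addrC addrA subrK dbl.
case=> [|k]; rewrite /exp_coeff /=.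
  by rewrite !expr0 fact0 !divr1 invr1 !scale1r hp addrC subrK.
rewrite scale0r addr0 exprZn (@exprS3 X 1 k) ?scale1r// !expr1n !scale1r scalerA.
rewrite exprNn -signr_odd /=; case: (odd k) => /=.
  rewrite expr0 mul1r -scalerDr hp; congr (_ *: _).
  by rewrite realcM realcV realc_nat realcX mulrC.
rewrite expr1 mulN1r mulNr realcN scaleNr -scalerBr hm; congr (_ *: _).
by rewrite realcM realcV realc_nat realcX mulrC.
Qed.

Lemma expmx_elliptic X (s : R) : X ^+ 3 = - X ->
  expmx (s%:C *: X) = (cos s)%:C *: (- X ^+ 2) + (sin s)%:C *: X + (1%:M + X ^+ 2).
Proof.
move=> X3; apply: (@expmx_terms _ _ _ _ (cos_coeff s) (sin_coeff s));
  [|exact: cvg_cos|exact: cvg_sin].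
have X3' : X ^+ 3 = -1 *: X by rewrite scaleN1r.
case=> [|k]; rewrite /cos_coeff /sin_coeff /=.
  by rewrite !expr0 fact0 !invr1 mul0r !mulr1 !scale1r scale0r addr0 addrCA addNr addr0.
rewrite scale0r addr0 exprZn (@exprS3 X (-1) k X3') scalerA uphalf_half.
case: (odd k) => /=.
  rewrite !mul0r scale0r addr0 mul1r add1n scalerN -scaleNr scalerA; congr (_ *: _).
  rewrite !(realcM, realcV, realcX, realcN, realc_nat) rmorph1 !exprS.
  by move: (_^-1) => c; ring.
rewrite !mul0r scale0r add0r mul1r scalerA; congr (_ *: _).
rewrite !(realcM, realcV, realcX, realcN, realc_nat) rmorph1.
by move: (_^-1) => c; ring.
Qed.

End MatrixExponential.

(** * Explicit matrices in SU(2,1) *)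

Section Matrices3.
Context {R : realType}.
Local Notation C := R[i].
Local Notation M3 := 'M[C]_3.

Definition mx9 (a b c d e f g h i : C) : M3 :=
  mx3 [:: [:: a; b; c]; [:: d; e; f]; [:: g; h; i]].

Definition mx2 (a b c d : C) : 'M[C]_2 :=
  \matrix_(i < 2, j < 2) (nth [::] [:: [:: a; b]; [:: c; d]] i)`_j.

Lemma mx9_mul a b c d e f g h i a' b' c' d' e' f' g' h' i' :
  mx9 a b c d e f g h i *m mx9 a' b' c' d' e' f' g' h' i' =
  mx9 (a * a' + b * d' + c * g') (a * b' + b * e' + c * h') (a * c' + b * f' + c * i')
      (d * a' + e * d' + f * g') (d * b' + e * e' + f * h') (d * c' + e * f' + f * i')
      (g * a' + h * d' + i * g') (g * b' + h * e' + i * h') (g * c' + h * f' + i * i').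
Proof.
apply/matrixP => -[[|[|[|//]]] hi] [[|[|[|//]]] hj];
  by rewrite !mxE !big_ord_recl big_ord0 !mxE /= addr0 addrA.
Qed.

Lemma mx9_add a b c d e f g h i a' b' c' d' e' f' g' h' i' :
  mx9 a b c d e f g h i + mx9 a' b' c' d' e' f' g' h' i' =
  mx9 (a + a') (b + b') (c + c') (d + d') (e + e') (f + f') (g + g') (h + h') (i + i').
Proof. by apply/matrixP => -[[|[|[|//]]] hi] [[|[|[|//]]] hj]; rewrite !mxE. Qed.

Lemma mx9_opp a b c d e f g h i :
  - mx9 a b c d e f g h i = mx9 (- a) (- b) (- c) (- d) (- e) (- f) (- g) (- h) (- i).
Proof. by apply/matrixP => -[[|[|[|//]]] hi] [[|[|[|//]]] hj]; rewrite !mxE. Qed.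

Lemma mx9_scale x a b c d e f g h i :
  x *: mx9 a b c d e f g h i =
  mx9 (x * a) (x * b) (x * c) (x * d) (x * e) (x * f) (x * g) (x * h) (x * i).
Proof. by apply/matrixP => -[[|[|[|//]]] hi] [[|[|[|//]]] hj]; rewrite !mxE. Qed.

Lemma mx9_1 : 1%:M = mx9 1 0 0 0 1 0 0 0 1.
Proof. by apply/matrixP => -[[|[|[|//]]] hi] [[|[|[|//]]] hj]; rewrite !mxE. Qed.

Lemma mx9_0 : 0 = mx9 0 0 0 0 0 0 0 0 0.
Proof. by apply/matrixP => -[[|[|[|//]]] hi] [[|[|[|//]]] hj]; rewrite !mxE. Qed.

Lemma mx9_diag3 a b c : diag3 a b c = mx9 a 0 0 0 b 0 0 0 c.
Proof. by apply/matrixP => -[[|[|[|//]]] hi] [[|[|[|//]]] hj]; rewrite !mxE. Qed.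

Lemma mx9_E13 : Emx 1 3 = mx9 0 0 1 0 0 0 0 0 0.
Proof.
by apply/matrixP => -[[|[|[|//]]] hi] [[|[|[|//]]] hj]; rewrite !mxE -!val_eqE /= !inordK.
Qed.

Lemma mx9_E31 : Emx 3 1 = mx9 0 0 0 0 0 0 1 0 0.
Proof.
by apply/matrixP => -[[|[|[|//]]] hi] [[|[|[|//]]] hj]; rewrite !mxE -!val_eqE /= !inordK.
Qed.

Lemma mx9_block a b c d e :
  block_mx (mx2 a b c d) 0 0 e%:M = mx9 a b 0 c d 0 0 0 e :> 'M[C]_(2 + 1).
Proof.
apply/matrixP => i j; rewrite !mxE.
case: splitP => i' ei; rewrite !mxE; case: splitP => j' ej; rewrite !mxE ei ej.
- by case: i' {ei} => -[|[|//]] hi; case: j' {ej} => -[|[|//]] hj.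
- by case: i' {ei} => -[|[|//]] hi; case: j' {ej} => -[|//] hj.
- by case: i' {ei} => -[|//] hi; case: j' {ej} => -[|[|//]] hj.
- by case: i' {ei} => -[|//] hi; case: j' {ej} => -[|//] hj.
Qed.

Lemma mx2_mul a b c d a' b' c' d' : mx2 a b c d *m mx2 a' b' c' d' =
  mx2 (a * a' + b * c') (a * b' + b * d') (c * a' + d * c') (c * b' + d * d').
Proof.
by apply/matrixP => -[[|[|//]] hi] [[|[|//]] hj];
  rewrite !mxE !big_ord_recl big_ord0 !mxE /= addr0.
Qed.

Lemma mx2_1 : 1%:M = mx2 1 0 0 1.
Proof. by apply/matrixP => -[[|[|//]] hi] [[|[|//]] hj]; rewrite !mxE. Qed.

Lemma mx2_adj a b c d : adjmx (mx2 a b c d) =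
  mx2 (Num.conj a) (Num.conj c) (Num.conj b) (Num.conj d).
Proof. by apply/matrixP => -[[|[|//]] hi] [[|[|//]] hj]; rewrite !mxE. Qed.

Lemma mx2_det a b c d : \det (mx2 a b c d) = a * d - b * c.
Proof.
rewrite (expand_det_row _ ord0) !big_ord_recl big_ord0 /cofactor !det_mx11 !mxE /=.
by rewrite addr0 !mul1r expr1 mulN1r mulrN.
Qed.

Lemma invmx_eq n (A B : 'M[C]_n) : A *m B = 1%:M -> invmx A = B.
Proof.
move=> AB; have [uA _] := mulmx1_unit AB.
by rewrite -[RHS]mul1mx -(mulVmx uA) -mulmxA AB mulmx1.
Qed.

Lemma a_E (s : R) : let ch := ((expR s + expR (- s)) / 2)%:C in
  let sh := ((expR s - expR (- s)) / 2)%:C in a_ s = mx9 ch 0 sh 0 1 0 sh 0 ch.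
Proof.
move=> ch sh; rewrite /a_ mx9_E13 mx9_E31 mx9_add; set X := mx9 _ _ _ _ _ _ _ _ _.
have X2 : X ^+ 2 = mx9 1 0 0 0 0 0 0 0 1.
  by rewrite expr2 -[X * X]/(X *m X) mx9_mul; congr mx9; ring.
have X3 : X ^+ 3 = X.
  by rewrite exprS X2 -[X * _]/(X *m _) mx9_mul; congr mx9; ring.
rewrite expmx_hyperbolic// X2 mx9_1 !(mx9_add, mx9_opp, mx9_scale).
by congr mx9; rewrite /ch /sh ?(realcM, realcD, realcN, realcV, realc_nat); field.
Qed.

Lemma m_0 : m_ 0 = 1%:M :> M3.
Proof. by rewrite /m_ oppr0 scale0r expmx0. Qed.

Lemma sqrt2_cos_pi4 : Num.sqrt 2 * cos (pi / 4) = 1 :> R.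
Proof.
have p0 : (0 : R) < pi by exact: pi_gt0.
have c0 : 0 < cos (pi / 4 : R) by apply: cos_gt0_pihalf; lra.
have : (Num.sqrt 2 * cos (pi / 4)) ^+ 2 = 1 :> R.
  rewrite exprMn sqr_sqrtr//; have : cos (pi / 2 : R) = 0 by exact: cos_pihalf.
  have -> : (pi / 2 : R) = pi / 4 + pi / 4 by field.
  rewrite cosD -!expr2 => /subr0_eq h; have := cos2Dsin2 (pi / 4 : R); lra.
move/eqP; rewrite sqrf_eq1 => /orP[/eqP//|/eqP h].
have : 0 < Num.sqrt 2 * cos (pi / 4 : R) by rewrite mulr_gt0// sqrtr_gt0.
by rewrite h; lra.
Qed.

Lemma sin_pi4 : sin (pi / 4) = cos (pi / 4) :> R.
Proof.
by rewrite -cosBpihalf (_ : pi / 4 - pi / 2 = - (pi / 4)) ?cosN//; field.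
Qed.

(** The conjugate of z and the number u are independent letters here, so that the Iwasawa identities
    become purely algebraic. *)
Definition nbar_mx (z zc u : C) : M3 :=
  mx9 (1 - u / 2) (- zc) (- (u / 2)) z 1 z (u / 2) zc (1 + u / 2).

Lemma nbarE (z : C) (w : R) :
  nbar z w = nbar_mx z (Num.conj z) (`|z| ^+ 2 - 2 * 'i * w%:C).
Proof.
rewrite /nbar; set u := `|z| ^+ 2 - _; set t := (Num.sqrt 2)%:C; set zc := Num.conj z.
pose h : C := (cos (pi / 4))%:C.
have th : t * h = 1 by rewrite -realcM sqrt2_cos_pi4.
have tt : t * t = 2 by rewrite -realcM -expr2 sqr_sqrtr ?realc_nat.
have t0 : t != 0 by apply/eqP => t0; move/eqP: th; rewrite t0 mul0r eq_sym oner_eq0.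
have hE : h = t / 2 by apply: (mulfI t0); rewrite th mulrA tt divff// pnatr_eq0.
have cE : c_ = mx9 h 0 (- h) 0 1 0 h 0 h.
  rewrite /c_ mx9_E13 mx9_E31 mx9_opp mx9_add; set X := mx9 _ _ _ _ _ _ _ _ _.
  have X2 : X ^+ 2 = mx9 (-1) 0 0 0 0 0 0 0 (-1).
    by rewrite expr2 -[X * X]/(X *m X) mx9_mul; congr mx9; ring.
  have X3 : X ^+ 3 = - X.
    by rewrite exprS X2 -[X * _]/(X *m _) mx9_mul mx9_opp; congr mx9; ring.
  rewrite expmx_elliptic// X2 sin_pi4 -/h mx9_1 !(mx9_add, mx9_opp, mx9_scale).
  by congr mx9; ring.
have -> : invmx c_ = mx9 h 0 h 0 1 0 (- h) 0 h.
  apply: invmx_eq; rewrite cE mx9_mul mx9_1; congr mx9; rewrite ?hE; try ring.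
    by transitivity (t * t / 2); [field|rewrite tt divff// pnatr_eq0].
  by transitivity (t * t / 2); [field|rewrite tt divff// pnatr_eq0].
rewrite cE -[mx3 _]/(mx9 _ _ _ _ _ _ _ _ _) !mx9_mul /nbar_mx hE.
have e (x : C) : t * t / 2 * x = x by rewrite tt divff ?mul1r// pnatr_eq0.
congr mx9.
- by rewrite -[RHS]e; field.
- by rewrite -[RHS]e; field.
- by rewrite -[RHS]e; field.
- by rewrite -[RHS]e; field.
- by ring.
- by rewrite -[RHS]e; field.
- by rewrite -[RHS]e; field.
- by rewrite -[RHS]e; field.
- by rewrite -[RHS]e; field.
Qed.

Lemma Ngrp_expmx (X : M3) : lie_n X -> Ngrp (expmx X).
Proof. by move=> lX H [_ HX]; apply: HX; exists X. Qed.

Lemma expmx_lie_n (z : C) (w : R) : let q := 'i * w%:C - z * Num.conj z / 2 in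
  expmx (mx9 ('i * w%:C) z (- ('i * w%:C)) (- Num.conj z) 0 (Num.conj z)
             ('i * w%:C) z (- ('i * w%:C))) =
  mx9 (1 + q) z (- q) (- Num.conj z) 1 (Num.conj z) q z (1 - q).
Proof.
move=> q; set X := mx9 _ _ _ _ _ _ _ _ _.
have X2 : X ^+ 2 = mx9 (- (z * Num.conj z)) 0 (z * Num.conj z) 0 0 0 (- (z * Num.conj z)) 0 (z * Num.conj z).
  by rewrite expr2 -[X * X]/(X *m X) mx9_mul; congr mx9; ring.
have X3 : X ^+ 3 = 0.
  by rewrite exprS X2 -[X * _]/(X *m _) mx9_mul mx9_0; congr mx9; ring.
rewrite expmx_nilpotent// X2 mx9_1 !(mx9_add, mx9_scale).
by congr mx9; rewrite /q; ring.
Qed.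

Lemma mul_block (A B : 'M[C]_2) (d e : C) :
  (block_mx A 0 0 d%:M : 'M[C]_(2 + 1)) *m (block_mx B 0 0 e%:M : 'M[C]_(2 + 1)) =
  block_mx (A *m B) 0 0 (d * e)%:M.
Proof. by rewrite mulmx_block !(mulmx0, mul0mx, addr0, add0r) -scalar_mxM. Qed.

Lemma conjM (x y : C) : Num.conj (x * y) = Num.conj x * Num.conj y.
Proof. exact: rmorphM. Qed.

Lemma conjN (x : C) : Num.conj (- x) = - Num.conj x.
Proof. exact: rmorphN. Qed.

Lemma w0_block : w0 = block_mx (- 1%:M) 0 0 1%:M :> 'M[C]_(2 + 1).
Proof.
rewrite /w0 mx9_diag3 -mx9_block; congr block_mx.
by apply/matrixP => -[[|[|//]] hi] [[|[|//]] hj]; rewrite !mxE ?oppr0.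
Qed.

Lemma det_unitary (A : 'M[C]_2) : U2 A -> Num.conj (\det A) * \det A = 1.
Proof.
move=> hA; have := congr1 determinant hA; rewrite det_mulmx det1.
by rewrite /adjmx det_map_mx det_tr.
Qed.

Lemma Kgrp_mul (k k' : M3) : Kgrp k -> Kgrp k' -> Kgrp (k *m k').
Proof.
move=> [A hA ->] [B hB ->]; exists (A *m B).
  rewrite /U2 /= /adjmx trmx_mul map_mxM -mulmxA (mulmxA _ A B).
  by rewrite -[map_mx _ A^T]/(adjmx A) hA mul1mx.
by rewrite mul_block det_mulmx invfM.
Qed.

Lemma Kgrp_w0 : Kgrp (w0 : M3).
Proof.
exists (- 1%:M).
  rewrite /U2 /= /adjmx; apply/matrixP => -[[|[|//]] hi] [[|[|//]] hj];
  by rewrite !mxE !big_ord_recl big_ord0 !mxE /= ?(rmorphN, rmorph1, rmorph0, oppr0); ring.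
by rewrite w0_block -scaleN1r detZ det1 mulr1 sqrrN expr1n invr1.
Qed.

Lemma adjmx_block (A : 'M[C]_2) (d : C) :
  adjmx (block_mx A 0 0 d%:M : 'M[C]_(2 + 1)) = block_mx (adjmx A) 0 0 (Num.conj d)%:M.
Proof.
by rewrite /adjmx tr_block_mx map_block_mx !trmx0 !map_mx0 tr_scalar_mx map_scalar_mx.
Qed.

Lemma Kgrp_SU21 (k : M3) : Kgrp k -> SU21 k.
Proof.
move=> [A hA ->]; have dA := det_unitary hA.
have d0 : \det A != 0 by apply/eqP => d0; move/eqP: dA; rewrite d0 mulr0 eq_sym oner_eq0.
split; first by rewrite (det_ublock A 0 (_)%:M) det_scalar1 divff.
have -> : Jmx = block_mx 1%:M 0 0 (-1)%:M :> 'M[C]_(2 + 1).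
  rewrite /Jmx mx9_diag3 -mx9_block; congr block_mx.
  by apply/matrixP => -[[|[|//]] hi] [[|[|//]] hj]; rewrite !mxE.
have e : Num.conj (\det A)^-1 * (-1) / \det A = -1.
  by rewrite mulrN1 mulNr fmorphV -invfM dA invr1.
by rewrite adjmx_block !mul_block mulmx1 hA e.
Qed.

End Matrices3.

Section Iwasawa.
Context {R : realType}.
Local Notation C := R[i].
Local Notation M3 := 'M[C]_3.
Implicit Types p : R * R * R.

Definition iwasawa_phase p : C := cexp ('i%C * (iwasawa_arg (sqnorm p.1) p.2)%:C).

Definition kappa_alpha p : C := cayley p * Num.conj (iwasawa_phase p).

(* The K-component of nbar z w in G = K A_0 N; it is read off the image under
   nbar z w of the vector (1, 0, 1), which N fixes. *)
Definition kappa_mx p : 'M[C]_2 :=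
  mx2 (kappa_alpha p) (- (iwasawa_phase p * Num.conj (horo p)))
      (horo p) (iwasawa_phase p * Num.conj (kappa_alpha p)).

Definition kappa p : M3 :=
  block_mx (kappa_mx p) 0 0 ((iwasawa_phase p)^-1)%:M : 'M[C]_(2 + 1).

Lemma iwasawa_phase_conj p : iwasawa_phase p * Num.conj (iwasawa_phase p) = 1.
Proof.
rewrite /iwasawa_phase conj_cexp rmorphM /= conj_realc conj_complexi -cexpD.
by rewrite mulNr subrr cexp0.
Qed.

Lemma det_kappa p : \det (kappa_mx p) = iwasawa_phase p.
Proof.
have h := iwasawa_phase_conj p; have := horo_conj p; rewrite -cayley_conjE.
rewrite mx2_det /kappa_alpha; move: h.
move: (iwasawa_phase p) (cayley p) (horo p) => d a b dd bb.
rewrite conjM conjCK; move: (Num.conj d) (Num.conj a) (Num.conj b) dd bb => dc ac bc dd bb.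
have -> : a * dc * (d * (ac * d)) - - (d * bc) * b = (d * dc) * d * (a * ac) + d * (b * bc) by ring.
by rewrite dd bb; ring.
Qed.

Lemma kappa_unitary p : U2 (kappa_mx p).
Proof.
have h := iwasawa_phase_conj p; have := horo_conj p; rewrite -cayley_conjE.
rewrite /U2 /= mx2_adj mx2_mul mx2_1 /kappa_alpha; move: h.
move: (iwasawa_phase p) (cayley p) (horo p) => d a b dd bb.
rewrite !(conjN, conjM, conjCK).
move: (Num.conj d) (Num.conj a) (Num.conj b) dd bb => dc ac bc dd bb; congr mx2.
- transitivity ((d * dc) * (a * ac) + b * bc); first by ring.
  by rewrite dd bb; ring.
- by ring.
- by ring.
- transitivity ((d * dc) * (b * bc) + (d * dc) * (d * dc) * (a * ac)); first by ring.
  by rewrite dd bb; ring.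
Qed.

Lemma Kgrp_kappa p : Kgrp (kappa p).
Proof. by exists (kappa_mx p); [exact: kappa_unitary|rewrite det_kappa]. Qed.

(** Read d = e^(i theta) and e = e^(-s), so that d e = 1/(1 + u); the hypothesis on z zc then says
    Re(1 + u) = 1 + |z|^2. Each entry is an identity of rational functions modulo this relation. *)
Lemma iwasawa_entries (d e z zc : C) : d != 0 -> e != 0 ->
  z * zc = (d + d^-1) / e / 2 - 1 ->
  let u := (d * e)^-1 - 1 in
  let ch := (e^-1 + e) / 2 in let sh := (e^-1 - e) / 2 in
  let q := (e * e - d * e) / 2 in
  nbar_mx z zc u =
  mx9 (2 * e - d^-1) (- (d * (2 * zc * e))) 0 (2 * z * e) (d * (2 * e - d)) 0 0 0 d^-1
  *m mx9 ch 0 sh 0 1 0 sh 0 ch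
  *m mx9 (1 + q) (d * e * zc) (- q) (- (d^-1 * e * z)) 1 (d^-1 * e * z) q (d * e * zc) (1 - q).
Proof.
move=> d0 e0 h u ch sh q; rewrite !mx9_mul /nbar_mx.
(* Here [c] is the cofactor exhibiting x - y as a multiple of the relation. *)
have key (x y c : C) : x - y = c * (z * zc - ((d + d^-1) / e / 2 - 1)) -> x = y.
  by rewrite h subrr mulr0 => /subr0_eq.
congr mx9; rewrite /u /ch /sh /q.
- by apply: (key _ _ (- 2 * e * e)); field; rewrite d0 e0.
- by field; rewrite d0 e0.
- by apply: (key _ _ (2 * e * e)); field; rewrite d0 e0.
- by field; rewrite d0 e0.
- by apply: (key _ _ (- 2 * d * e)); field; rewrite d0 e0.
- by field; rewrite d0 e0.
- by field; rewrite d0 e0.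
- by field; rewrite d0 e0.
- by field; rewrite d0 e0.
Qed.

Lemma iwasawa_decomposition p : exists2 n, Ngrp n &
  nbar (p.1.1 +i* p.1.2) p.2 = kappa p *m a_ (iwasawa_log (sqnorm p.1) p.2) *m n.
Proof.
set s := iwasawa_log _ _; set z : C := _ +i* _.
pose d := iwasawa_phase p; pose e : C := (expR (- s))%:C.
have dd : d * Num.conj d = 1 := iwasawa_phase_conj p.
have d0 : d != 0 by apply/eqP => d0; move/eqP: dd; rewrite d0 mul0r eq_sym oner_eq0.
have e0 : e != 0 by rewrite /e (inj_eq (@complexI _)) gt_eqF// expR_gt0.
have dc : Num.conj d = d^-1 by apply: (mulfI d0); rewrite dd divff.
have EE : haar_kernel (-1) 1 p = d * e.
  rewrite /haar_kernel /iwasawa_kernel /d /iwasawa_phase /e -cexpR -cexpD.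
  by congr cexp; rewrite realcN -/s; ring.
have EEc : haar_kernel (-1) (-1) p = d^-1 * e.
  have -> : d^-1 * e = Num.conj (d * e) by rewrite conjM dc conj_realc.
  by rewrite -EE haar_kernel_conj rmorphN1.
have hu := haar_kernel_inv p; have huc := haar_kernel_inv_conj p.
rewrite EE in hu; rewrite EEc in huc.
have zz : z * Num.conj z = (sqnorm p.1)%:C by exact: mul_conj_pair.
have hz : z * Num.conj z = (d + d^-1) / e / 2 - 1.
  have -> : d + d^-1 = d * (d^-1 * e * (1 + (sqnorm p.1)%:C + 2 * 'i%C * p.2%:C)) +
     d^-1 * (d * e * (1 + (sqnorm p.1)%:C - 2 * 'i%C * p.2%:C)) by rewrite hu huc !mulr1.
  by rewrite zz; field; rewrite d0 e0.
have uE : `|z| ^+ 2 - 2 * 'i * p.2%:C = (d * e)^-1 - 1.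
  rewrite normCK zz -complexiE; apply: (mulfI (mulf_neq0 d0 e0)).
  have -> : d * e * ((d * e)^-1 - 1) = 1 - d * e by field; rewrite d0 e0.
  by rewrite -[in RHS]hu; ring.
(* The N-component is the exponential of the element of the Lie algebra with parameters z' = d e
   conj(z) and w = - Im(d e) / 2; accordingly q = i w - |z'|^2 / 2. *)
pose q := (e * e - d * e) / 2; pose w : R := - (Im (d * e) / 2).
exists (mx9 (1 + q) (d * e * Num.conj z) (- q) (- (d^-1 * e * z)) 1 (d^-1 * e * z) q
   (d * e * Num.conj z) (1 - q)).
  have cz : Num.conj (d * e * Num.conj z) = d^-1 * e * z.
    by rewrite 2!conjM conjCK dc conj_realc.
  have <- : 'i * w%:C - (d * e * Num.conj z) * Num.conj (d * e * Num.conj z) / 2 = q.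
    have -> : 'i * w%:C = - (d * e - d^-1 * e) / 4.
      have <- : Num.conj (d * e) = d^-1 * e by rewrite conjM dc conj_realc.
      rewrite /w; case: (d * e) => x y.
      have -> : x +i* y - Num.conj (x +i* y) = 2 * 'i%C * y%:C.
        by apply: complex_eqP; rewrite !(cReM, cImM) /=; ring.
      by rewrite -complexiE realcN realcM realcV realc_nat /=; field.
    rewrite cz; have -> : d * e * Num.conj z * (d^-1 * e * z) = e * e * (z * Num.conj z) by field.
    by rewrite hz /q; field; rewrite d0 e0.
  rewrite -cz -expmx_lie_n; apply: Ngrp_expmx.
  by exists (d * e * Num.conj z), w.
rewrite nbarE uE (iwasawa_entries d0 e0 hz) /kappa mx9_block a_E.
have hs : (expR s)%:C = e^-1 :> C by rewrite /e expRN realcV invrK.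
have ha : kappa_alpha p = 2 * e - d^-1.
  by rewrite /kappa_alpha /cayley EE -/d dc; field.
have hac : Num.conj (kappa_alpha p) = 2 * e - d.
  have dci : Num.conj (d^-1) = d by rewrite -dc conjCK.
  have cB (x y : C) : Num.conj (x - y) = Num.conj x - Num.conj y by exact: rmorphB.
  by rewrite ha cB dci conjM conj_realc rmorph_nat.
have hbc : Num.conj (horo p) = 2 * Num.conj z * e.
  by rewrite /horo -/z -/s -/e 2!conjM conj_realc rmorph_nat.
rewrite hac ha hbc -/d -[horo p]/(2 * z * e).
by congr (_ *m _ *m _); congr mx9; rewrite !(realcM, realcD, realcN, realcV, realc_nat) -/e ?hs.
Qed.

Lemma principal_series_nbar (delta : int) (lambda : C) f k p :
  principal_series delta lambda f -> Kgrp k ->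
  f (k *m w0 *m nbar (p.1.1 +i* p.1.2) p.2) =
  cexp (- (lambda + 2) * (iwasawa_log (sqnorm p.1) p.2)%:C) * f (k *m w0 *m kappa p).
Proof.
move=> [_ _ hf] Kk; have [n Nn ->] := iwasawa_decomposition p.
have Sk : SU21 (k *m w0 *m kappa p).
  apply: Kgrp_SU21; apply: Kgrp_mul; last exact: Kgrp_kappa.
  by apply: Kgrp_mul => //; exact: Kgrp_w0.
have := hf _ 0 (iwasawa_log (sqnorm p.1) p.2) n Sk Nn.
by rewrite m_0 mulmx1 !mulmxA mulr0 oppr0 add0r mulNr.
Qed.

End Iwasawa.

(** * Matrix coefficients of U(2) *)

Section WignerProduct.
Context {R : realType}.
Local Notation C := R[i].
Local Notation M3 := 'M[C]_3.
Local Notation polyz := (mpoly 2 C).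
Implicit Types (A B : 'M[C]_2) (x y : polyz).

Lemma subst_linM A x y : subst_lin A (x * y) = subst_lin A x * subst_lin A y.
Proof. exact: rmorphM. Qed.

Lemma subst_linX A x n : subst_lin A (x ^+ n) = subst_lin A x ^+ n.
Proof. exact: rmorphXn. Qed.

Lemma subst_linD A x y : subst_lin A (x + y) = subst_lin A x + subst_lin A y.
Proof. exact: raddfD. Qed.

Lemma subst_linZ A (c : C) x : subst_lin A (c *: x) = c *: subst_lin A x.
Proof. exact: comp_mpolyZ. Qed.

Lemma subst_lin_sum A (I : Type) (s : seq I) (P : pred I) (F : I -> polyz) :
  subst_lin A (\sum_(i <- s | P i) F i) = \sum_(i <- s | P i) subst_lin A (F i).
Proof. exact: raddf_sum. Qed.

Lemma subst_lin_z1 A : subst_lin A z1 = A 0 0 *: z1 + A 0 1 *: z2.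
Proof. by rewrite /subst_lin /comp_mpoly mmapX mmap1U tnth_mktuple. Qed.

Lemma subst_lin_z2 A : subst_lin A z2 = A 1 0 *: z1 + A 1 1 *: z2.
Proof. by rewrite /subst_lin /comp_mpoly mmapX mmap1U tnth_mktuple. Qed.

Lemma mulmx2E A B i j : (B *m A) i j = B i 0 * A 0 j + B i 1 * A 1 j.
Proof.
rewrite mxE !big_ord_recl big_ord0 addr0.
by have -> : lift ord0 ord0 = 1 :> 'I_2 by exact: val_inj.
Qed.

Lemma subst_lin_comp A B a b :
  subst_lin (B *m A) (z1 ^+ a * z2 ^+ b) = subst_lin A (subst_lin B (z1 ^+ a * z2 ^+ b)).
Proof.
have h1 : subst_lin (B *m A) z1 = subst_lin A (subst_lin B z1).
  rewrite !subst_lin_z1 subst_linD !subst_linZ subst_lin_z1 subst_lin_z2 !mulmx2E.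
  by rewrite !scalerDl !scalerDr !scalerA addrACA.
have h2 : subst_lin (B *m A) z2 = subst_lin A (subst_lin B z2).
  rewrite !subst_lin_z2 subst_linD !subst_linZ subst_lin_z1 subst_lin_z2 !mulmx2E.
  by rewrite !scalerDl !scalerDr !scalerA addrACA.
by rewrite !subst_linM !subst_linX h1 h2.
Qed.

Lemma innerZr x (c : C) y : inner x (c *: y) = Num.conj c * inner x y.
Proof.
rewrite /inner mulr_sumr; apply: eq_bigr => u _.
by rewrite mcoeffZ conjM [RHS]mulrCA.
Qed.

Lemma inner_sumr x (I : Type) (s : seq I) (P : pred I) (F : I -> polyz) :
  inner x (\sum_(i <- s | P i) F i) = \sum_(i <- s | P i) inner x (F i).
Proof.
rewrite /inner exchange_big; apply: eq_bigr => u _ /=.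
by rewrite raddf_sum rmorph_sum mulr_sumr.
Qed.

(** Unnormalized monomials replace the vectors [vbasis_ j m2], so that a translate expands with
    plain binomial coefficients and without square roots. *)
Definition wigner_col (N0 : int) (j m1 : rat) (N i : nat) (A : 'M[C]_2) : C :=
  inner (vbasis_ j m1) (\det A ^ N0 *: subst_lin (invmx A) (z1 ^+ (N - i) * z2 ^+ i)).

Definition wigner_norm (a b : nat) : C := (Num.sqrt (a`! * b`!)%:R : R)%:C^-1.

Lemma conj_wigner_norm a b : Num.conj (wigner_norm a b) = wigner_norm a b.
Proof. by rewrite /wigner_norm -realcV conj_realc. Qed.

Lemma wigner_col_E j n m1 m2 (k : M3) :
  let a := Num.truncn (j - m2) in let b := Num.truncn (j + m2) in
  wigner j n m1 m2 k = wigner_norm a b *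
    wigner_col (Num.floor (j + n)) j m1 (a + b) b (toU2 k).
Proof.
move=> a b; rewrite /wigner /pi_ /wigner_col /vbasis_ -/a -/b subst_linZ addnK.
have sc (c c' : C) x : c *: (c' *: x) = c' *: (c *: x) by rewrite !scalerA mulrC.
by rewrite (sc (\det (toU2 k) ^ _)) innerZr -/(wigner_norm a b) conj_wigner_norm.
Qed.

Lemma monomial_scale (c c' : C) s n m :
  (c *: z1) ^+ n * (c' *: z2) ^+ m *+ s = (s%:R * (c ^+ n * c' ^+ m)) *: (z1 ^+ n * z2 ^+ m : polyz).
Proof. by rewrite !exprZn -scalerAl -scalerAr scalerA -scaler_nat scalerA. Qed.

Lemma scale_mul (c c' : C) x y : (c *: x) * (c' *: y) = (c * c') *: (x * y).
Proof. by rewrite -scalerAl -scalerAr scalerA. Qed.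

Lemma subst_lin_expand A a b : subst_lin A (z1 ^+ a * z2 ^+ b) =
  \sum_(i < a.+1) \sum_(l < b.+1)
    (('C(a, i) * 'C(b, l))%:R * (A 0 0 ^+ (a - i) * A 0 1 ^+ i * (A 1 0 ^+ (b - l) * A 1 1 ^+ l)))
     *: (z1 ^+ (a + b - (i + l)) * z2 ^+ (i + l)).
Proof.
rewrite subst_linM !subst_linX subst_lin_z1 subst_lin_z2 !exprDn mulr_suml.
apply: eq_bigr => i _; rewrite mulr_sumr; apply: eq_bigr => l _.
have -> : (a + b - (i + l) = (a - i) + (b - l))%N.
  by have := ltn_ord i; have := ltn_ord l; lia.
rewrite !monomial_scale scale_mul !exprD natrM mulrACA [in RHS]mulrACA.
by congr (_ *: _); rewrite mulrACA.
Qed.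

Lemma kappa_inv (al be d : C) : d != 0 -> al * Num.conj al + be * Num.conj be = 1 ->
  mx2 al (- (d * Num.conj be)) be (d * Num.conj al) *m
  mx2 (Num.conj al) (Num.conj be) (- (be / d)) (al / d) = 1%:M.
Proof.
move=> d0 h; rewrite mx2_mul mx2_1; congr mx2.
- by rewrite -h; field.
- by field.
- by field.
- by rewrite -h; field.
Qed.

End WignerProduct.

(** * Translates of Wigner functions and their integrals *)

Section WignerIntegral.
Context {R : realType}.
Local Notation C := R[i].
Local Notation M3 := 'M[C]_3.
Local Notation mu := (@lebesgue_measure R).
Local Notation haar := ((mu \x mu) \x mu)%E.
Implicit Types (A K : 'M[C]_2) (p : R * R * R) (a b i l : nat).

(** Binomial expansion of the substitution by the inverse of K, followed by the substitution by the
    inverse of A. The coefficients appear conjugated because [inner] is conjugate linear in its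
    second argument. *)
Lemma wigner_col_mul (N0 : int) j m1 a b A K Ki : A \in unitmx -> K *m Ki = 1%:M ->
  wigner_col N0 j m1 (a + b) b (A *m K) =
  \sum_(i < a.+1) \sum_(l < b.+1) Num.conj (\det K ^ N0 *
    (('C(a, i) * 'C(b, l))%:R * (Ki 0 0 ^+ (a - i) * Ki 0 1 ^+ i * (Ki 1 0 ^+ (b - l) * Ki 1 1 ^+ l)))) *
    wigner_col N0 j m1 (a + b) (i + l) A.
Proof.
move=> uA KKi.
rewrite /wigner_col addnK (@invmx_eq _ _ (A *m K) (Ki *m invmx A)); last first.
  by rewrite -mulmxA (mulmxA K) KKi mul1mx mulmxV.
rewrite subst_lin_comp subst_lin_expand det_mulmx expfzMl subst_lin_sum scaler_sumr inner_sumr.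
apply: eq_bigr => i _; rewrite subst_lin_sum scaler_sumr inner_sumr; apply: eq_bigr => l _.
by rewrite subst_linZ -innerZr !scalerA; congr (inner _ (_ *: _)); rewrite [RHS]mulrC [RHS]mulrA.
Qed.

Lemma iwasawa_phase_neq0 p : iwasawa_phase p != 0.
Proof. exact: cexp_neq0. Qed.

Lemma iwasawa_phase_conjV p : Num.conj (iwasawa_phase p) = (iwasawa_phase p)^-1.
Proof.
apply: (mulfI (iwasawa_phase_neq0 p)).
by rewrite iwasawa_phase_conj divff ?iwasawa_phase_neq0.
Qed.

Lemma cexp_intr (z : C) (e : int) : cexp (e%:~R * z) = cexp z ^ e.
Proof.
case: e => n; first by rewrite -pmulrn cexp_natr.
by rewrite NegzE mulrNz mulNr cexpN -pmulrn cexp_natr.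
Qed.

Lemma haar_kernel_phase lambda (e : int) p : haar_kernel lambda e p =
  cexp (- (lambda + 2) * (iwasawa_log (sqnorm p.1) p.2)%:C) * iwasawa_phase p ^ e.
Proof.
by rewrite /haar_kernel /iwasawa_kernel /iwasawa_phase -cexp_intr -cexpD; congr cexp; ring.
Qed.

(** The exponent of the phase e^(i theta) in the (i, l) term of the expansion; the determinant
    contributes [- N0]. *)
Definition term_weight (N0 : int) a b i l : int := (b - l + (l + l))%:Z - (a - i)%:Z - N0.

Lemma conj_expz (z : C) (e : int) : Num.conj (z ^ e) = Num.conj z ^ e.
Proof. exact: fmorphXz. Qed.

Lemma conj_expr (z : C) n : Num.conj (z ^+ n) = Num.conj z ^+ n.
Proof. exact: rmorphXn. Qed.

Lemma wigner_col_term (N0 : int) a b i l (d Z Y be bc : C) : d != 0 ->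
  Num.conj d = d^-1 -> Num.conj Z = Y -> Num.conj be = bc ->
  Num.conj (d ^ N0 * (('C(a, i) * 'C(b, l))%:R *
    ((- Num.conj (Z * d^-1)) ^+ (a - i) * (- bc) ^+ i *
     ((be / d) ^+ (b - l) * (- (Z * d^-1 / d)) ^+ l)))) =
  (('C(a, i) * 'C(b, l))%:R * ((-1) ^+ (a - i) * (-1) ^+ i * (-1) ^+ l)) *
  (d ^ term_weight N0 a b i l * (Z ^+ (a - i) * Y ^+ l * (be ^+ i * bc ^+ (b - l)))).
Proof.
move=> d0 dc ZY bb.
have cV : Num.conj (d^-1) = d by rewrite -dc conjCK.
have bb' : Num.conj bc = be by rewrite -bb conjCK.
have c1 : Num.conj (- Num.conj (Z * d^-1)) = - (Z * d^-1) by rewrite conjN conjCK.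
have c2 : Num.conj (- bc) = - be by rewrite conjN bb'.
have c3 : Num.conj (be / d) = bc * d by rewrite conjM bb cV.
have c4 : Num.conj (- (Z * d^-1 / d)) = - (Y * d * d) by rewrite conjN 2!conjM ZY cV.
move: (- Num.conj _) (- bc) (be / d) (- (Z * d^-1 / d)) c1 c2 c3 c4 => x1 x2 x3 x4 c1 c2 c3 c4.
rewrite !conjM !conj_expr conj_expz rmorph_nat c1 c2 c3 c4 dc.
rewrite /term_weight !expfzDr// -exprnN exprz_inv.
rewrite -[d ^ (b - l + (l + l))%:Z]/(d ^+ (b - l + (l + l))).
rewrite -[- (Z * _)]mulN1r -[- be]mulN1r -[- (Y * d * d)]mulN1r !exprMn !exprD exprVn.
by move: (_%:R) (d ^ (- N0)) (d ^+ (a - i))^-1 => u v w; ring.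
Qed.

Lemma wigner_kernel lambda (N0 : int) j m1 a b A p : A \in unitmx ->
  cexp (- (lambda + 2) * (iwasawa_log (sqnorm p.1) p.2)%:C) *
    wigner_col N0 j m1 (a + b) b (A *m - kappa_mx p) =
  \sum_(i < a.+1) \sum_(l < b.+1)
   ((('C(a, i) * 'C(b, l))%:R * ((-1) ^+ (a - i) * (-1) ^+ i * (-1) ^+ l)) *
    wigner_col N0 j m1 (a + b) (i + l) A) *
   haar_term lambda (term_weight N0 a b i l) (a - i) l i (b - l) p.
Proof.
move=> uA; have d0 := iwasawa_phase_neq0 p.
have hk : kappa_alpha p * Num.conj (kappa_alpha p) + horo p * Num.conj (horo p) = 1.
  rewrite horo_conj -cayley_conjE /kappa_alpha conjM conjCK mulrACA.
  by rewrite [Num.conj _ * _]mulrC iwasawa_phase_conj mulr1 addrC subrK.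
have hK := kappa_inv d0 hk; rewrite -/(kappa_mx p) in hK.
have hN : (- kappa_mx p) *m - mx2 (Num.conj (kappa_alpha p)) (Num.conj (horo p))
   (- (horo p / iwasawa_phase p)) (kappa_alpha p / iwasawa_phase p) = 1%:M.
  by rewrite mulNmx mulmxN opprK.
rewrite (wigner_col_mul N0 j m1 a b uA hN) mulr_sumr; apply: eq_bigr => i _.
rewrite mulr_sumr; apply: eq_bigr => l _.
have -> : \det (- kappa_mx p) = iwasawa_phase p.
  by rewrite -scaleN1r detZ sqrrN expr1n mul1r det_kappa.
rewrite !mxE /= opprK /haar_term haar_kernel_phase.
rewrite [X in Num.conj (_ * (_ * (X ^+ _ * _ * _)))](_ : _ = - Num.conj (cayley p * (iwasawa_phase p)^-1)); last first.
  by rewrite /kappa_alpha iwasawa_phase_conjV.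
rewrite [kappa_alpha p](_ : _ = cayley p * (iwasawa_phase p)^-1); last first.
  by rewrite /kappa_alpha iwasawa_phase_conjV.
rewrite (wigner_col_term _ _ _ _ _ d0 (iwasawa_phase_conjV p) (cayley_conjE p) (erefl _)).
move: (cexp _) (_ ^ _) (wigner_col _ _ _ _ _ _) => x y v.
move: (cayley p ^+ _) (cayley_conj p ^+ _) (horo p ^+ _) (Num.conj _ ^+ _) => c1 c2 c3 c4.
by move: (_%:R) => u; ring.
Qed.

Lemma haar_disc lambda delta a b p :
  haar_kernel lambda delta p * disc_poly a b (cayley p) (cayley_conj p) =
  \sum_(k < a.+1) (('C(a, k) * 'C(b, k))%:R * (-1) ^+ k) *
     haar_term lambda delta (a - k) (b - k) k k p.
Proof.
rewrite /disc_poly mulr_sumr; apply: eq_bigr => k _.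
rewrite /haar_term -exprMn horo_conj.
have -> : cayley p * cayley_conj p - 1 = -1 * (1 - cayley p * cayley_conj p) by ring.
rewrite exprMn; move: (haar_kernel _ _ _) (_%:R) ((1 - _) ^+ _) (_ ^+ (a - k)) (_ ^+ (b - k)) => x u v c1 c2.
by ring.
Qed.

Lemma term_weight_diag (N0 : int) a b i : (i <= a)%N -> (i <= b)%N ->
  term_weight N0 a b i (b - i) = b%:Z + b%:Z - a%:Z - N0.
Proof. by move=> ia ib; rewrite /term_weight; lia. Qed.

(** The (i, l) term has rotation weight i - (b - l), so only i + l = b survives. On these terms the
    exponent of e^(i theta) is constant, and they reassemble into the Zernike polynomial of index
    (a, b). The sign (-1)^(a + b) comes from the block -1 of w_0 acting on polynomials of degree a +
    b. *)
Lemma wigner_col_integral lambda (N0 : int) j m1 a b A : 2 <= Re lambda -> A \in unitmx ->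
  let F p := cexp (- (lambda + 2) * (iwasawa_log (sqnorm p.1) p.2)%:C) *
    wigner_col N0 j m1 (a + b) b (A *m - kappa_mx p) in
  cintegrable haar setT F /\
  cintegral haar setT F = (-1) ^+ (a + b) * wigner_col N0 j m1 (a + b) b A *
    disc_integral lambda (b%:Z + b%:Z - a%:Z - N0) a b.
Proof.
move=> l2 uA F; set delta := (_ - N0).
pose c i l : C := (('C(a, i) * 'C(b, l))%:R * ((-1) ^+ (a - i) * (-1) ^+ i * (-1) ^+ l)) *
    wigner_col N0 j m1 (a + b) (i + l) A.
pose H i l p := haar_term lambda (term_weight N0 a b i l) (a - i) l i (b - l) p.
have FE : F = fun p => \sum_(i < a.+1) \sum_(l < b.+1) c i l * H i l p.
  by apply/funext => p; exact: wigner_kernel.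
have iH i l : cintegrable haar setT (fun p => c i l * H i l p).
  by apply: cintegrableZ; exact: cintegrable_haar_term.
have iS (i : nat) : cintegrable haar setT (fun p => \sum_(l < b.+1) c i l * H i l p).
  by apply: cintegrable_sum => l; exact: iH.
split; first by rewrite FE; apply: cintegrable_sum => i; exact: iS.
rewrite FE (cintegral_sum _ _ (fun i : 'I_a.+1 => iS i)).
have -> : disc_integral lambda delta a b = \sum_(k < a.+1)
    (('C(a, k) * 'C(b, k))%:R * (-1) ^+ k) * cintegral haar setT (haar_term lambda delta (a - k) (b - k) k k).
  rewrite /disc_integral.
  have -> : (fun p => haar_kernel lambda delta p * disc_poly a b (cayley p) (cayley_conj p)) =
    (fun p => \sum_(k < a.+1) (('C(a, k) * 'C(b, k))%:R * (-1) ^+ k) *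
     haar_term lambda delta (a - k) (b - k) k k p) by apply/funext => p; exact: haar_disc.
  rewrite (cintegral_sum _ _ (fun k : 'I_a.+1 => cintegrableZ _ (cintegrable_haar_term _ _ _ _ _ l2))).
  by apply: eq_bigr => k _; rewrite (cintegralZ _ (cintegrable_haar_term _ _ _ _ _ l2)).
rewrite [RHS]mulr_sumr; apply: eq_bigr => i _.
rewrite (cintegral_sum _ _ (fun l : 'I_b.+1 => iH i l)).
have ia : (i <= a)%N by rewrite -ltnS.
have z0 (l : 'I_b.+1) : (i + l)%N != b -> cintegral haar setT (fun p => c i l * H i l p) = 0.
  move=> il; rewrite (cintegralZ _ (cintegrable_haar_term _ _ _ _ _ l2)) cintegral_haar_term0 ?mulr0//.
  by apply: contra il => /eqP ->; have := ltn_ord l; rewrite ltnS => lb; rewrite subnK.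
have [ib|ib] := leqP i b; last first.
  have cz : ('C(a, i) * 'C(b, i))%:R = 0 :> C by rewrite (bin_small ib) muln0.
  rewrite cz big1; last by move=> l _; apply: z0; apply/eqP; lia.
  by move: (cintegral _ _ _) (wigner_col _ _ _ _ _ _) => x v; rewrite (mul0r ((-1) ^+ i)) mul0r mulr0.
have lt : (b - i < b.+1)%N by rewrite ltnS leq_subr.
rewrite (bigD1 (Ordinal lt)) //= big1; last first.
  move=> l nl; apply: z0; apply: contra nl => /eqP il.
  by apply/eqP/val_inj => /=; lia.
rewrite (addr0 (cintegral haar setT _)).
rewrite (cintegralZ _ (cintegrable_haar_term _ _ _ _ _ l2)) /H term_weight_diag// subKn// /c subnKC//.
rewrite bin_sub// -exprD subnK// -/delta.
have -> : (-1) ^+ a * (-1) ^+ (b - i) = (-1) ^+ (a + b) * (-1) ^+ i :> C.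
  rewrite -!exprD -signr_odd -[RHS]signr_odd; congr (_ ^+ nat_of_bool _).
  by rewrite !oddD oddB//; case: (odd a) (odd b) (odd i) => [] [] [].
by move: (cintegral _ _ _) (wigner_col _ _ _ _ _ _) (_%:R) => x v u; ring.
Qed.

Lemma nat_truncn (x : rat) : 0 <= x -> x \is a Num.int -> (Num.truncn x)%:R = x.
Proof. by move=> x0 xi; apply: truncnK; rewrite natrEint xi. Qed.

(** The numbers a and b are the degrees of [vbasis_ j m2] in z1 and z2, and 2 b - a - (j + n) = 3 m2
    - n. *)
Lemma wigner_index_delta (delta : int) (j n m1 m2 : rat) : wigner_index delta j n m1 m2 ->
  let a := Num.truncn (j - m2) in let b := Num.truncn (j + m2) in
  [/\ a%:R = j - m2, b%:R = j + m2 &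
      b%:Z + b%:Z - a%:Z - Num.floor (j + n) = delta].
Proof.
move=> [/andP[j0 j2] n2 jn [_ /and3P[m2l m2u m2i]] e] a b.
have hb : b%:R = j + m2 by apply: nat_truncn; [lra|rewrite addrC].
have ha : a%:R = j - m2.
  apply: nat_truncn; first by lra.
  have -> : j - m2 = 2 * j - (m2 + j) by ring.
  exact: rpredB.
split => //; apply: (@intr_inj rat).
rewrite !mulrzBr mulrzDr -!pmulrn floorK// ha hb -e.
by ring.
Qed.

Lemma Kgrp_unitmx k : Kgrp k -> toU2 k \in unitmx /\
  forall p, toU2 (k *m w0 *m kappa p) = toU2 k *m - kappa_mx p.
Proof.
move=> [A hA ->].
have tA (B : 'M[C]_2) (d : C) : toU2 (block_mx B 0 0 d%:M : 'M[C]_(2 + 1)) = B by exact: block_mxKul.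
have [_ uA] := mulmx1_unit hA.
rewrite tA; split => // p.
by rewrite w0_block mul_block /kappa mul_block tA mulmxN mulmx1 mulNmx mulmxN.
Qed.

Lemma wigner_integral lambda (delta : int) (j n m1 m2 : rat) k :
  wigner_index delta j n m1 m2 -> Kgrp k -> convergence_range lambda delta ->
  let F p := cexp (- (lambda + 2) * (iwasawa_log (sqnorm p.1) p.2)%:C) *
    wigner j n m1 m2 (k *m w0 *m kappa p) in
  let a := Num.truncn (j - m2) in let b := Num.truncn (j + m2) in
  cintegrable haar setT F /\
  cintegral haar setT F = (-1) ^+ (a + b) * haar_total lambda delta *
    disc_ratio ((lambda + delta%:~R) / 2) ((lambda - delta%:~R) / 2) a b * wigner j n m1 m2 k.
Proof.
move=> hw Kk hl F a b; have [_ _ hd] := wigner_index_delta hw.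
have [uA hA] := Kgrp_unitmx Kk; have [l4 _ _] := large_half hl.
have l2 : 2 <= Re lambda by lra.
have FE : F = fun p => wigner_norm a b * (cexp (- (lambda + 2) * (iwasawa_log (sqnorm p.1) p.2)%:C) *
    wigner_col (Num.floor (j + n)) j m1 (a + b) b (toU2 k *m - kappa_mx p)).
  by apply/funext => p; rewrite /F wigner_col_E hA -/a -/b mulrCA.
have [iF eF] := @wigner_col_integral lambda (Num.floor (j + n)) j m1 a b _ l2 uA.
split; first by rewrite FE; exact: cintegrableZ.
rewrite FE (cintegralZ _ iF) eF -/a -/b hd disc_integral_ratio// wigner_col_E -/a -/b.
move: (wigner_col _ _ _ _ _ _) (haar_total _ _) (disc_ratio _ _ _ _) (wigner_norm _ _) ((-1) ^+ _).
by move=> v x r w s; ring.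
Qed.

End WignerIntegral.

(** * Meromorphic continuation *)

Section Holomorphy.
Context {R : realType}.
Local Notation C := R[i].
Local Notation mu := (@lebesgue_measure R).
Implicit Types (f g : C -> C) (z w h : C).

Definition cderivable f z : Prop := derivable (f : C^o -> C^o) z 1.

Lemma normr_normc z : `|z| = (normc z)%:C :> C. Proof. by []. Qed.

Lemma cderivable_cst c z : cderivable (fun=> c) z.
Proof. exact: (derivable_cst (c : C^o)). Qed.

Lemma cderivable_id z : cderivable id z.
Proof. exact: derivable_id. Qed.

Lemma cderivableD f g z : cderivable f z -> cderivable g z -> cderivable (fun z => f z + g z) z.
Proof. exact: derivableD. Qed.

Lemma cderivableM f g z : cderivable f z -> cderivable g z -> cderivable (fun z => f z * g z) z.
Proof. exact: derivableM. Qed.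

Lemma cderivableV f z : f z != 0 -> cderivable f z -> cderivable (fun z => (f z)^-1) z.
Proof. exact: derivableV. Qed.

Lemma cderivableX f n z : cderivable f z -> cderivable (fun z => f z ^+ n) z.
Proof.
move=> df; elim: n => [|n IH]; first by under eq_fun do rewrite expr0; exact: cderivable_cst.
by under eq_fun do rewrite exprS; exact: cderivableM.
Qed.

Lemma cderivable_quadratic f z (D : C) (K r : R) : 0 < r ->
  (forall h, normc h <= r -> normc (f (h + z) - f z - h * D) <= K * normc h ^+ 2) ->
  cderivable f z.
Proof.
move=> r0 hq; apply/cvg_ex; exists D; apply/cvgrPdist_lt => e e0.
have [ei er] : Im e = 0 /\ 0 < Re e by move: e0; rewrite ltcE /= => /andP[/eqP -> ->].
have eE : e = (Re e)%:C by apply: complex_eqP.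
pose K' := `|K| + 1; have K'0 : 0 < K' by rewrite ltr_wpDl.
(* This radius ensures both |h| <= r, where the remainder bound holds, and K' |h| < e. *)
pose rho := Num.min r (Re e / K'); have rho0 : 0 < rho by rewrite lt_min r0 divr_gt0.
near=> h.
have h0 : h != 0 by near: h; exact: nbhs_dnbhs_neq.
have hr' : `|h| < rho%:C :> C by near: h; apply: dnbhs0_lt; rewrite ltcR.
have hr : normc h < rho by move: hr'; rewrite normr_normc ltcR.
have nh0 : 0 < normc h by rewrite lt_def normc_ge0 andbT; apply: contra h0 => /eqP/eq0_normc ->.
rewrite eE normr_normc ltcR -[_ *: _]/(h^-1 * (f (h * 1 + z) - f z)) mulr1.
have -> : D - h^-1 * (f (h + z) - f z) = - (h^-1 * (f (h + z) - f z - h * D)) by field.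
rewrite normcN normcM normcV ltr_pdivrMl//.
have := hq h; move: hr; rewrite lt_min => /andP[hr1 hr2] /(_ (ltW hr1)) hle.
apply: (le_lt_trans hle); rewrite expr2 mulrA [ltRHS]mulrC ltr_pM2r//.
apply: (@le_lt_trans _ _ (K' * normc h)).
  by apply: ler_wpM2r; [exact: ltW|rewrite (le_trans (ler_norm _))// lerDl].
by rewrite mulrC -ltr_pdivlMr.
Unshelve. all: by end_near. Qed.

Lemma log1sqr_sqr_le t : log1sqr t ^+ 2 <= 4 * expR (log1sqr t) :> R.
Proof.
have h0 := log1sqr_ge0 t; have := @exp.expR_ge1Dx R (log1sqr t / 2); move: (log1sqr t) h0 => x x0 h.
have -> : expR x = expR (x / 2) ^+ 2 by rewrite expr2 -expRD; congr expR; field.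
have : (x / 2) ^+ 2 <= expR (x / 2) ^+ 2 by rewrite ler_sqr ?nnegrE ?expR_ge0//; lra.
have -> : (x / 2) ^+ 2 = x ^+ 2 / 4 by field.
lra.
Qed.

(** Differentiation under the integral sign with an explicit remainder. With L = log(1 + t^2), the
    lambda-derivative multiplies the kernel by -L/2; for |h| <= 1 the remainder costs at most e^L
    for (L/2)^2 and e^(L/2) for the exponential, and [3 <= Re lambda] still leaves e^(-L). *)
Lemma cauchy_integral_quadratic lambda (delta : int) : 3 <= Re lambda ->
  exists D : C, exists K : R, forall h, normc h <= 1 ->
  normc (cauchy_integral (h + lambda) delta - cauchy_integral lambda delta - h * D) <= K * normc h ^+ 2.
Proof.
move=> l3.
pose d t : C := - (log1sqr t / 2)%:C * cauchy_kernel lambda delta t.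
have l0 : 0 <= Re lambda by lra.
have cd : ccontinuous d.
  move=> t; apply: ccontinuous_atM; last exact: ccontinuous_cauchy_kernel.
  have -> : (fun x : R => - (log1sqr x / 2)%:C : C) = (fun x => (- (log1sqr x / 2))%:C).
    by apply/funext => x; rewrite realcN.
  apply: ccontinuous_atR; apply: cvgN; apply: cvgM; last exact: cvg_cst.
  exact: continuous_log1sqr.
have idd : cintegrable mu setT d.
  apply: (@cintegrable_cauchy _ _ 1) => // t.
  rewrite mul1r normcM normcN normcR normc_cauchy_kernel cauchy_funE.
  have L0 := log1sqr_ge0 t; rewrite ger0_norm ?divr_ge0//.
  have h : log1sqr t / 2 <= expR (log1sqr t / 2) by have := @exp.expR_ge1Dx R (log1sqr t / 2); lra.
  apply: (le_trans (ler_wpM2r (expR_ge0 _) h)); rewrite -expRD ler_expR.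
  by nra.
exists (cintegral mu setT d), (2 * \int[mu]_t cauchy_fun t) => h h1.
have [R3 R2] : 0 <= Re (h + lambda) /\ 2 <= Re (h + lambda).
  by rewrite cReD; have := normr_Re_le h; have := ler_norm (- Re h); rewrite normrN; split; lra.
have iA := cintegrable_cauchy_kernel delta R3; have iB := cintegrable_cauchy_kernel delta l0.
have e : cauchy_integral (h + lambda) delta - cauchy_integral lambda delta - h * cintegral mu setT d =
   cintegral mu setT (fun t => cauchy_kernel (h + lambda) delta t - cauchy_kernel lambda delta t - h * d t).
  by rewrite (cintegralB (cintegrableB iA iB) (cintegrableZ h idd)) (cintegralB iA iB) (cintegralZ h idd).
have ptw t : normc (cauchy_kernel (h + lambda) delta t - cauchy_kernel lambda delta t - h * d t) <=
    normc h ^+ 2 * cauchy_fun t.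
  pose w : C := h * - (log1sqr t / 2)%:C.
  have -> : cauchy_kernel (h + lambda) delta t = cauchy_kernel lambda delta t * cexp w.
    by rewrite /cauchy_kernel -cexpD; congr cexp; rewrite /w realcM realcV realc_nat; field.
  have -> : cauchy_kernel lambda delta t * cexp w - cauchy_kernel lambda delta t - h * d t =
     cauchy_kernel lambda delta t * (cexp w - 1 - w) by rewrite /d /w; ring.
  rewrite normcM normc_cauchy_kernel cauchy_funE.
  apply: (le_trans (ler_wpM2l (expR_ge0 _) (normc_cexp_sub1B w))).
  have L0 := log1sqr_ge0 t; have nh := normc_ge0 h.
  have -> : normc w = normc h * (log1sqr t / 2).
    by rewrite /w normcM normcN normcR ger0_norm ?divr_ge0.
  have hL := log1sqr_sqr_le t.
  have ew : expR (normc h * (log1sqr t / 2)) <= expR (log1sqr t / 2).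
    by rewrite ler_expR -[leRHS]mul1r; apply: ler_wpM2r; rewrite ?divr_ge0.
  rewrite exprMn -mulrA mulrCA; apply: ler_wpM2l; first exact: sqr_ge0.
  have e0 := expR_ge0 (log1sqr t / 2).
  have step : (log1sqr t / 2) ^+ 2 * expR (normc h * (log1sqr t / 2)) <=
     expR (log1sqr t) * expR (log1sqr t / 2).
    apply: ler_pM; rewrite ?sqr_ge0 ?expR_ge0//.
    have -> : (log1sqr t / 2) ^+ 2 = log1sqr t ^+ 2 / 4 by field.
    lra.
  rewrite (le_trans (ler_wpM2l (expR_ge0 _) step))//.
  by rewrite -!expRD ler_expR; nra.
have mm : cmeasurable (fun t => cauchy_kernel (h + lambda) delta t - cauchy_kernel lambda delta t - h * d t).
  apply: cmeasurableB.
    by apply: cmeasurableB; apply: ccontinuous_measurable; exact: ccontinuous_cauchy_kernel.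
  by apply: cmeasurableM; [exact: cmeasurable_cst|exact: ccontinuous_measurable].
have := cintegral_bound (mu := mu) mm ptw (integrableMr_cauchy_fun (normc h ^+ 2)); rewrite -e.
have -> : \int[mu]_t (normc h ^+ 2 * cauchy_fun t) = normc h ^+ 2 * \int[mu]_t cauchy_fun t.
  by rewrite RintegralZl//; exact: integrable_cauchy_fun.
by rewrite (mulrC (normc h ^+ 2) _) mulrA.
Qed.

Lemma cderivable_cauchy_integral lambda (delta : int) : 3 <= Re lambda ->
  cderivable (fun z => cauchy_integral z delta) lambda.
Proof.
move=> l3; have [D [K hK]] := cauchy_integral_quadratic delta l3.
exact: (cderivable_quadratic ltr01 hK).
Qed.

Lemma cderivable_shift f (c : C) z : cderivable f (z + c) -> cderivable (fun z => f (z + c)) z.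
Proof.
move=> df; rewrite /cderivable /derivable.
rewrite [X in cvg (X @ _)](_ : _ = (fun h : C^o => h^-1 *: ((f \o shift (z + c : C^o)) (h *: 1) - f (z + c)) : C^o))//.
by apply/funext => h /=; rewrite addrA.
Qed.

End Holomorphy.

Section Meromorphy.
Context {R : realType}.
Local Notation C := R[i].
Implicit Types (f g h : C -> C) (z w : C).

Definition meromorphic_at z0 f : Prop := exists (p : nat) (h : C -> C), holomorphic_near z0 h /\
    \forall z \near (z0 : C^o)^', f z = h z / (z - z0) ^+ p.

Lemma near_dnbhs_neq z0 : \forall z \near (z0 : C^o)^', z - z0 != 0.
Proof.
have := @nbhs_dnbhs_neq _ (z0 : C^o); apply: filterS => z; by rewrite subr_eq0.
Qed.

Lemma meromorphic_at_near z0 f g : (\forall z \near (z0 : C^o)^', f z = g z) ->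
  meromorphic_at z0 g -> meromorphic_at z0 f.
Proof.
move=> fg [p [h [hh e]]]; exists p, h; split=> //.
by apply: filterS2 fg e => z -> ->.
Qed.

Lemma holomorphic_nearW z0 h : (forall z, cderivable h z) -> holomorphic_near z0 h.
Proof. by move=> hh; apply: (@filterE _ (nbhs (z0 : C^o))). Qed.

Lemma meromorphic_at_holomorphic z0 h : holomorphic_near z0 h -> meromorphic_at z0 h.
Proof.
move=> hh; exists 0, h; split=> //.
by apply: (@filterE _ ((z0 : C^o)^')) => z; rewrite expr0 divr1.
Qed.

Lemma meromorphic_at_cst z0 c : meromorphic_at z0 (fun=> c).
Proof.
by apply: meromorphic_at_holomorphic; apply: holomorphic_nearW => z; exact: cderivable_cst.
Qed.

Lemma meromorphic_atM z0 f g : meromorphic_at z0 f -> meromorphic_at z0 g ->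
  meromorphic_at z0 (fun z => f z * g z).
Proof.
move=> [p [h [hh e]]] [q [k [hk e']]]; exists (p + q)%N, (fun z => h z * k z); split.
  by apply: filterS2 hh hk => z; exact: cderivableM.
by apply: filterS2 e e' => z -> ->; rewrite exprD invfM mulrACA.
Qed.

Lemma meromorphic_atD z0 f g : meromorphic_at z0 f -> meromorphic_at z0 g ->
  meromorphic_at z0 (fun z => f z + g z).
Proof.
move=> [p [h [hh e]]] [q [k [hk e']]].
exists (p + q)%N, (fun z => h z * (z - z0) ^+ q + k z * (z - z0) ^+ p); split.
  have dX n z : cderivable (fun z => (z - z0) ^+ n) z.
    by apply: cderivableX; apply: cderivableD; [exact: cderivable_id|exact: cderivable_cst].
  by apply: filterS2 hh hk => z dh dk; exact: (cderivableD (cderivableM dh (dX q z)) (cderivableM dk (dX p z))).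
apply: filterS3 e e' (near_dnbhs_neq z0) => z -> -> nz.
have np : (z - z0) ^+ p != 0 by rewrite expf_neq0.
have nq : (z - z0) ^+ q != 0 by rewrite expf_neq0.
by rewrite exprD; field; rewrite np nq.
Qed.

Lemma meromorphic_at_sum z0 (I : Type) (s : seq I) (F : I -> C -> C) :
  (forall i, meromorphic_at z0 (F i)) -> meromorphic_at z0 (fun z => \sum_(i <- s) F i z).
Proof.
move=> hF; elim: s => [|i s IH].
  by under eq_fun do rewrite big_nil; exact: meromorphic_at_cst.
by under eq_fun do rewrite big_cons; exact: meromorphic_atD.
Qed.

Lemma meromorphic_at_prod z0 (I : Type) (s : seq I) (F : I -> C -> C) :
  (forall i, meromorphic_at z0 (F i)) -> meromorphic_at z0 (fun z => \prod_(i <- s) F i z).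
Proof.
move=> hF; elim: s => [|i s IH].
  by under eq_fun do rewrite big_nil; exact: meromorphic_at_cst.
by under eq_fun do rewrite big_cons; exact: meromorphic_atM.
Qed.

Lemma meromorphic_at_affine z0 c d : meromorphic_at z0 (fun z => c * z + d).
Proof.
apply: meromorphic_atD; last exact: meromorphic_at_cst.
apply: meromorphic_atM; first exact: meromorphic_at_cst.
by apply: meromorphic_at_holomorphic; apply: holomorphic_nearW => z; exact: cderivable_id.
Qed.

Lemma meromorphic_at_affineV z0 c d : c != 0 -> meromorphic_at z0 (fun z => (c * z + d)^-1).
Proof.
move=> c0; have [e|e] := eqVneq (c * z0 + d) 0.
  exists 1%N, (fun=> c^-1); split.
    by apply: holomorphic_nearW => z; exact: cderivable_cst.
  apply: (@filterE _ ((z0 : C^o)^')) => z; rewrite expr1 -invfM; congr (_^-1).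
  by rewrite -[LHS]subr0 -e; ring.
apply: meromorphic_at_holomorphic.
have da z : cderivable (fun z => c * z + d) z.
  apply: cderivableD; last exact: cderivable_cst.
  by apply: cderivableM; [exact: cderivable_cst|exact: cderivable_id].
have cn : {for (z0 : C^o), continuous (fun z : C^o => c * z + d : C^o)}.
  by apply: differentiable_continuous; apply/derivable1_diffP; exact: da.
have : \forall z \near (z0 : C^o), c * z + d != 0 by exact: (cvgr_neq0 _ cn e).
by apply: filterS => z nz; exact: cderivableV.
Qed.

End Meromorphy.

(** * The scalar as a meromorphic function *)

Section Scalar.
Context {R : realType}.
Local Notation C := R[i].
Implicit Types (lambda z w : C) (delta : int) (a b n : nat).

Definition halfsum lambda delta : C := (lambda + delta%:~R) / 2.
Definition halfdiff lambda delta : C := (lambda - delta%:~R) / 2.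

Definition base_scalar delta lambda : C :=
  (pi ^+ 2)%:C * cpow 2 (- lambda - 1) * Gamma lambda /
  (Gamma (1 + halfdiff lambda delta) * Gamma (1 + halfsum lambda delta)).

(* Unlike intertwining_scalar, this involves no quotient of Gamma values at
   poles, apart from base_scalar; the two agree off the integers. *)
Definition closed_scalar delta a b lambda : C :=
  base_scalar delta lambda *
  ((-1) ^+ (a + b) * disc_ratio (halfsum lambda delta) (halfdiff lambda delta) a b).

(** The Gamma factors of the formula have poles only at integral lambda. This single condition
    avoids them all, and it holds on a punctured neighbourhood of every point. *)
Definition nonint lambda : Prop := forall m : int, lambda != m%:~R.

Lemma nonint_nonpole lambda : nonint lambda -> nonpole lambda.
Proof.
move=> h n; apply/eqP => e; have /eqP := h (- n%:Z); apply.
by rewrite rmorphN /= -pmulrn; apply/eqP; rewrite -addr_eq0 e.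
Qed.

Lemma nonint_half (e e' : int) lambda : nonint lambda -> e' = 1 \/ e' = -1 ->
  nonpole (1 + e'%:~R * (lambda + e%:~R) / 2).
Proof.
move=> h e1 n; apply/eqP => hn; have /eqP := h (- e - e' * (2 * n%:Z + 2)); apply.
rewrite !(rmorphB, rmorphN, rmorphM, rmorphD) /=.
have ee : (e'%:~R : C) * e'%:~R = 1 by case: e1 => ->; rewrite ?mulr1 ?rmorphN1 ?mulrNN ?mulr1.
have -> : lambda = e'%:~R * e'%:~R * lambda by rewrite ee mul1r.
have -> : e'%:~R * e'%:~R * lambda = 2 * e'%:~R * (1 + e'%:~R * (lambda + e%:~R) / 2 + n%:R)
   - e'%:~R * e'%:~R * e%:~R - 2 * e'%:~R - 2 * e'%:~R * n%:R :> C by field.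
by rewrite hn ee -[(n%:Z)%:~R]/(n%:R); ring.
Qed.

Lemma nonint_halfsum lambda delta : nonint lambda -> nonpole (1 + halfsum lambda delta).
Proof.
by move=> h; have := @nonint_half delta 1 lambda h (or_introl erefl); rewrite mul1r.
Qed.

Lemma nonint_halfdiff lambda delta : nonint lambda -> nonpole (1 + halfdiff lambda delta).
Proof.
move=> h; have := @nonint_half (- delta) 1 lambda h (or_introl erefl).
by rewrite mul1r rmorphN.
Qed.

Lemma nonint_halfsumN lambda delta : nonint lambda -> nonpole (1 - halfsum lambda delta).
Proof.
move=> h; have := @nonint_half delta (-1) lambda h (or_intror erefl).
by rewrite rmorphN1 mulN1r mulNr.
Qed.

Lemma nonint_halfdiffN lambda delta : nonint lambda -> nonpole (1 - halfdiff lambda delta).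
Proof.
move=> h; have := @nonint_half (- delta) (-1) lambda h (or_intror erefl).
by rewrite rmorphN1 rmorphN mulN1r mulNr.
Qed.

Lemma cderivable_continuous f z : cderivable f z ->
  (f : C^o -> C^o) @ (z : C^o) --> (f z : C^o).
Proof. by move=> df; apply: differentiable_continuous; apply/derivable1_diffP. Qed.

Lemma continuous_translation (c z : C) : (fun z : C^o => z + c : C^o) @ (z : C^o) --> (z + c : C^o).
Proof.
have df : cderivable (fun z => z + c) z.
  by apply: (@cderivableD _ id (fun=> c)); [exact: cderivable_id|exact: cderivable_cst].
exact: (cderivable_continuous df).
Qed.

Lemma near_nonint z0 : \forall z \near (z0 : C^o)^', nonint z.
Proof.
have near_neq (c : C) : \forall z \near (z0 : C^o)^', z != c.
  have [->|e] := eqVneq c z0; first exact: (@nbhs_dnbhs_neq _ (z0 : C^o)).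
  apply: nbhs_dnbhs; have : \forall z \near (z0 : C^o), z - c != 0.
    have cn : (fun z : C^o => z - c : C^o) @ (z0 : C^o) --> (z0 - c : C^o).
      exact: continuous_translation.
    by apply: (cvgr_neq0 _ cn); rewrite subr_eq0 eq_sym.
  by apply: filterS => z; rewrite subr_eq0.
have nb : \forall z \near (z0 : C^o)^', `|z0 - z| < 1.
  by apply: nbhs_dnbhs; apply: (@cvgr_dist_lt _ _ _ (nbhs (z0 : C^o)) _ id z0 cvg_id).
pose n := Num.floor (Re z0).
(* At distance less than 1 from z0 the only possible integers are the floor of Re z0 and its
   successor. *)
apply: filterS3 nb (near_neq n%:~R) (near_neq (n + 1)%:~R) => z; rewrite normr_normc ltcR => hz z1 z2 m.
apply/eqP => e; have hr := normr_Re_le (z0 - z).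
have : `|Re z0 - m%:~R| < 1 by apply: le_lt_trans hz; rewrite -[m%:~R](Re_intr m) -e -cReN -cReD.
rewrite ltr_norml => /andP[h1 h2].
have /andP[f1 f2] := Num.Theory.floor_itv (Re z0); rewrite -/n in f1 f2.
have m1 : (n - 1 < m)%R by rewrite -(ltr_int R) rmorphB /=; lra.
have m2 : (m < n + 2)%R by rewrite -(ltr_int R) rmorphD /=; rewrite rmorphD /= in f2; lra.
have : m = n \/ m = n + 1 by lia.
by case=> em; [move/eqP: z1|move/eqP: z2]; rewrite e em.
Qed.

Lemma cpow2_even n lambda : cpow 2 (lambda - (n + n)%:R) = cpow 2 lambda / 4 ^+ n :> C.
Proof.
rewrite cpowD; congr (_ * _); rewrite /cpow -mulrN1 -mulrA cexp_natr -[cexp _]/(cpow 2 (-1)).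
by rewrite cpow2N1 exprD -exprMn -exprVn; congr (_ ^+ _); field.
Qed.

(* Moves lambda into the half plane where base_scalar is given by an integral. *)
Lemma base_scalar_shift delta lambda n : nonint lambda ->
  base_scalar delta lambda = base_scalar delta (lambda + (n + n)%:R) *
    (4 ^+ n * (rising (1 + halfdiff lambda delta) n * rising (1 + halfsum lambda delta) n))
    / rising lambda (n + n).
Proof.
move=> h; rewrite /base_scalar.
have e (d : int) : (lambda + (n + n)%:R + d%:~R) / 2 = (lambda + d%:~R) / 2 + n%:R.
  by rewrite natrD; field.
have -> : halfdiff (lambda + (n + n)%:R) delta = halfdiff lambda delta + n%:R.
  by rewrite /halfdiff -rmorphN e.
rewrite /halfsum e -/(halfsum lambda delta) !addrA.
have hs := nonint_halfsum delta h; have hd := nonint_halfdiff delta h; have h0 := nonint_nonpole h.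
rewrite !Gamma_rising// opprD addrAC cpow2_even.
have r1 := rising_neq0 n hs; have r2 := rising_neq0 n hd; have r3 := rising_neq0 (n + n) h0.
have g1 := Gamma_neq0 hs; have g2 := Gamma_neq0 hd.
have q4 : 4 ^+ n != 0 :> C by rewrite expf_neq0// pnatr_eq0.
move: (Gamma (1 + halfsum lambda delta)) (Gamma (1 + halfdiff lambda delta))
  (rising (1 + halfsum lambda delta) n) (rising (1 + halfdiff lambda delta) n) (rising lambda (n + n)) (4 ^+ n)
  r1 r2 r3 g1 g2 q4 => G1 G2 s1 s2 s3 q h1 h2 h3 h4 h5 h6.
by field; rewrite h1 h2 h3 h4 h5 h6.
Qed.

Lemma base_scalar_haar delta lambda : 8 + `|delta|%:~R <= Re lambda ->
  base_scalar delta lambda = haar_total lambda delta.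
Proof.
move=> h; have hl : convergence_range lambda delta by rewrite /convergence_range; lra.
have [l4 hs hd] := large_half hl.
have g1 := Gamma_neq0 (nonpole_gt0 hs); have g2 := Gamma_neq0 (nonpole_gt0 hd).
have l0 : lambda != 0 by apply: Re_gt0_neq0; lra.
have npl : nonpole lambda by apply: nonpole_gt0; lra.
rewrite /base_scalar /haar_total; apply: (mulIf (mulf_neq0 g2 g1)).
have E := cauchy_integral_gamma h; rewrite (GammaS npl) in E.
rewrite /halfdiff /halfsum divfK; last exact: mulf_neq0.
rewrite -[RHS]mulrA E (cpowD 2 (- lambda) (- 1)) cpow2N1 realcX.
by field.
Qed.

Lemma base_scalar_neq0 delta lambda : convergence_range lambda delta -> base_scalar delta lambda != 0.
Proof.
move=> hl; have [l4 hs hd] := large_half hl.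
have g1 := Gamma_neq0 (nonpole_gt0 hs); have g2 := Gamma_neq0 (nonpole_gt0 hd).
have g0 : Gamma lambda != 0 by apply: Gamma_neq0; apply: nonpole_gt0; lra.
apply: mulf_neq0; last by rewrite invr_eq0; apply: mulf_neq0.
apply: mulf_neq0 => //; apply: mulf_neq0; last exact: cexp_neq0.
by rewrite (inj_eq (@complexI _)) gt_eqF// exprn_gt0// pi_gt0.
Qed.

Lemma meromorphic_at_rising z0 (c d : C) n : meromorphic_at z0 (fun z => rising (c * z + d) n).
Proof.
by apply: meromorphic_at_prod => i; under eq_fun do rewrite -addrA; exact: meromorphic_at_affine.
Qed.

Lemma meromorphic_at_risingV z0 (c d : C) n : c != 0 ->
  meromorphic_at z0 (fun z => (rising (c * z + d) n)^-1).
Proof.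
move=> c0; rewrite /rising; under eq_fun do rewrite -prodfV.
by apply: meromorphic_at_prod => i; under eq_fun do rewrite -addrA; exact: meromorphic_at_affineV.
Qed.

Lemma meromorphic_haar_total z0 (c : C) delta : 4 <= Re (z0 + c) ->
  meromorphic_at z0 (fun z => haar_total (z + c) delta).
Proof.
move=> h4; apply: meromorphic_atM.
  apply: meromorphic_atM; first exact: meromorphic_at_cst.
  have t0 : (2 : C) != 0 by rewrite pnatr_eq0.
  by have := meromorphic_at_affineV z0 (2 * c) t0; under eq_fun do rewrite -mulrDr.
apply: meromorphic_at_holomorphic.
have nb : \forall z \near (z0 : C^o), `|z0 - z| < 1.
  by apply: (@cvgr_dist_lt _ _ _ (nbhs (z0 : C^o)) _ id z0 cvg_id).
apply: (@filterS _ (nbhs (z0 : C^o)) _ _ _ _ nb) => z; rewrite normr_normc ltcR => hz.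
apply: (@cderivable_shift _ (cauchy_integral^~ delta) c z); apply: cderivable_cauchy_integral.
have := normr_Re_le (z0 - z); have := ler_norm (Re (z0 - z)); move: h4; rewrite !cReD cReN; lra.
Qed.

Lemma meromorphic_base_scalar delta : meromorphic (base_scalar delta).
Proof.
(* The margin of 1 over the bound 8 of [base_scalar_haar] lets the identification hold on the whole
   unit disc around z0. *)
move=> z0; have [n hn] := exists_nat_Re_ge z0 (9 + `|delta|%:~R).
have hn2 : 9 + `|delta|%:~R <= Re (z0 + (n + n)%:R).
  by apply: (le_trans hn); rewrite !cReD !Re_nat lerD2l ler_nat leq_addr.
have d0 : (0 : R) <= `|delta|%:~R by rewrite ler0z.
change (meromorphic_at z0 (base_scalar delta)).
apply: (@meromorphic_at_near _ z0 _ (fun z => haar_total (z + (n + n)%:R) delta *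
    (4 ^+ n * (rising (1 + halfdiff z delta) n * rising (1 + halfsum z delta) n)) * (rising z (n + n))^-1)).
  have nb : \forall z \near (z0 : C^o)^', `|z0 - z| < 1.
    by apply: nbhs_dnbhs; apply: (@cvgr_dist_lt _ _ _ (nbhs (z0 : C^o)) _ id z0 cvg_id).
  apply: filterS2 nb (near_nonint z0) => z; rewrite normr_normc ltcR => hz nz.
  rewrite (base_scalar_shift delta n nz) base_scalar_haar//.
  by have := normr_Re_le (z0 - z); have := ler_norm (Re (z0 - z)); move: hn2; rewrite !cReD cReN; lra.
have h2 : (2^-1 : C) != 0 by rewrite invr_eq0 pnatr_eq0.
apply: meromorphic_atM; first apply: meromorphic_atM.
- by apply: meromorphic_haar_total; lra.
- apply: meromorphic_atM; first exact: meromorphic_at_cst.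
  apply: meromorphic_atM.
    have -> : (fun z => rising (1 + halfdiff z delta) n) =
      (fun z => rising (2^-1 * z + (1 - delta%:~R / 2)) n).
      by apply/funext => z; congr rising; rewrite /halfdiff; field.
    exact: meromorphic_at_rising.
  have -> : (fun z => rising (1 + halfsum z delta) n) =
      (fun z => rising (2^-1 * z + (1 + delta%:~R / 2)) n).
    by apply/funext => z; congr rising; rewrite /halfsum; field.
  exact: meromorphic_at_rising.
- have -> : (fun z : C => (rising z (n + n))^-1) = (fun z => (rising (1 * z + 0) (n + n))^-1).
    by apply/funext => z; rewrite mul1r addr0.
  by apply: meromorphic_at_risingV; exact: oner_neq0.
Qed.

Lemma meromorphic_closed_scalar delta a b : meromorphic (closed_scalar delta a b).
Proof.
move=> z0; change (meromorphic_at z0 (closed_scalar delta a b)).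
apply: meromorphic_atM; first exact: meromorphic_base_scalar.
apply: meromorphic_atM; first exact: meromorphic_at_cst.
have h2 : (2^-1 : C) != 0 by rewrite invr_eq0 pnatr_eq0.
have e1 z : 1 - halfsum z delta = - 2^-1 * z + (1 - delta%:~R / 2) by rewrite /halfsum; field.
have e2 z : 1 - halfdiff z delta = - 2^-1 * z + (1 + delta%:~R / 2) by rewrite /halfdiff; field.
have e3 z : 1 + halfdiff z delta = 2^-1 * z + (1 - delta%:~R / 2) by rewrite /halfdiff; field.
have e4 z : 1 + halfsum z delta = 2^-1 * z + (1 + delta%:~R / 2) by rewrite /halfsum; field.
have -> : (fun z => disc_ratio (halfsum z delta) (halfdiff z delta) a b) =
   (fun z => ((-1) ^+ (a + b) * (rising (- 2^-1 * z + (1 - delta%:~R / 2)) b *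
      rising (- 2^-1 * z + (1 + delta%:~R / 2)) a)) *
      ((rising (2^-1 * z + (1 - delta%:~R / 2)) b)^-1 * (rising (2^-1 * z + (1 + delta%:~R / 2)) a)^-1)).
  by apply/funext => z; rewrite /disc_ratio e1 e2 e3 e4 invfM.
apply: meromorphic_atM; last by apply: meromorphic_atM; exact: meromorphic_at_risingV.
apply: meromorphic_atM; first exact: meromorphic_at_cst.
by apply: meromorphic_atM; exact: meromorphic_at_rising.
Qed.

(** As j + m2 and j - m2 are the natural numbers b and a, the last four Gamma factors are Gamma at 1
    - A, 1 - B, 1 + B and 1 + A times Pochhammer symbols. The values at 1 - A and 1 - B cancel
    against the first denominator, and the two signs (-1)^(a + b) cancel each other. *)
Lemma intertwining_scalar_closed delta (j m2 : rat) a b lambda : nonint lambda ->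
  a%:R = j - m2 -> b%:R = j + m2 ->
  intertwining_scalar delta j m2 lambda = closed_scalar delta a b lambda.
Proof.
move=> h ha hb; rewrite /intertwining_scalar /closed_scalar /base_scalar /disc_ratio.
have -> : ratr j + ratr m2 = b%:R :> C by rewrite -rmorphD /= -hb ratr_nat.
have -> : ratr j - ratr m2 = a%:R :> C by rewrite -rmorphB /= -ha ratr_nat.
rewrite -/(halfsum lambda delta) -/(halfdiff lambda delta).
have e1 (x y : C) : x - y + 1 = 1 - y + x by ring.
have e2 (x y : C) : x + y + 1 = 1 + y + x by ring.
have h1 := nonint_halfsum delta h; have h2 := nonint_halfdiff delta h.
have h3 := nonint_halfsumN delta h; have h4 := nonint_halfdiffN delta h.
rewrite !e1 !e2 !Gamma_rising//.
have g1 := Gamma_neq0 h1; have g2 := Gamma_neq0 h2; have g3 := Gamma_neq0 h3; have g4 := Gamma_neq0 h4.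
have r1 := rising_neq0 a h1; have r2 := rising_neq0 b h2.
have ss : (-1) ^+ (a + b) * (-1) ^+ (a + b) = 1 :> C by rewrite -exprMn mulrNN mulr1 expr1n.
rewrite [(-1) ^+ _ * (_ / _)]mulrA [(-1) ^+ _ * (_ * _)]mulrA ss mul1r.
move: (Gamma (1 + halfsum lambda delta)) (Gamma (1 + halfdiff lambda delta)) (Gamma (1 - halfsum lambda delta))
  (Gamma (1 - halfdiff lambda delta)) g1 g2 g3 g4.
move: (rising (1 + halfsum lambda delta) a) (rising (1 + halfdiff lambda delta) b) r1 r2.
move=> r1 r2 r10 r20 G1 G2 G3 G4 g1 g2 g3 g4.
by field; rewrite g1 g2 g3 g4 r10 r20.
Qed.

End Scalar.

(** * Rational functions that vanish at all large natural numbers *)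

Section Rational.
Context {R : realType}.
Local Notation C := R[i].
Implicit Types (S : C -> Prop) (g : C -> C) (z c d : C).

Definition rational_on S g : Prop := exists P Q : {poly C},
  forall z, S z -> Q.[z] != 0 /\ g z = P.[z] / Q.[z].

Lemma rational_affine S c d : rational_on S (fun z => c * z + d).
Proof.
exists (c%:P * 'X + d%:P), 1 => z _.
by rewrite !hornerE oner_neq0 divr1.
Qed.

Lemma rational_cst S c : rational_on S (fun=> c).
Proof. by exists c%:P, 1 => z _; rewrite !hornerE oner_neq0 divr1. Qed.

Lemma rationalD S g1 g2 : rational_on S g1 -> rational_on S g2 -> rational_on S (fun z => g1 z + g2 z).
Proof.
move=> [P1 [Q1 h1]] [P2 [Q2 h2]]; exists (P1 * Q2 + P2 * Q1), (Q1 * Q2) => z Sz.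
have [n1 ->] := h1 z Sz; have [n2 ->] := h2 z Sz.
by rewrite hornerD !hornerM mulf_neq0//; split => //; field; rewrite n1 n2.
Qed.

Lemma rationalM S g1 g2 : rational_on S g1 -> rational_on S g2 -> rational_on S (fun z => g1 z * g2 z).
Proof.
move=> [P1 [Q1 h1]] [P2 [Q2 h2]]; exists (P1 * P2), (Q1 * Q2) => z Sz.
have [n1 ->] := h1 z Sz; have [n2 ->] := h2 z Sz.
by rewrite !hornerM mulf_neq0//; split => //; field; rewrite n1 n2.
Qed.

Lemma rationalV S g : rational_on S g -> (forall z, S z -> g z != 0) -> rational_on S (fun z => (g z)^-1).
Proof.
move=> [P [Q h]] g0; exists Q, P => z Sz; have [n e] := h z Sz.
by have := g0 z Sz; rewrite e mulf_eq0 negb_or => /andP[p0 _]; rewrite invf_div.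
Qed.

Lemma rational_sum S (I : Type) (s : seq I) (F : I -> C -> C) :
  (forall i, rational_on S (F i)) -> rational_on S (fun z => \sum_(i <- s) F i z).
Proof.
move=> hF; elim: s => [|i s IH].
  by under eq_fun do rewrite big_nil; exact: rational_cst.
by under eq_fun do rewrite big_cons; exact: rationalD.
Qed.

Lemma rational_rising S c d n : rational_on S (fun z => rising (c * z + d) n).
Proof.
elim: n => [|n IH]; first by under eq_fun do rewrite rising0; exact: rational_cst.
under eq_fun do rewrite risingS -addrA; apply: rationalM => //; exact: rational_affine.
Qed.

(** An algebraic substitute for the identity theorem: the numerator has more roots than its degree
    allows, so it is the zero polynomial. *)
Lemma rational_eq0 S g (N : nat) : rational_on S g ->
  (forall n, (N <= n)%N -> S n%:R /\ g n%:R = 0) -> forall z, S z -> g z = 0.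
Proof.
move=> [P [Q h]] hN z Sz.
have P0 : P = 0.
  apply/eqP/negPn/negP => Pn0.
  have := @max_poly_roots _ P [seq (N + i)%:R | i <- iota 0 (size P)] Pn0.
  rewrite size_map size_iota ltnn => h'; have // : false; apply: h'.
    apply/allP => x /mapP[i _ ->]; apply/rootP.
    have [Sn gn] := hN (N + i)%N (leq_addr _ _); have [qn e] := h _ Sn.
    by move/eqP: gn; rewrite e mulf_eq0 invr_eq0 (negbTE qn) orbF => /eqP.
  rewrite map_inj_uniq ?iota_uniq// => i i' /eqP; rewrite eqr_nat => /eqP; exact: addnI.
by have [_ ->] := h z Sz; rewrite P0 horner0 mul0r.
Qed.

End Rational.

Lemma cintegral_cst0 (R : realType) d (T : measurableType d) (m : {measure set T -> \bar R}) :
  cintegrable m setT (fun=> 0 : R[i]) /\ cintegral m setT (fun=> 0 : R[i]) = 0.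
Proof.
split; first exact: cintegrable0.
have h := cintegralZ 0 (cintegrable0 m); rewrite [RHS]mul0r in h; rewrite -[RHS]h.
by congr cintegral; apply/funext => x; rewrite mul0r.
Qed.

(** * The operator on the span of the Wigner functions *)

Section Operator.
Context {R : realType}.
Local Notation C := R[i].
Local Notation M3 := 'M[C]_3.
Local Notation mu := (@lebesgue_measure R).
Local Notation haar := ((mu \x mu) \x mu)%E.
Local Notation index := (rat * rat * rat * rat)%type.
Variable delta : int.
Implicit Types (lambda : C) (k : M3) (q : index) (s : seq (C * index)) (phi : M3 -> C).

Definition wigner_of q k : C := wigner q.1.1.1 q.1.1.2 q.1.2 q.2 k.

Definition index_ok q : Prop := wigner_index delta q.1.1.1 q.1.1.2 q.1.2 q.2.

Definition z1_degree q : nat := Num.truncn (q.1.1.1 - q.2).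
Definition z2_degree q : nat := Num.truncn (q.1.1.1 + q.2).

Definition ratio q lambda : C := (-1) ^+ (z1_degree q + z2_degree q) *
  disc_ratio (halfsum lambda delta) (halfdiff lambda delta) (z1_degree q) (z2_degree q).

(** An expansion is a list of coefficients with indices: lists of all lengths form one type, from
    which a choice can be made, and integrals of expansions are computed by induction on the
    list. *)
Definition span_rep phi s : Prop := (forall x, x \in s -> index_ok x.2) /\
  forall k, Kgrp k -> phi k = \sum_(x <- s) x.1 * wigner_of x.2 k.

Lemma span_integral s k lambda : (forall x, x \in s -> index_ok x.2) -> Kgrp k ->
  convergence_range lambda delta ->
  let F p := cexp (- (lambda + 2) * (iwasawa_log (sqnorm p.1) p.2)%:C) *
    \sum_(x <- s) x.1 * wigner_of x.2 (k *m w0 *m kappa p) in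
  cintegrable haar setT F /\
  cintegral haar setT F = haar_total lambda delta * \sum_(x <- s) x.1 * ratio x.2 lambda * wigner_of x.2 k.
Proof.
move=> hs Kk hl; elim: s hs => [|x s IH] hs F.
  have [i0 e0] := cintegral_cst0 haar.
  have FE : F = fun=> 0 by apply/funext => p; rewrite /F big_nil mulr0.
  by rewrite big_nil mulr0 FE.
have [iF eF] := IH (fun y ys => hs y (@mem_behead _ (x :: s) y ys)).
have [iG eG] := wigner_integral (hs x (mem_head _ _)) Kk hl.
have FE : F = fun p => x.1 * (cexp (- (lambda + 2) * (iwasawa_log (sqnorm p.1) p.2)%:C) *
    wigner_of x.2 (k *m w0 *m kappa p)) +
   cexp (- (lambda + 2) * (iwasawa_log (sqnorm p.1) p.2)%:C) *
    \sum_(x <- s) x.1 * wigner_of x.2 (k *m w0 *m kappa p).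
  by apply/funext => p; rewrite /F big_cons mulrDr mulrCA.
rewrite FE; split; first by apply: cintegrableD => //; exact: cintegrableZ.
rewrite (cintegralD (cintegrableZ x.1 iG) iF) (cintegralZ x.1 iG) eF eG big_cons.
rewrite -/(z1_degree x.2) -/(z2_degree x.2) /ratio /wigner_of -/(halfsum lambda delta) -/(halfdiff lambda delta).
move: (\sum_(_ <- _) _) (wigner _ _ _ _ _) (haar_total _ _) (disc_ratio _ _ _ _) ((-1) ^+ _) => u v w r e.
by ring.
Qed.

Definition ratio_regular lambda : Prop :=
  nonpole (1 + halfsum lambda delta) /\ nonpole (1 + halfdiff lambda delta).

Lemma rational_ratio q : rational_on ratio_regular (ratio q).
Proof.
have e1 z : 1 - halfsum z delta = - 2^-1 * z + (1 - delta%:~R / 2) by rewrite /halfsum; field.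
have e2 z : 1 - halfdiff z delta = - 2^-1 * z + (1 + delta%:~R / 2) by rewrite /halfdiff; field.
have e3 z : 1 + halfdiff z delta = 2^-1 * z + (1 - delta%:~R / 2) by rewrite /halfdiff; field.
have e4 z : 1 + halfsum z delta = 2^-1 * z + (1 + delta%:~R / 2) by rewrite /halfsum; field.
apply: rationalM; first exact: rational_cst.
apply: rationalM.
  apply: rationalM; first exact: rational_cst.
  by apply: rationalM; [under eq_fun do rewrite e1|under eq_fun do rewrite e2]; exact: rational_rising.
apply: rationalV.
  by apply: rationalM; [under eq_fun do rewrite e3|under eq_fun do rewrite e4]; exact: rational_rising.
by move=> z [g1 g2]; rewrite mulf_neq0 ?rising_neq0.
Qed.

(* The Wigner functions need not be known to be linearly independent: in the range
   of convergence both sides come from the same integral, and the identity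
   extends because both sides are rational in lambda. *)
Lemma span_rep_unique phi s s' lambda k : span_rep phi s -> span_rep phi s' -> Kgrp k -> ratio_regular lambda ->
  \sum_(x <- s) x.1 * ratio x.2 lambda * wigner_of x.2 k =
  \sum_(x <- s') x.1 * ratio x.2 lambda * wigner_of x.2 k.
Proof.
move=> [hs es] [hs' es'] Kk gl; apply: subr0_eq.
pose g z := \sum_(x <- s) x.1 * ratio x.2 z * wigner_of x.2 k +
  (-1) * \sum_(x <- s') x.1 * ratio x.2 z * wigner_of x.2 k.
have rs (t : seq (C * index)) : rational_on ratio_regular (fun z => \sum_(x <- t) x.1 * ratio x.2 z * wigner_of x.2 k).
  apply: rational_sum => x; apply: rationalM; last exact: rational_cst.
  by apply: rationalM; [exact: rational_cst|exact: rational_ratio].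
have rg : rational_on ratio_regular g.
  by apply: rationalD => //; apply: rationalM => //; exact: rational_cst.
rewrite -[- _]mulN1r -/(g lambda); apply: (rational_eq0 (N := (8 + `|delta|)%N) rg) => // n hn.
have hn8 : 8 + `|delta|%:~R <= Re (n%:R : C).
  rewrite Re_nat -(ler_nat R) natrD in hn *; apply: le_trans hn.
  by rewrite lerD2l -[`|delta|%R]/(`|delta|%N%:Z) abszE.
have hl : convergence_range (n%:R : C) delta by rewrite /convergence_range; apply: le_trans hn8; rewrite lerD2r ler_nat.
have [_ h1 h2] := large_half hl.
split; first by split; apply: nonpole_gt0.
(* Both expansions give the same integral, equal to this total times the respective sum; the sums
   agree once the total is cancelled. *)
have h0 : haar_total (n%:R : C) delta != 0.
  by rewrite -(base_scalar_haar hn8); exact: base_scalar_neq0.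
have [_ e1] := span_integral hs Kk hl; have [_ e2] := span_integral hs' Kk hl.
have e : (fun p : R * R * R => cexp (- ((n%:R : C) + 2) * (iwasawa_log (sqnorm p.1) p.2)%:C) *
    \sum_(x <- s) x.1 * wigner_of x.2 (k *m w0 *m kappa p)) =
  (fun p => cexp (- ((n%:R : C) + 2) * (iwasawa_log (sqnorm p.1) p.2)%:C) *
    \sum_(x <- s') x.1 * wigner_of x.2 (k *m w0 *m kappa p)).
  apply/funext => p; congr (_ * _).
  have Kp : Kgrp (k *m w0 *m kappa p).
    by apply: Kgrp_mul; [apply: Kgrp_mul => //; exact: Kgrp_w0|exact: Kgrp_kappa].
  by rewrite -(es _ Kp) (es' _ Kp).
by rewrite e e2 in e1; rewrite /g (mulfI h0 e1) mulN1r subrr.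
Qed.

(** Outside [wigner_span] the default is the empty list, and the operator below takes the value
    0. *)
Definition chosen_rep phi : seq (C * index) := xget [::] [set s | span_rep phi s].

Lemma wigner_spanP phi : wigner_span delta phi -> span_rep phi (chosen_rep phi).
Proof.
move=> [r [c [j [n [m1 [m2 [hi he]]]]]]].
have : span_rep phi [seq (c i, (j i, n i, m1 i, m2 i)) | i <- enum 'I_r].
  split=> [x /mapP[i _ ->]|k Kk]; first exact: hi.
  by rewrite he// big_map big_enum.
move=> h; exact: (@xgetPex _ [::] [set s | span_rep phi s] (ex_intro _ _ h)).
Qed.

Lemma span_rep_wigner_span phi s : span_rep phi s -> wigner_span delta phi.
Proof.
move=> [hs es]; pose x0 : C * index := (0, (0, 0, 0, 0)).
exists (size s), (fun i => (nth x0 s i).1), (fun i => (nth x0 s i).2.1.1.1),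
  (fun i => (nth x0 s i).2.1.1.2), (fun i => (nth x0 s i).2.1.2), (fun i => (nth x0 s i).2.2).
split=> [i|k Kk]; first exact: (hs _ (mem_nth x0 (ltn_ord i))).
by rewrite es// (big_nth x0) big_mkord.
Qed.

Definition intertwiner lambda phi k : C :=
  \sum_(x <- chosen_rep phi) x.1 * closed_scalar delta (z1_degree x.2) (z2_degree x.2) lambda * wigner_of x.2 k.

Lemma intertwiner_base lambda phi k : intertwiner lambda phi k = base_scalar delta lambda *
  \sum_(x <- chosen_rep phi) x.1 * ratio x.2 lambda * wigner_of x.2 k.
Proof.
rewrite /intertwiner mulr_sumr; apply: eq_bigr => x _.
by rewrite /closed_scalar -/(ratio x.2 lambda) mulrCA !mulrA.
Qed.

Lemma intertwiner_span lambda phi : wigner_span delta phi -> wigner_span delta (intertwiner lambda phi).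
Proof.
move=> /wigner_spanP[hs _].
apply: (@span_rep_wigner_span _
  [seq (x.1 * closed_scalar delta (z1_degree x.2) (z2_degree x.2) lambda, x.2) | x <- chosen_rep phi]).
split=> [x /mapP[y ys ->]|k Kk]; first exact: (hs y ys).
by rewrite big_map.
Qed.

Lemma intertwiner_integral lambda f phi k : 8 + `|delta|%:~R < Re lambda ->
  principal_series delta lambda f -> wigner_span delta phi ->
  (forall k, Kgrp k -> f k = phi k) -> Kgrp k ->
  intertwining_converges f k /\ intertwiner lambda phi k = intertwining_integral f k.
Proof.
move=> hl hf /wigner_spanP[hs es] ff Kk; have hl' := ltW hl.
have lg : convergence_range lambda delta by rewrite /convergence_range; lra.
have [iF eF] := span_integral hs Kk lg.
have e : intertwining_integrand f k = fun p => cexp (- (lambda + 2) * (iwasawa_log (sqnorm p.1) p.2)%:C) *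
    \sum_(x <- chosen_rep phi) x.1 * wigner_of x.2 (k *m w0 *m kappa p).
  apply/funext => p; rewrite /intertwining_integrand (principal_series_nbar p hf Kk).
  have Kp : Kgrp (k *m w0 *m kappa p).
    by apply: Kgrp_mul; [apply: Kgrp_mul => //; exact: Kgrp_w0|exact: Kgrp_kappa].
  congr (_ * _).
  exact: (etrans (ff _ Kp) (es _ Kp)).
rewrite /intertwining_converges /intertwining_integral e; split => //.
by rewrite eF intertwiner_base base_scalar_haar.
Qed.

Lemma meromorphic_intertwiner phi k : meromorphic (fun lambda => intertwiner lambda phi k).
Proof.
move=> z0; apply: meromorphic_at_sum => x.
apply: meromorphic_atM; last exact: meromorphic_at_cst.
apply: meromorphic_atM; first exact: meromorphic_at_cst.
exact: meromorphic_closed_scalar.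
Qed.

Lemma intertwiner_wigner j n m1 m2 k lambda : wigner_index delta j n m1 m2 -> Kgrp k -> nonint lambda ->
  intertwiner lambda (wigner j n m1 m2) k =
  intertwining_scalar delta j m2 lambda * wigner j n m1 m2 k.
Proof.
move=> hw Kk nl; pose q : index := (j, n, m1, m2).
have r1 : span_rep (wigner j n m1 m2) [:: (1, q)].
  split=> [x|k' _]; first by rewrite inE => /eqP ->.
  by rewrite big_seq1 mul1r.
have r2 := wigner_spanP (span_rep_wigner_span r1).
have gl : ratio_regular lambda by split; [exact: nonint_halfsum|exact: nonint_halfdiff].
rewrite intertwiner_base (span_rep_unique r2 r1 Kk gl) big_seq1 mul1r.
have [ha hb _] := wigner_index_delta hw.
by rewrite (intertwining_scalar_closed delta nl ha hb) /closed_scalar mulrA.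
Qed.

End Operator.

End Proofs.
Import Proofs.

Theorem theorem1p3 (R : realType) (delta : int) :
  exists A : R[i] -> ('M[R[i]]_3 -> R[i]) -> ('M[R[i]]_3 -> R[i]),
    long_intertwining_operator delta A /\
    forall j n m1 m2 : rat, wigner_index delta j n m1 m2 ->
      mero_eq Kgrp (fun lambda k => A lambda (wigner j n m1 m2) k)
              (fun lambda k =>
                 intertwining_scalar delta j m2 lambda * wigner j n m1 m2 k).
Proof.
exists (@intertwiner R delta); split.
  split.
  - by move=> lambda phi; exact: intertwiner_span.
  - exists (8 + `|delta|%:~R) => lambda hl f phi hf hphi ff k Kk.
    exact: (intertwiner_integral hl hf hphi ff Kk).
  - by move=> phi k _ _; exact: meromorphic_intertwiner.
move=> j n m1 m2 hw z0; have := near_nonint z0; apply: filterS => lambda nl k Kk.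
exact: intertwiner_wigner.
Qed.
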